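(* There is an efficiently computable function $g$ such that for every constant $\epsilon>0$ there is an algorithm running in time $g(n,\epsilon)\cdot\mathrm{poly}(m)$ that outputs a $(1+\epsilon)$-approximate solution to any instance of the Pure Fixed Charge Transportation (PFCT) problem with $n$ sources and $m$ sinks.
   Context: PFCT: we are given a set $S$ of $n$ sources and a set $T$ of $m$ sinks; each source $i$ has supply $a_i\in\mathbb{Z}_{>0}$, each sink $j$ has demand $b_j\in\mathbb{Z}_{>0}$, with $\sum_{i\in S}a_i=\sum_{j\in T}b_j$; every pair $(i,j)\in S\times T$ has a fixed cost $f_{ij}\ge0$. Feasible solutions are $x\in\mathcal{X}=\{x\in\mathbb{R}_{\ge0}^{S\times T}:\sum_{j}x_{ij}=a_i\ \forall i,\ \sum_i x_{ij}=b_j\ \forall j\}$ and the cost of $x$ is $\sum_{i,j}\mathbf{1}_{x_{ij}>0}f_{ij}$, to be minimized. A $(1+\epsilon)$-approximate solution is a feasible solution of cost at most $(1+\epsilon)$ times the optimum. *)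

(* Defs.v *)
From mathcomp Require Import all_boot all_order all_algebra.
From mathcomp Require Import reals.

Set Implicit Arguments.
Unset Strict Implicit.
Unset Printing Implicit Defensive.

Import Order.TTheory GRing.Theory Num.Theory.
Local Open Scope ring_scope.

Record pfct (R : realType) (n m : nat) := Pfct {
  supply : 'I_n -> nat;
  demand : 'I_m -> nat;
  fixed_cost : 'I_n -> 'I_m -> R;
  supply_gt0 : forall i, (0 < supply i)%N;
  demand_gt0 : forall j, (0 < demand j)%N;
  supply_demand : (\sum_i supply i = \sum_j demand j)%N;
  fixed_cost_ge0 : forall i j, 0 <= fixed_cost i j
}.

Section Solutions.
Variables (R : realType) (n m : nat) (I : pfct R n m).

Definition feasible (x : 'M[R]_(n, m)) : Prop :=
  [/\ forall i j, 0 <= x i j,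
      forall i, \sum_j x i j = (supply I i)%:R
    & forall j, \sum_i x i j = (demand I j)%:R].

Definition cost (x : 'M[R]_(n, m)) : R :=
  \sum_i \sum_j (if 0 < x i j then fixed_cost I i j else 0).

Definition optimal (x : 'M[R]_(n, m)) : Prop :=
  feasible x /\ forall y, feasible y -> cost x <= cost y.

Definition approx_solution (eps : R) (x : 'M[R]_(n, m)) : Prop :=
  feasible x /\ exists2 y, optimal y & cost x <= (1 + eps) * cost y.

End Solutions.

(* Programs run on a real RAM, presented as a structured language.  It has two
   unbounded memories, one of natural numbers, used for addresses and counters,
   and one of real numbers.  Every operation costs one time unit.  Two
   restrictions keep this cost measure meaningful:
   - naturals are only added, subtracted (truncated) and compared, so that a
     natural computed in time [t] has O(t) bits more than the input naturals;
   - reals are subject to the field operations and comparisons only: there is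
     no rounding and no conversion from reals to naturals.
   The constants of a program are natural numbers, so a program cannot hide
   an infinite amount of information in a real constant. *)

Inductive nexp :=
| NConst of nat
| NLoad of nexp
| NAdd of nexp & nexp
| NSub of nexp & nexp.

Inductive rexp :=
| RNat of nexp
| RLoad of nexp
| RAdd of rexp & rexp
| RSub of rexp & rexp
| RMul of rexp & rexp
| RDiv of rexp & rexp.

Inductive bexp :=
| BNLe of nexp & nexp
| BRLe of rexp & rexp
| BNot of bexp
| BAnd of bexp & bexp.

(* [NStore e1 e2] and [RStore e1 e2] write the value of [e2] at address [e1]. *)
Inductive cmd :=
| Skip
| NStore of nexp & nexp
| RStore of nexp & rexp
| Seq of cmd & cmd
| If of bexp & cmd & cmd
| While of bexp & cmd.

Fixpoint ncost (e : nexp) : nat :=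
  match e with
  | NConst _ => 1
  | NLoad e1 => (ncost e1).+1
  | NAdd e1 e2 | NSub e1 e2 => (ncost e1 + ncost e2).+1
  end.

Fixpoint rcost (e : rexp) : nat :=
  match e with
  | RNat e1 | RLoad e1 => (ncost e1).+1
  | RAdd e1 e2 | RSub e1 e2 | RMul e1 e2 | RDiv e1 e2 =>
      (rcost e1 + rcost e2).+1
  end.

Fixpoint bcost (e : bexp) : nat :=
  match e with
  | BNLe e1 e2 => (ncost e1 + ncost e2).+1
  | BRLe e1 e2 => (rcost e1 + rcost e2).+1
  | BNot e1 => (bcost e1).+1
  | BAnd e1 e2 => (bcost e1 + bcost e2).+1
  end.

Section Semantics.
Variable R : realType.

Record state := State { nmem : nat -> nat; rmem : nat -> R }.

Definition upd (T : Type) (f : nat -> T) (k : nat) (v : T) : nat -> T :=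
  fun l => if l == k then v else f l.

Fixpoint neval (s : state) (e : nexp) : nat :=
  match e with
  | NConst k => k
  | NLoad e1 => nmem s (neval s e1)
  | NAdd e1 e2 => (neval s e1 + neval s e2)%N
  | NSub e1 e2 => (neval s e1 - neval s e2)%N
  end.

(* Division by zero yields zero. *)
Fixpoint reval (s : state) (e : rexp) : R :=
  match e with
  | RNat e1 => (neval s e1)%:R
  | RLoad e1 => rmem s (neval s e1)
  | RAdd e1 e2 => reval s e1 + reval s e2
  | RSub e1 e2 => reval s e1 - reval s e2
  | RMul e1 e2 => reval s e1 * reval s e2
  | RDiv e1 e2 => reval s e1 / reval s e2
  end.

Fixpoint beval (s : state) (e : bexp) : bool :=
  match e with
  | BNLe e1 e2 => (neval s e1 <= neval s e2)%N
  | BRLe e1 e2 => reval s e1 <= reval s e2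
  | BNot e1 => ~~ beval s e1
  | BAnd e1 e2 => beval s e1 && beval s e2
  end.

(* [exec c s t s']: started in state [s], the program [c] halts after exactly
   [t] time units, in state [s']. *)
Inductive exec : cmd -> state -> nat -> state -> Prop :=
| ExSkip s : exec Skip s 1 s
| ExNStore e1 e2 s :
    exec (NStore e1 e2) s (ncost e1 + ncost e2).+1
         (State (upd (nmem s) (neval s e1) (neval s e2)) (rmem s))
| ExRStore e1 e2 s :
    exec (RStore e1 e2) s (ncost e1 + rcost e2).+1
         (State (nmem s) (upd (rmem s) (neval s e1) (reval s e2)))
| ExSeq c1 c2 s t1 s1 t2 s2 :
    exec c1 s t1 s1 -> exec c2 s1 t2 s2 -> exec (Seq c1 c2) s (t1 + t2) s2
| ExIfT b c1 c2 s t s1 :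
    beval s b -> exec c1 s t s1 -> exec (If b c1 c2) s (bcost b + t).+1 s1
| ExIfF b c1 c2 s t s1 :
    ~~ beval s b -> exec c2 s t s1 -> exec (If b c1 c2) s (bcost b + t).+1 s1
| ExWhileF b c s :
    ~~ beval s b -> exec (While b c) s (bcost b).+1 s
| ExWhileT b c s t1 s1 t2 s2 :
    beval s b -> exec c s t1 s1 -> exec (While b c) s1 t2 s2 ->
    exec (While b c) s (bcost b + t1 + t2).+1 s2.

Lemma exec_det c s t s1 t' s2 :
  exec c s t s1 -> exec c s t' s2 -> t = t' /\ s1 = s2.
Proof.
move=> E; elim: E t' s2 => {c s t s1}.
- by move=> s t' s2 E; inversion E.
- by move=> e1 e2 s t' s2 E; inversion E.
- by move=> e1 e2 s t' s2 E; inversion E.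
- move=> c1 c2 s t1 s1 t2 s2 _ IH1 _ IH2 t' s' E.
  inversion E as [| | |? ? ? u1 r1 u2 r2 E1 E2| | | |]; subst.
  by case: (IH1 _ _ E1) => ? ?; subst; case: (IH2 _ _ E2) => -> ->.
- move=> b c1 c2 s t s1 sb _ IH t' s' E.
  inversion E as [| | | |? ? ? ? u r sb' E1|? ? ? ? u r sb' E1| |]; subst.
    by case: (IH _ _ E1) => -> ->.
  by rewrite sb in sb'.
- move=> b c1 c2 s t s1 sb _ IH t' s' E.
  inversion E as [| | | |? ? ? ? u r sb' E1|? ? ? ? u r sb' E1| |]; subst.
    by rewrite sb' in sb.
  by case: (IH _ _ E1) => -> ->.
- move=> b c s sb t' s' E.
  inversion E as [| | | | | |? ? ? sb'|? ? ? u1 r1 u2 r2 sb' E1 E2]; subst.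
    by [].
  by rewrite sb' in sb.
- move=> b c s t1 s1 t2 s2 sb _ IH1 _ IH2 t' s' E.
  inversion E as [| | | | | |? ? ? sb'|? ? ? u1 r1 u2 r2 sb' E1 E2]; subst.
    by rewrite sb in sb'.
  by case: (IH1 _ _ E1) => ? ?; subst; case: (IH2 _ _ E2) => -> ->.
Qed.

Definition load (ns : seq nat) (rs : seq R) : state :=
  State (fun k => nth 0%N ns k) (fun k => nth 0 rs k).

(* Memory layout: the dimensions are in the memory of naturals; the supplies,
   then the demands, then the costs in row-major order are in the memory of
   reals.  All other cells are zero. *)
Definition pfct_input (n m : nat) (I : pfct R n m) : state :=
  load [:: n; m]
       ([seq (supply I i)%:R | i <- enum 'I_n]
        ++ [seq (demand I j)%:R | j <- enum 'I_m]
        ++ [seq fixed_cost I i j | i <- enum 'I_n, j <- enum 'I_m]).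

(* The solution is read off in row-major order from address 0. *)
Definition pfct_output (n m : nat) (s : state) : 'M[R]_(n, m) :=
  \matrix_(i, j) rmem s (i * m + j)%N.

(* [g] is computed by a single program, uniformly in [n] and in the real
   number [eps], in time polynomial in [n], [1 / eps] and the number of bits
   of the result. *)
Definition efficiently_computable (g : nat -> R -> nat) : Prop :=
  exists (c : cmd) (k : nat), forall (n : nat) (eps : R), 0 < eps ->
    exists (t : nat) (s : state),
      [/\ exec c (load [:: n] [:: eps]) t s,
          nmem s 0 = g n eps
        & t%:R <= (n%:R + eps^-1 + (trunc_log 2 (g n eps))%:R + 2) ^+ k].

End Semantics.

(* Main.v *)
(* Let V be a guess with OPT <= V <= 2 OPT, taken among the multiples k f_ij with
   k <= nm.  Round costs to multiples of V / L: sinks with the same rounded costs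
   have the same type.  An optimal solution uses few sinks through edges costing
   more than kap V / L.  Such a sink that is not among the M largest of its type
   can exchange its supply pattern, suitably scaled, with one of K disjoint families
   of larger sinks of its type, and the cheapest family raises the cost by at most
   OPT / K, up to rounding.  So the expensive edges may be assumed to lie in a set
   of size bounded in n and K, whose subsets are enumerated.

   Once the set of allowed expensive edges is guessed, give the cheap edge (i, j)
   the linear cost f_ij / b_j and the others linear cost 0.  A feasible flow is
   found greedily, sending on each edge what the Hall cuts allow; the best cycle
   move between sources closes a fraction 1 / (n^2 m) of the gap to the linear
   optimum, so polynomially many rounds suffice; cancelling 4-cycles leaves at most
   n^2 cheap edges that carry only part of the demand of their sink, and these cost
   at most kap V / L each.

   The natural numbers below G = 2 ^ (2 ^ (u ^ 7)), with u = n + K + 2, encode all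
   the sets that are enumerated, and the running time is polynomial in G m. *)
Require Import Defs.
From mathcomp Require Import all_boot all_order all_algebra all_fingroup.
From mathcomp Require Import boolp reals.
From mathcomp Require Import zify ring lra.

Set Implicit Arguments.
Unset Strict Implicit.
Unset Printing Implicit Defensive.

Import Order.TTheory GRing.Theory Num.Theory.
Local Open Scope ring_scope.

(** * A language with bounded loops and its compiler *)

(** The running time may not depend on the size of supplies, demands and costs, so every phase must
    take a number of steps bounded in [n], [m] and [K]. Since [n] is a parameter, all cuts and all
    sets of arcs between sources can be enumerated. And the linear problem need only be solved up to
    [n ^ 2] times the price of a cheap edge, an error that the edges sharing a sink cause anyway;
    the slow convergence of cycle moves suffices for that.

    With [kap = u ^ 2], [Kx = u ^ 3], [M = u ^ 4] and [L = kap * Kx], all errors are multiples of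
    OPT / K: at most [Kx] sinks of an optimal solution use an expensive edge, an exchange costs
    [2 n] units [V / L], and a cheap edge costs at most [kap] units. [M] is such that each of the
    [Kx] sinks still has [K] replacements of its own when [Kx] occupied ones are discarded.

    The algorithm is written in a language with bounded loops: its correctness is a statement about
    a denotation, and its running time is read off from the syntax as a polynomial in the largest
    loop bound. *)

(* A language with bounded loops, also inside expressions.  Memory consists of
   numbered arrays.  [SumN v h e], [SumR v h e], [All v h e] and [PFor v h p] let
   the loop variable [v] range over the naturals below cell 0 of array [h];
   [PN a i e] and [PR a i e] assign [e] to cell [i] of array [a]. *)
Inductive ty := TN | TR | TB.

Inductive expr : ty -> Type :=
| Cst of nat : expr TN
| Var of nat : expr TN
| NArr of nat & expr TN : expr TN
| RArr of nat & expr TN : expr TR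
| OfN of expr TN : expr TR
| AddN of expr TN & expr TN : expr TN
| SubN of expr TN & expr TN : expr TN
| AddR of expr TR & expr TR : expr TR
| SubR of expr TR & expr TR : expr TR
| MulR of expr TR & expr TR : expr TR
| DivR of expr TR & expr TR : expr TR
| LeN of expr TN & expr TN : expr TB
| LeR of expr TR & expr TR : expr TB
| Neg of expr TB : expr TB
| Conj of expr TB & expr TB : expr TB
| Ite t of expr TB & expr t & expr t : expr t
| SumN of nat & nat & expr TN : expr TN
| SumR of nat & nat & expr TR : expr TR
| All of nat & nat & expr TB : expr TB.

Inductive prog :=
| PNop
| PN of nat & expr TN & expr TN
| PR of nat & expr TN & expr TR
| PSeq of prog & prog
| PIf of expr TB & prog & prog
| PFor of nat & nat & prog.

(** Equality is [Nat.eqb], so that the value of an explicit environment at a numeral is found by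
    conversion; the evaluation lemmas rely on this through [erefl]. *)
Definition setv (T : Type) (f : nat -> T) (k : nat) (v : T) : nat -> T :=
  fun l => if Nat.eqb l k then v else f l.

Lemma setv_same T (f : nat -> T) k v : setv f k v k = v.
Proof. by rewrite /setv; have -> : Nat.eqb k k by elim: k. Qed.

Lemma eqbE (a b : nat) : Nat.eqb a b = (a == b).
Proof. by elim: a b => [|a IH] [|b]. Qed.

Lemma setvE T (f : nat -> T) k v l : setv f k v l = if l == k then v else f l.
Proof. by rewrite /setv eqbE. Qed.

Section Denotation.
Variable R : realType.

Record store := Store { sn : nat -> nat -> nat; sr : nat -> nat -> R }.

Definition sem (t : ty) : Type :=
  match t with TN => nat | TR => R | TB => bool end.

Fixpoint eval t (e : expr t) (ev : nat -> nat) (st : store) : sem t :=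
  match e in expr t return sem t with
  | Cst k => k
  | Var v => ev v
  | NArr a e => sn st a (eval e ev st)
  | RArr a e => sr st a (eval e ev st)
  | OfN e => (eval e ev st)%:R
  | AddN e1 e2 => (eval e1 ev st + eval e2 ev st)%N
  | SubN e1 e2 => (eval e1 ev st - eval e2 ev st)%N
  | AddR e1 e2 => eval e1 ev st + eval e2 ev st
  | SubR e1 e2 => eval e1 ev st - eval e2 ev st
  | MulR e1 e2 => eval e1 ev st * eval e2 ev st
  | DivR e1 e2 => eval e1 ev st / eval e2 ev st
  | LeN e1 e2 => (eval e1 ev st <= eval e2 ev st)%N
  | LeR e1 e2 => eval e1 ev st <= eval e2 ev st
  | Neg e => ~~ eval e ev st
  | Conj e1 e2 => eval e1 ev st && eval e2 ev st
  | Ite _ b e1 e2 => if eval b ev st then eval e1 ev st else eval e2 ev st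
  | SumN v h e => (\sum_(k < sn st h 0) eval e (setv ev v k) st)%N
  | SumR v h e => \sum_(k < sn st h 0) eval e (setv ev v k) st
  | All v h e => [forall k : 'I_(sn st h 0), eval e (setv ev v k) st]
  end.

Definition wrn (st : store) a k v := Store (setv (sn st) a (setv (sn st a) k v)) (sr st).
Definition wrr (st : store) a k v := Store (sn st) (setv (sr st) a (setv (sr st a) k v)).

Fixpoint den (p : prog) (ev : nat -> nat) (st : store) : store :=
  match p with
  | PNop => st
  | PN a i e => wrn st a (eval i ev st) (eval e ev st)
  | PR a i e => wrr st a (eval i ev st) (eval e ev st)
  | PSeq p q => den q ev (den p ev st)
  | PIf b p q => if eval b ev st then den p ev st else den q ev st
  | PFor v h p =>
      foldl (fun st k => den p (setv ev v k) st) st (iota 0 (sn st h 0))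
  end.

End Denotation.

(* [bnd] and [bndP] list the arrays that hold loop bounds, [outn] and [outr] the
   arrays that are written. *)
Fixpoint bnd t (e : expr t) : seq nat :=
  match e with
  | Cst _ | Var _ => [::]
  | NArr _ e | RArr _ e | OfN e | Neg e => bnd e
  | AddN e1 e2 | SubN e1 e2 | LeN e1 e2 => bnd e1 ++ bnd e2
  | AddR e1 e2 | SubR e1 e2 | MulR e1 e2 | DivR e1 e2 | LeR e1 e2 => bnd e1 ++ bnd e2
  | Conj e1 e2 => bnd e1 ++ bnd e2
  | Ite _ b e1 e2 => bnd b ++ bnd e1 ++ bnd e2
  | SumN _ h e => h :: bnd e
  | SumR _ h e => h :: bnd e
  | All _ h e => h :: bnd e
  end.

Fixpoint bndP (p : prog) : seq nat :=
  match p with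
  | PNop => [::]
  | PN _ i e => bnd i ++ bnd e
  | PR _ i e => bnd i ++ bnd e
  | PSeq p q => bndP p ++ bndP q
  | PIf b p q => bnd b ++ bndP p ++ bndP q
  | PFor _ h p => h :: bndP p
  end.

Fixpoint outn (p : prog) : seq nat :=
  match p with
  | PNop | PR _ _ _ => [::]
  | PN a _ _ => [:: a]
  | PSeq p q | PIf _ p q => outn p ++ outn q
  | PFor _ _ p => outn p
  end.

Fixpoint outr (p : prog) : seq nat :=
  match p with
  | PNop | PN _ _ _ => [::]
  | PR a _ _ => [:: a]
  | PSeq p q | PIf _ p q => outr p ++ outr q
  | PFor _ _ p => outr p
  end.

Lemma den_sn R p ev (st : store R) a : a \notin outn p -> sn (den p ev st) a = sn st a.
Proof.
elim: p ev st => //= [b i e|p IHp q IHq|b p IHp q IHq|v h p IHp] ev st.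
- by rewrite inE setvE => /negPf ->.
- by rewrite mem_cat negb_or => /andP[ap aq]; rewrite IHq // IHp.
- by rewrite mem_cat negb_or => /andP[ap aq]; case: ifP => _; rewrite ?IHq ?IHp.
- by move=> ap; move: (iota _ _) => s; elim: s st => //= k s IH st; rewrite IH IHp.
Qed.

Lemma den_sr R p ev (st : store R) a : a \notin outr p -> sr (den p ev st) a = sr st a.
Proof.
elim: p ev st => //= [b i e|p IHp q IHq|b p IHp q IHq|v h p IHp] ev st.
- by rewrite inE setvE => /negPf ->.
- by rewrite mem_cat negb_or => /andP[ap aq]; rewrite IHq // IHp.
- by rewrite mem_cat negb_or => /andP[ap aq]; case: ifP => _; rewrite ?IHq ?IHp.
- by move=> ap; move: (iota _ _) => s; elim: s st => //= k s IH st; rewrite IH IHp.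
Qed.

(* Array [a] of the language occupies the addresses congruent to [a] modulo 32.
   The last two arrays are private to the compiler. *)
Definition addr (a k : nat) : nat := (32 * k + a)%N.
Definition loopv : nat := 30.
Definition temp : nat := 31.

Fixpoint wf (sc : seq nat) t (e : expr t) : bool :=
  match e with
  | Cst _ => true
  | Var v => v \in sc
  | NArr a e | RArr a e => (a < 30)%N && wf sc e
  | OfN e | Neg e => wf sc e
  | AddN e1 e2 | SubN e1 e2 | LeN e1 e2 => wf sc e1 && wf sc e2
  | AddR e1 e2 | SubR e1 e2 | MulR e1 e2 | DivR e1 e2 | LeR e1 e2 => wf sc e1 && wf sc e2
  | Conj e1 e2 => wf sc e1 && wf sc e2
  | Ite _ b e1 e2 => [&& wf sc b, wf sc e1 & wf sc e2]
  | SumN v h e => [&& v \notin sc, (h < 30)%N & wf (v :: sc) e]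
  | SumR v h e => [&& v \notin sc, (h < 30)%N & wf (v :: sc) e]
  | All v h e => [&& v \notin sc, (h < 30)%N & wf (v :: sc) e]
  end.

Fixpoint wfP (sc : seq nat) (p : prog) : bool :=
  match p with
  | PNop => true
  | PN a i e => [&& (a < 30)%N, wf sc i & wf sc e]
  | PR a i e => [&& (a < 30)%N, wf sc i & wf sc e]
  | PSeq p q => wfP sc p && wfP sc q
  | PIf b p q => [&& wf sc b, wfP sc p & wfP sc q]
  | PFor v h p => [&& v \notin sc, (h < 30)%N & wfP (v :: sc) p]
  end.

Definition cell a d := NConst (addr a d).
Definition tn d := NLoad (cell temp d).
Definition tr d := RLoad (cell temp d).
Definition dbl e := NAdd e e.
(** The naturals of the machine cannot be multiplied, so the factor 32 is five doublings. Each
    doubling copies [e], which is therefore always the reading of a single cell. *)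
Definition at_ a e := NAdd (iter 5 dbl e) (NConst a).

(** The bound is read again before every round, whereas the range of [PFor] is fixed at entry. The
    two agree because a body never writes a loop bound, which is a hypothesis of [compP_ok]. *)
Definition loop (v h : nat) (c : cmd) : cmd :=
  Seq (NStore (cell loopv v) (NConst 0))
      (While (BNot (BNLe (NLoad (cell h 0)) (NLoad (cell loopv v))))
         (Seq c (NStore (cell loopv v) (NAdd (NLoad (cell loopv v)) (NConst 1))))).

(** The result goes to cell [d] of [temp], in the memory of its type, and the cells above [d] are
    free for subexpressions. Booleans are 0 or 1, so that conjunction is the truncated
    [a + b - 1]. *)
Fixpoint comp t (e : expr t) (d : nat) : cmd :=
  match e with
  | Cst k => NStore (cell temp d) (NConst k)
  | Var v => NStore (cell temp d) (NLoad (cell loopv v))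
  | NArr a e => Seq (comp e d) (NStore (cell temp d) (NLoad (at_ a (tn d))))
  | RArr a e => Seq (comp e d) (RStore (cell temp d) (RLoad (at_ a (tn d))))
  | OfN e => Seq (comp e d) (RStore (cell temp d) (RNat (tn d)))
  | AddN e1 e2 => Seq (comp e1 d) (Seq (comp e2 d.+1)
      (NStore (cell temp d) (NAdd (tn d) (tn d.+1))))
  | SubN e1 e2 => Seq (comp e1 d) (Seq (comp e2 d.+1)
      (NStore (cell temp d) (NSub (tn d) (tn d.+1))))
  | AddR e1 e2 => Seq (comp e1 d) (Seq (comp e2 d.+1)
      (RStore (cell temp d) (RAdd (tr d) (tr d.+1))))
  | SubR e1 e2 => Seq (comp e1 d) (Seq (comp e2 d.+1)
      (RStore (cell temp d) (RSub (tr d) (tr d.+1))))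
  | MulR e1 e2 => Seq (comp e1 d) (Seq (comp e2 d.+1)
      (RStore (cell temp d) (RMul (tr d) (tr d.+1))))
  | DivR e1 e2 => Seq (comp e1 d) (Seq (comp e2 d.+1)
      (RStore (cell temp d) (RDiv (tr d) (tr d.+1))))
  | LeN e1 e2 => Seq (comp e1 d) (Seq (comp e2 d.+1)
      (If (BNLe (tn d) (tn d.+1)) (NStore (cell temp d) (NConst 1))
          (NStore (cell temp d) (NConst 0))))
  | LeR e1 e2 => Seq (comp e1 d) (Seq (comp e2 d.+1)
      (If (BRLe (tr d) (tr d.+1)) (NStore (cell temp d) (NConst 1))
          (NStore (cell temp d) (NConst 0))))
  | Neg e => Seq (comp e d) (NStore (cell temp d) (NSub (NConst 1) (tn d)))
  | Conj e1 e2 => Seq (comp e1 d) (Seq (comp e2 d.+1)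
      (NStore (cell temp d) (NSub (NAdd (tn d) (tn d.+1)) (NConst 1))))
  | Ite _ b e1 e2 => Seq (comp b d) (If (BNLe (NConst 1) (tn d)) (comp e1 d) (comp e2 d))
  | SumN v h e => Seq (NStore (cell temp d) (NConst 0)) (loop v h (Seq (comp e d.+1)
      (NStore (cell temp d) (NAdd (tn d) (tn d.+1)))))
  | SumR v h e => Seq (RStore (cell temp d) (RNat (NConst 0))) (loop v h (Seq (comp e d.+1)
      (RStore (cell temp d) (RAdd (tr d) (tr d.+1)))))
  | All v h e => Seq (NStore (cell temp d) (NConst 1)) (loop v h (Seq (comp e d.+1)
      (NStore (cell temp d) (NSub (NAdd (tn d) (tn d.+1)) (NConst 1)))))
  end.

Fixpoint compP (p : prog) : cmd :=
  match p with
  | PNop => Skip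
  | PN a i e => Seq (comp i 0) (Seq (comp e 1) (NStore (at_ a (tn 0)) (tn 1)))
  | PR a i e => Seq (comp i 0) (Seq (comp e 1) (RStore (at_ a (tn 0)) (tr 1)))
  | PSeq p q => Seq (compP p) (compP q)
  | PIf b p q => Seq (comp b 0) (If (BNLe (NConst 1) (tn 0)) (compP p) (compP q))
  | PFor v h p => loop v h (compP p)
  end.

(* Upper bounds, with generous constants, on the running time of the compiled
   code when all loop bounds are at most [B]. *)
Fixpoint tm (B : nat) t (e : expr t) : nat :=
  match e with
  | Cst _ | Var _ => (1000)%N
  | NArr _ e | RArr _ e | OfN e | Neg e => (tm B e + 1000)%N
  | AddN e1 e2 | SubN e1 e2 | LeN e1 e2 => (tm B e1 + tm B e2 + 1000)%N
  | AddR e1 e2 | SubR e1 e2 | MulR e1 e2 | DivR e1 e2 | LeR e1 e2 => (tm B e1 + tm B e2 + 1000)%N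
  | Conj e1 e2 => (tm B e1 + tm B e2 + 1000)%N
  | Ite _ b e1 e2 => (tm B b + tm B e1 + tm B e2 + 1000)%N
  | SumN _ _ e => (B * (tm B e + 1000) + 1000)%N
  | SumR _ _ e => (B * (tm B e + 1000) + 1000)%N
  | All _ _ e => (B * (tm B e + 1000) + 1000)%N
  end.

Fixpoint tmP (B : nat) (p : prog) : nat :=
  match p with
  | PNop => (1000)%N
  | PN _ i e => (tm B i + tm B e + 1000)%N
  | PR _ i e => (tm B i + tm B e + 1000)%N
  | PSeq p q => (tmP B p + tmP B q + 1000)%N
  | PIf b p q => (tm B b + tmP B p + tmP B q + 1000)%N
  | PFor _ _ p => (B * (tmP B p + 1000) + 1000)%N
  end.

(** * Correctness and running time of the compiled code *)

Section Correctness.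
Variable R : realType.
Implicit Types (s : state R) (st : store R).

Definition runs c s (T : nat) (Q : state R -> Prop) : Prop :=
  exists t s', [/\ exec c s t s', (t <= T)%N & Q s'].

Lemma runs_le c s T T' Q : runs c s T Q -> (T <= T')%N -> runs c s T' Q.
Proof. by move=> [t [s' [E l q]]] l'; exists t, s'; split=> //; apply: leq_trans l l'. Qed.

Lemma runs_imp c s T Q Q' : runs c s T Q -> (forall s', Q s' -> Q' s') -> runs c s T Q'.
Proof. by move=> [t [s' [E l q]]] l'; exists t, s'; split=> //; apply: l'. Qed.

Lemma runs_seq c1 c2 s T1 T2 Q Q' :
  runs c1 s T1 Q' -> (forall s', Q' s' -> runs c2 s' T2 Q) -> runs (Seq c1 c2) s (T1 + T2) Q.
Proof.
move=> [t [s' [E l q]]] /(_ _ q) [t' [s'' [E' l' q']]].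
by exists (t + t')%N, s''; split=> //; [apply: ExSeq E E' | apply: leq_add].
Qed.

Lemma runs_while b c s N T (I : nat -> state R -> Prop) :
  (forall k s, I k s -> (k <= N)%N -> beval s b = (k < N)%N) ->
  (forall k s, (k < N)%N -> I k s -> runs c s T (I k.+1)) ->
  I 0%N s -> runs (While b c) s (N * (bcost b + T + 1) + bcost b + 1) (I N).
Proof.
move=> Hb Hc I0.
(* Here [k] counts the rounds that remain, so that the induction unfolds the loop from its first
   test. *)
suff H k s' : (k <= N)%N -> I (N - k)%N s' ->
    runs (While b c) s' (k * (bcost b + T + 1) + bcost b + 1) (I N).
  by apply: H => //; rewrite subnn.
elim: k s' => [|k IH] s' kN Is.
  rewrite subn0 in Is; exists (bcost b).+1, s'; split=> //; last lia.
  by apply: ExWhileF; rewrite (Hb _ _ Is) // ltnn.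
have lt : (N - k.+1 < N)%N by lia.
have [t1 [s1 [E1 l1 q1]]] := Hc _ _ lt Is.
have q1' : I (N - k)%N s1 by rewrite (_ : (N - k = (N - k.+1).+1)%N) //; lia.
have [t2 [s2 [E2 l2 q2]]] := IH _ (ltnW kN) q1'.
exists (bcost b + t1 + t2).+1, s2; split=> //; last by rewrite mulSn; lia.
by apply: ExWhileT E1 E2; rewrite (Hb _ _ Is) //; lia.
Qed.

Lemma runs_nstore e1 e2 s Q T :
  ((ncost e1 + ncost e2).+1 <= T)%N ->
  Q (State (upd (nmem s) (neval s e1) (neval s e2)) (rmem s)) -> runs (NStore e1 e2) s T Q.
Proof. by move=> l q; eexists _, _; split; [apply: ExNStore | |]. Qed.

Lemma runs_rstore e1 e2 s Q T :
  ((ncost e1 + rcost e2).+1 <= T)%N ->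
  Q (State (nmem s) (upd (rmem s) (neval s e1) (reval s e2))) -> runs (RStore e1 e2) s T Q.
Proof. by move=> l q; eexists _, _; split; [apply: ExRStore | |]. Qed.

Lemma runs_if b c1 c2 s Q T :
  runs (if beval s b then c1 else c2) s T Q -> runs (If b c1 c2) s (bcost b + T + 1) Q.
Proof.
move=> [t [s' [E l q]]]; exists (bcost b + t).+1, s'; split=> //; last lia.
by case: ifP E => [|/negbT] bs E; [apply: ExIfT|apply: ExIfF].
Qed.

Lemma addr_eq a k a' k' : (a < 32)%N -> (a' < 32)%N ->
  (addr a k == addr a' k') = (a == a') && (k == k').
Proof.
move=> la la'; rewrite /addr; apply/eqP/andP => [H|[/eqP -> /eqP ->]] //.
by split; apply/eqP; lia.
Qed.

Lemma at_E s a e : neval s (at_ a e) = addr a (neval s e).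
Proof. by rewrite /at_ /addr /=; lia. Qed.

Lemma nload_at s a e : neval s (NLoad (at_ a e)) = nmem s (addr a (neval s e)).
Proof. by rewrite -at_E. Qed.

Lemma rload_at s a e : reval s (RLoad (at_ a e)) = rmem s (addr a (neval s e)).
Proof. by rewrite -at_E. Qed.

(** Nothing is said about the loop variables outside the scope [sc], so that leaving a loop is a
    mere weakening. *)
Definition rel (sc : seq nat) (ev : nat -> nat) st s : Prop :=
  [/\ forall v, v \in sc -> nmem s (addr loopv v) = ev v,
      forall a k, (a < 30)%N -> nmem s (addr a k) = sn st a k
    & forall a k, (a < 30)%N -> rmem s (addr a k) = sr st a k].

Definition holds d t : sem R t -> state R -> Prop :=
  match t return sem R t -> state R -> Prop with
  | TN => fun v s => nmem s (addr temp d) = v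
  | TR => fun v s => rmem s (addr temp d) = v
  | TB => fun v s => nmem s (addr temp d) = (v : bool) :> nat
  end.

(* Subexpressions are evaluated on a stack; [low] says that the part below depth
   [d] is intact. *)
Definition low d s s' : Prop := forall d', (d' < d)%N ->
  nmem s' (addr temp d') = nmem s (addr temp d') /\
  rmem s' (addr temp d') = rmem s (addr temp d').

Lemma low_trans d d' s1 s2 s3 : (d <= d')%N -> low d s1 s2 -> low d' s2 s3 -> low d s1 s3.
Proof.
move=> dd H1 H2 k kd; have [-> ->] := H2 k (leq_trans kd dd); exact: H1.
Qed.

Lemma low_holds t d d' (v : sem R t) s s' : (d < d')%N -> low d' s s' ->
  holds d v s -> holds d v s'.
Proof. by move=> dd /(_ d dd) [e1 e2]; case: t v => v /=; rewrite ?e1 ?e2. Qed.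

Lemma addr_neq a k a' k' : (a < 32)%N -> (a' < 32)%N -> a != a' ->
  (addr a k == addr a' k') = false.
Proof. by move=> la la' /negPf ne; rewrite addr_eq // ne. Qed.

Lemma addr_temp a k d : (a < 31)%N -> (addr a k == addr temp d) = false.
Proof. by move=> la; rewrite addr_eq ?(ltn_eqF la) ?(leq_trans la). Qed.

Lemma addr_loopv a k d : (a < 30)%N -> (addr a k == addr loopv d) = false.
Proof. by move=> la; rewrite addr_eq ?(ltn_eqF la) ?(leq_trans la). Qed.

Lemma rel_ntemp sc ev st s d v :
  rel sc ev st s -> rel sc ev st (State (upd (nmem s) (addr temp d) v) (rmem s)).
Proof.
move=> [r1 r2 r3]; split=> [w ws|a k la|a k la] /=; rewrite /upd ?addr_temp //.
- exact: r1.
- exact: r2.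
- exact: ltn_trans la _.
- exact: r3.
Qed.

Lemma rel_rtemp sc ev st s d v :
  rel sc ev st s -> rel sc ev st (State (nmem s) (upd (rmem s) (addr temp d) v)).
Proof.
move=> [r1 r2 r3]; split=> [w ws|a k la|a k la] /=; rewrite /upd ?addr_temp //.
- exact: r1.
- exact: r2.
- exact: r3.
- exact: ltn_trans la _.
Qed.

Lemma low_ntemp d s s' v : low d s s' ->
  low d s (State (upd (nmem s') (addr temp d) v) (rmem s')).
Proof. by move=> H k kd; rewrite /= /upd addr_eq // (ltn_eqF kd) andbF; apply: H. Qed.

Lemma low_rtemp d s s' v : low d s s' ->
  low d s (State (nmem s') (upd (rmem s') (addr temp d) v)).
Proof. by move=> H k kd; rewrite /= /upd addr_eq // (ltn_eqF kd) andbF; apply: H. Qed.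

Definition good sc ev st d s t (v : sem R t) s' :=
  [/\ rel sc ev st s', holds d v s' & low d s s'].

Lemma good_ntemp sc ev st d s s' v t (w : sem R t) :
  rel sc ev st s' -> low d s s' ->
  holds d w (State (upd (nmem s') (addr temp d) v) (rmem s')) ->
  good sc ev st d s w (State (upd (nmem s') (addr temp d) v) (rmem s')).
Proof. by move=> r l h; split=> //; [apply: rel_ntemp|apply: low_ntemp]. Qed.

Lemma good_rtemp sc ev st d s s' v t (w : sem R t) :
  rel sc ev st s' -> low d s s' ->
  holds d w (State (nmem s') (upd (rmem s') (addr temp d) v)) ->
  good sc ev st d s w (State (nmem s') (upd (rmem s') (addr temp d) v)).
Proof. by move=> r l h; split=> //; [apply: rel_rtemp|apply: low_rtemp]. Qed.

Lemma updE (T : Type) (f : nat -> T) k v : upd f k v k = v.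
Proof. by rewrite /upd eqxx. Qed.

Definition good2 sc ev st d s t1 (v1 : sem R t1) t2 (v2 : sem R t2) s' :=
  [/\ rel sc ev st s', holds d v1 s', holds d.+1 v2 s' & low d s s'].

Lemma runs_two sc ev st d s c1 c2 c t1 (v1 : sem R t1) t2 (v2 : sem R t2) T1 T2 T Q :
  runs c1 s T1 (good sc ev st d s v1) ->
  (forall s1, rel sc ev st s1 -> runs c2 s1 T2 (good sc ev st d.+1 s1 v2)) ->
  (forall s2, good2 sc ev st d s v1 v2 s2 -> runs c s2 T Q) ->
  runs (Seq c1 (Seq c2 c)) s (T1 + (T2 + T)) Q.
Proof.
move=> H1 H2 H; apply: runs_seq H1 _ => s1 [r1 h1 l1].
apply: runs_seq (H2 _ r1) _ => s2 [r2 h2 l2]; apply: H; split=> //.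
- exact: low_holds l2 h1.
- exact: low_trans l1 l2.
Qed.

Lemma rel_loopv sc ev st s v k : v \notin sc -> rel sc ev st s ->
  rel (v :: sc) (setv ev v k) st (State (upd (nmem s) (addr loopv v) k) (rmem s)).
Proof.
move=> vs [r1 r2 r3]; split=> [w|a i la|a i la] /=; rewrite /upd.
- rewrite inE setvE addr_eq // eqxx /= => /orP[/eqP ->|ws]; first by rewrite eqxx.
  by case: eqP ws vs => [-> -> //|_ ws _]; apply: r1.
- by rewrite addr_loopv //; apply: r2.
- exact: r3.
Qed.

Lemma rel_weak sc ev st s v k : v \notin sc -> rel (v :: sc) (setv ev v k) st s ->
  rel sc ev st s.
Proof.
move=> vs [r1 r2 r3]; split=> // w ws; rewrite r1 ?inE ?ws ?orbT // setvE.
by case: eqP ws vs => // -> ->.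
Qed.

(** Serves statements and expressions alike. [D k] is the store after [k] rounds, constant for the
    loops inside expressions; [I] describes the accumulator on the stack, and is trivial for
    statements. The stability hypothesis lets [I] survive the updates of the loop variable. *)
Lemma runs_loop sc ev s v h c T N B (D : nat -> store R) (I : nat -> state R -> Prop) :
  v \notin sc -> (h < 30)%N ->
  (forall k, (k <= N)%N -> sn (D k) h 0 = N) -> (N <= B)%N ->
  (forall k s s', I k s -> rmem s' = rmem s ->
     (forall a, (a < 32)%N -> a != loopv -> forall i, nmem s' (addr a i) = nmem s (addr a i)) ->
     I k s') ->
  (forall k s, (k < N)%N -> rel (v :: sc) (setv ev v k) (D k) s -> I k s ->
     runs c s T (fun s' => rel (v :: sc) (setv ev v k) (D k.+1) s' /\ I k.+1 s')) ->
  rel sc ev (D 0%N) s -> I 0%N s ->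
  runs (loop v h c) s (B * (T + 20) + 20) (fun s' => rel sc ev (D N) s' /\ I N s').
Proof.
move=> vs lh Dh NB stab body r0 i0.
have stab' k s1 w : I k s1 -> I k (State (upd (nmem s1) (addr loopv v) w) (rmem s1)).
  move=> Is; apply: stab Is _ _ => // a la na i /=.
  by rewrite /upd addr_neq.
apply: (@runs_le _ _ (4 + (N * (6 + (T + 8) + 1) + 6 + 1))%N); last first.
  by nia.
pose J k s := rel (v :: sc) (setv ev v k) (D k) s /\ I k s.
apply: (@runs_seq _ _ _ _ _ _ (J 0%N)).
  apply: runs_nstore => //=; split; last exact: stab'.
  exact: rel_loopv.
move=> s1 J1.
have := @runs_while (BNot (BNLe (NLoad (cell h 0)) (NLoad (cell loopv v))))
   (Seq c (NStore (cell loopv v) (NAdd (NLoad (cell loopv v)) (NConst 1)))) s1 N (T + 8) J.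
move=> H; apply: runs_imp (H _ _ J1) _; last by move=> s' [r i]; split=> //; apply: rel_weak r.
- move=> k s2 [[r1 r2 _] _] kN /=.
  by rewrite r1 ?inE ?eqxx // setv_same r2 // Dh // -ltnNge.
- move=> k s2 kN [r2 i2]; apply: runs_seq (body _ _ kN r2 i2) _ => s3 [r3 i3].
  apply: runs_nstore => //=; split; last exact: stab'.
  have := r3 => -[r31 _ _]; rewrite r31 ?inE ?eqxx // setv_same addn1.
  exact: rel_loopv (rel_weak vs r3).
Qed.

Lemma forall_ord_recr k (P : nat -> bool) :
  [forall i : 'I_k.+1, P i] = [forall i : 'I_k, P i] && P k.
Proof.
apply/forallP/andP => [H|[/forallP H Pk] i].
  by split; [apply/forallP => i; apply: (H (widen_ord (leqnSn k) i))|apply: (H ord_max)].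
have := ltn_ord i; rewrite ltnS leq_eqVlt => /orP[/eqP ->//|ik].
exact: (H (Ordinal ik)).
Qed.

Lemma comp_ok t (e : expr t) d sc ev st s B :
  wf sc e -> (forall h, h \in bnd e -> (sn st h 0 <= B)%N) -> rel sc ev st s ->
  runs (comp e d) s (tm B e) (good sc ev st d s (eval e ev st)).
Proof.
(* Shared by the binary operators: the second operand is evaluated one level higher on the stack and
   cannot destroy the first. *)
have two (t1 t2 : ty) (e1 : expr t1) (e2 : expr t2) :
    (forall d sc ev s, wf sc e1 -> (forall h, h \in bnd e1 -> (sn st h 0 <= B)%N) ->
       rel sc ev st s -> runs (comp e1 d) s (tm B e1) (good sc ev st d s (eval e1 ev st))) ->
    (forall d sc ev s, wf sc e2 -> (forall h, h \in bnd e2 -> (sn st h 0 <= B)%N) ->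
       rel sc ev st s -> runs (comp e2 d) s (tm B e2) (good sc ev st d s (eval e2 ev st))) ->
    forall d sc ev s, wf sc e1 && wf sc e2 ->
      (forall h, h \in bnd e1 ++ bnd e2 -> (sn st h 0 <= B)%N) -> rel sc ev st s ->
    forall c Q, (forall s2, good2 sc ev st d s (eval e1 ev st) (eval e2 ev st) s2 ->
       runs c s2 1000 Q) ->
    runs (Seq (comp e1 d) (Seq (comp e2 d.+1) c)) s (tm B e1 + tm B e2 + 1000) Q.
  move=> H1 H2 {}d {}sc {}ev {}s /andP[w1 w2] b r c Q HQ; rewrite -addnA.
  apply: runs_two HQ; first by apply: H1 => // h hh; apply: b; rewrite mem_cat hh.
  by move=> s1 r1; apply: H2 => // h hh; apply: b; rewrite mem_cat hh orbT.
elim: e d sc ev s => /=.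
- by move=> k d sc ev s _ _ r; apply: runs_nstore => //; apply: good_ntemp => //=; rewrite updE.
- move=> v d sc ev s vs _ r; apply: runs_nstore => //.
  by apply: good_ntemp => //=; rewrite updE; case: r => ->.
- move=> a e IH d sc ev s /andP[la w] b r; apply: runs_seq (IH _ _ _ _ w b r) _ => s1 [r1 h1 l1].
  apply: runs_nstore => //; rewrite nload_at /=.
  apply: good_ntemp => //=; rewrite updE.
  by case: r1 => _ -> // _; rewrite h1.
- move=> a e IH d sc ev s /andP[la w] b r; apply: runs_seq (IH _ _ _ _ w b r) _ => s1 [r1 h1 l1].
  apply: runs_rstore => //; rewrite rload_at /=.
  apply: good_rtemp => //=; rewrite updE.
  by case: r1 => _ _ -> //; rewrite h1.
- move=> e IH d sc ev s w b r; apply: runs_seq (IH _ _ _ _ w b r) _ => s1 [r1 h1 l1].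
  by apply: runs_rstore => //; apply: good_rtemp => //=; rewrite updE h1.
- move=> e1 H1 e2 H2 d sc ev s w b r; apply: (two _ _ _ _ H1 H2 d sc ev s w b r) => s2 [r2 /= h1 h2 l2].
  by apply: runs_nstore => //; apply: good_ntemp => //=; rewrite updE h1 h2.
- move=> e1 H1 e2 H2 d sc ev s w b r; apply: (two _ _ _ _ H1 H2 d sc ev s w b r) => s2 [r2 /= h1 h2 l2].
  by apply: runs_nstore => //; apply: good_ntemp => //=; rewrite updE h1 h2.
- move=> e1 H1 e2 H2 d sc ev s w b r; apply: (two _ _ _ _ H1 H2 d sc ev s w b r) => s2 [r2 /= h1 h2 l2].
  by apply: runs_rstore => //; apply: good_rtemp => //=; rewrite updE h1 h2.
- move=> e1 H1 e2 H2 d sc ev s w b r; apply: (two _ _ _ _ H1 H2 d sc ev s w b r) => s2 [r2 /= h1 h2 l2].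
  by apply: runs_rstore => //; apply: good_rtemp => //=; rewrite updE h1 h2.
- move=> e1 H1 e2 H2 d sc ev s w b r; apply: (two _ _ _ _ H1 H2 d sc ev s w b r) => s2 [r2 /= h1 h2 l2].
  by apply: runs_rstore => //; apply: good_rtemp => //=; rewrite updE h1 h2.
- move=> e1 H1 e2 H2 d sc ev s w b r; apply: (two _ _ _ _ H1 H2 d sc ev s w b r) => s2 [r2 /= h1 h2 l2].
  by apply: runs_rstore => //; apply: good_rtemp => //=; rewrite updE h1 h2.
- move=> e1 H1 e2 H2 d sc ev s w b r; apply: (two _ _ _ _ H1 H2 d sc ev s w b r) => s2 [r2 /= h1 h2 l2].
  apply: (@runs_le _ _ (5 + 10 + 1)) => //; apply: runs_if; rewrite /= h1 h2.
  by case: ifP => E; apply: runs_nstore => //; apply: good_ntemp => //=; rewrite updE.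
- move=> e1 H1 e2 H2 d sc ev s w b r; apply: (two _ _ _ _ H1 H2 d sc ev s w b r) => s2 [r2 /= h1 h2 l2].
  apply: (@runs_le _ _ (5 + 10 + 1)) => //; apply: runs_if; rewrite /= h1 h2.
  by case: ifP => E; apply: runs_nstore => //; apply: good_ntemp => //=; rewrite updE.
- move=> e IH d sc ev s w b r; apply: runs_seq (IH _ _ _ _ w b r) _ => s1 [r1 h1 l1].
  apply: runs_nstore => //; apply: good_ntemp => //=; rewrite updE h1.
  by case: (eval e ev st : bool).
- move=> e1 H1 e2 H2 d sc ev s w b r; apply: (two _ _ _ _ H1 H2 d sc ev s w b r) => s2 [r2 /= h1 h2 l2].
  apply: runs_nstore => //; apply: good_ntemp => //=; rewrite updE h1 h2.
  by case: (eval e1 ev st : bool); case: (eval e2 ev st : bool).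
- move=> t' b IHb e1 H1 e2 H2 d sc ev s /and3P[wb w1 w2] hb r.
  apply: (@runs_le _ _ (tm B b + (4 + (tm B e1 + tm B e2) + 1))); last by lia.
  apply: runs_seq (IHb d sc ev s wb _ r) _ => [h hh|s1 [r1 /= h1 l1]].
    by apply: hb; rewrite mem_cat hh.
  apply: runs_if; rewrite /= h1; case: (eval b ev st : bool) => /=.
    apply: runs_le (leq_addr _ _).
    apply: runs_imp (H1 d sc ev s1 w1 _ r1) _ => [h hh|s2 [r2 h2 l2]].
      by apply: hb; rewrite !mem_cat hh orbT.
    by split=> //; apply: low_trans l1 l2.
  apply: runs_le (leq_addl _ _).
  apply: runs_imp (H2 d sc ev s1 w2 _ r1) _ => [h hh|s2 [r2 h2 l2]].
    by apply: hb; rewrite !mem_cat hh !orbT.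
  by split=> //; apply: low_trans l1 l2.
- move=> v h e IH d sc ev s /and3P[vs lh w] hb r.
  apply: (@runs_le _ _ (10 + (B * ((tm B e + 100) + 20) + 20))); last by nia.
  pose I k s' := nmem s' (addr temp d) = (\sum_(i < k) eval e (setv ev v i) st)%N /\ low d s s'.
  apply: (@runs_seq _ _ _ _ _ _ (fun s' => rel sc ev st s' /\ I 0%N s')).
    apply: runs_nstore => //=; split; first exact: rel_ntemp.
    by split; [rewrite big_ord0 /= updE | apply: low_ntemp].
  move=> s1 [r1 i1].
  apply: runs_imp (@runs_loop sc ev s1 v h _ (tm B e + 100) (sn st h 0) B (fun=> st) I _ _ _ _ _ _ _ _) _ => //.
  - by apply: hb; rewrite inE eqxx.
  - move=> k s2 s3 [i2 l2] rs ns; split; first by rewrite ns.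
    by move=> d' dd; rewrite ns // rs; apply: l2.
  - move=> k s2 kN r2 [i2 l2].
    apply: runs_seq (IH _ _ _ _ w _ r2) _ => [h' hh|s3 [r3 /= h3 l3]].
      by apply: hb; rewrite inE hh orbT.
    apply: runs_nstore => //; split; first exact: rel_ntemp.
    split; last by apply: low_ntemp; apply: low_trans l2 l3.
    by rewrite /= updE big_ord_recr /= h3; congr addn; case: (l3 d) => // ->.
  - by move=> s2 [r2 [i2 l2]].
- move=> v h e IH d sc ev s /and3P[vs lh w] hb r.
  apply: (@runs_le _ _ (10 + (B * ((tm B e + 100) + 20) + 20))); last by nia.
  pose I k s' := rmem s' (addr temp d) = (\sum_(i < k) eval e (setv ev v i) st) /\ low d s s'.
  apply: (@runs_seq _ _ _ _ _ _ (fun s' => rel sc ev st s' /\ I 0%N s')).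
    apply: runs_rstore => //=; split; first exact: rel_rtemp.
    by split; [rewrite big_ord0 /= updE | apply: low_rtemp].
  move=> s1 [r1 i1].
  apply: runs_imp (@runs_loop sc ev s1 v h _ (tm B e + 100) (sn st h 0) B (fun=> st) I _ _ _ _ _ _ _ _) _ => //.
  - by apply: hb; rewrite inE eqxx.
  - move=> k s2 s3 [i2 l2] rs ns; split; first by rewrite rs.
    by move=> d' dd; rewrite ns // rs; apply: l2.
  - move=> k s2 kN r2 [i2 l2].
    apply: runs_seq (IH _ _ _ _ w _ r2) _ => [h' hh|s3 [r3 /= h3 l3]].
      by apply: hb; rewrite inE hh orbT.
    apply: runs_rstore => //; split; first exact: rel_rtemp.
    split; last by apply: low_rtemp; apply: low_trans l2 l3.
    by rewrite /= updE big_ord_recr /= h3; congr (_ + _); case: (l3 d) => // _ ->.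
  - by move=> s2 [r2 [i2 l2]].
- move=> v h e IH d sc ev s /and3P[vs lh w] hb r.
  apply: (@runs_le _ _ (10 + (B * ((tm B e + 100) + 20) + 20))); last by nia.
  pose I k s' := nmem s' (addr temp d) = [forall i : 'I_k, eval e (setv ev v i) st] :> nat
    /\ low d s s'.
  apply: (@runs_seq _ _ _ _ _ _ (fun s' => rel sc ev st s' /\ I 0%N s')).
    apply: runs_nstore => //=; split; first exact: rel_ntemp.
    split; last exact: low_ntemp.
    by rewrite /= updE; case: forallP => // -[] [].
  move=> s1 [r1 i1].
  apply: runs_imp (@runs_loop sc ev s1 v h _ (tm B e + 100) (sn st h 0) B (fun=> st) I _ _ _ _ _ _ _ _) _ => //.
  - by apply: hb; rewrite inE eqxx.
  - move=> k s2 s3 [i2 l2] rs ns; split; first by rewrite ns.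
    by move=> d' dd; rewrite ns // rs; apply: l2.
  - move=> k s2 kN r2 [i2 l2].
    apply: runs_seq (IH _ _ _ _ w _ r2) _ => [h' hh|s3 [r3 /= h3 l3]].
      by apply: hb; rewrite inE hh orbT.
    apply: runs_nstore => //; split; first exact: rel_ntemp.
    split; last by apply: low_ntemp; apply: low_trans l2 l3.
    rewrite /= updE (forall_ord_recr _ (fun i => eval e (setv ev v i) st)) h3.
    case: (l3 d) => // -> _; rewrite i2.
    by case: [forall _, _]; case: (eval e _ _ : bool).
  - by move=> s2 [r2 [i2 l2]].
Qed.

(** [H] contains all loop bounds and none of them is written, so the bound [B], assumed for the
    initial store only, holds for every intermediate one. *)
Lemma compP_ok (H : seq nat) p sc ev st s B :
  wfP sc p -> {subset bndP p <= H} -> (forall h, h \in H -> h \notin outn p) ->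
  (forall h, h \in H -> (sn st h 0 <= B)%N) -> rel sc ev st s ->
  runs (compP p) s (tmP B p) (rel sc ev (den p ev st)).
Proof.
elim: p sc ev st s => /= [|a i e|a i e|p IHp q IHq|b p IHp q IHq|v h p IHp] sc ev st s.
- by move=> *; exists 1%N, s; split=> //; apply: ExSkip.
- move=> /and3P[la wi we] sub out hB r.
  rewrite -addnA; apply: runs_two (@comp_ok _ i 0 sc ev st s B wi _ r) _ _ => [h hh|s1 r1|s2].
  + by apply: hB; apply: sub; rewrite mem_cat hh.
  + by apply: comp_ok => // h hh; apply: hB; apply: sub; rewrite mem_cat hh orbT.
  + move=> [[r1 r2 r3] /= h1 h2 l2]; apply: runs_nstore => //; rewrite at_E /= h1 h2.
    split=> [v vs|a' k la'|a' k la'] /=; last exact: r3.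
      rewrite /upd eq_sym addr_loopv //; exact: r1.
    rewrite /upd addr_eq ?(leq_trans la) ?(leq_trans la') // !setvE.
    by case: eqP => [->|_] /=; rewrite ?setvE ?r2.
- move=> /and3P[la wi we] sub out hB r.
  rewrite -addnA; apply: runs_two (@comp_ok _ i 0 sc ev st s B wi _ r) _ _ => [h hh|s1 r1|s2].
  + by apply: hB; apply: sub; rewrite mem_cat hh.
  + by apply: comp_ok => // h hh; apply: hB; apply: sub; rewrite mem_cat hh orbT.
  + move=> [[r1 r2 r3] /= h1 h2 l2]; apply: runs_rstore => //; rewrite at_E /= h1 h2.
    split=> [v vs|a' k la'|a' k la'] /=; [exact: r1|exact: r2|].
    rewrite /upd addr_eq ?(leq_trans la) ?(leq_trans la') // !setvE.
    by case: eqP => [->|_] /=; rewrite ?setvE ?r3.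
- move=> /andP[wp wq] sub out hB r; apply: runs_le (leq_addr 1000 _).
  have out1 h : h \in H -> h \notin outn p by move/out; rewrite mem_cat negb_or => /andP[].
  have out2 h : h \in H -> h \notin outn q by move/out; rewrite mem_cat negb_or => /andP[].
  apply: runs_seq (IHp _ ev st _ wp _ out1 hB r) _ => [h hh|s1 r1].
    by apply: sub; rewrite mem_cat hh.
  apply: IHq => // [h hh|h hh]; first by apply: sub; rewrite mem_cat hh orbT.
  by rewrite den_sn ?out1 // hB.
- move=> /and3P[wb wp wq] sub out hB r.
  have out1 h : h \in H -> h \notin outn p by move/out; rewrite mem_cat negb_or => /andP[].
  have out2 h : h \in H -> h \notin outn q by move/out; rewrite mem_cat negb_or => /andP[].
  apply: (@runs_le _ _ (tm B b + (4 + (tmP B p + tmP B q) + 1))); last by lia.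
  apply: runs_seq (@comp_ok _ b 0 sc ev st s B wb _ r) _ => [h hh|s1 [r1 /= h1 l1]].
    by apply: hB; apply: sub; rewrite mem_cat hh.
  apply: runs_if; rewrite /= h1; case: (eval b ev st : bool) => /=.
    apply: runs_le (leq_addr _ _); apply: IHp => // h hh.
    by apply: sub; rewrite !mem_cat hh orbT.
  apply: runs_le (leq_addl _ _); apply: IHq => // h hh.
  by apply: sub; rewrite !mem_cat hh !orbT.
- move=> /and3P[vs lh w] sub out hB r.
  have hH : h \in H by apply: sub; rewrite inE eqxx.
  pose D k := foldl (fun st k => den p (setv ev v k) st) st (iota 0 k).
  have DS k : D k.+1 = den p (setv ev v k) (D k).
    by rewrite /D -addn1 iotaD foldl_cat.
  have Dsn k a : a \notin outn p -> sn (D k) a = sn st a.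
    by move=> ap; elim: k => // k IH; rewrite DS den_sn.
  apply: (@runs_le _ _ (B * (tmP B p + 20) + 20)); last by nia.
  apply: runs_imp (@runs_loop sc ev s v h _ (tmP B p) (sn st h 0) B D (fun _ _ => True) _ _ _ _ _ _ _ _) _ => //.
  + by move=> k _; rewrite Dsn // out.
  + exact: hB.
  + move=> k s1 kN r1 _; apply: runs_imp (IHp _ _ _ _ w _ out _ r1) _ => [h' hh|h' hh|s2 r2].
    * by apply: sub; rewrite inE hh orbT.
    * by rewrite Dsn ?out // hB.
    * by rewrite DS.
  + by move=> s' [].
Qed.

End Correctness.

(** * Polynomial bounds on running times *)

Definition polyb (f : nat -> nat) : Prop :=
  exists C d, forall B, (0 < B)%N -> (f B <= C * B ^ d)%N.

Lemma polyb_const c : polyb (fun=> c).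
Proof. by exists c, 0%N => B _; rewrite muln1. Qed.

Lemma polyb_add f g : polyb f -> polyb g -> polyb (fun B => f B + g B)%N.
Proof.
move=> [C [d H]] [C' [d' H']]; exists (C + C')%N, (d + d')%N => B B0.
rewrite mulnDl leq_add //.
  by apply: leq_trans (H _ B0) _; rewrite leq_mul2l leq_pexp2l ?leq_addr ?orbT.
by apply: leq_trans (H' _ B0) _; rewrite leq_mul2l leq_pexp2l ?leq_addl ?orbT.
Qed.

Lemma polyb_mul f g : polyb f -> polyb g -> polyb (fun B => f B * g B)%N.
Proof.
move=> [C [d H]] [C' [d' H']]; exists (C * C')%N, (d + d')%N => B B0.
by rewrite expnD mulnACA leq_mul ?H ?H'.
Qed.

Lemma polyb_id : polyb id.
Proof. by exists 1%N, 1%N => B _; rewrite mul1n expn1. Qed.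

Ltac polyb_tac :=
  repeat lazymatch goal with
  | |- polyb (fun B => (_ + _)%N) => refine (polyb_add _ _)
  | |- polyb (fun B => (B * _)%N) => refine (polyb_mul polyb_id _)
  | H : polyb ?f |- polyb ?f => exact H
  | |- polyb (fun B => tm B _) => assumption
  | |- polyb (fun B => tmP B _) => assumption
  | |- polyb (fun=> ?c) => exact (polyb_const c)
  end.

Lemma tm_polyb t (e : expr t) : polyb (fun B => tm B e).
Proof. by elim: e => /=; intros; polyb_tac. Qed.

Lemma tmP_polyb p : polyb (fun B => tmP B p).
Proof.
elim: p => /= [|a i e|a i e|p IHp q IHq|b p IHp q IHq|v h p IHp].
all: try pose proof (tm_polyb i); try pose proof (tm_polyb e); try pose proof (tm_polyb b).
all: by polyb_tac.
Qed.

(** * Cycle moves decrease the linear cost *)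

(** The orbit of [x] is eventually periodic. [Z] is its cycle, where [f] is injective because an
    iterate of it is the identity there. *)
Lemma exists_cycle (T : finType) (f : T -> T) (x : T) :
  exists (s : {perm T}) (Z : {set T}),
    [/\ Z != set0, forall i, i \in Z -> s i = f i, forall i, i \notin Z -> s i = i
      & forall i, i \in Z -> exists k, i = iter k f x].
Proof.
have /trajectP [k klt E] := looping_order f x.
pose y := iter k f x; pose q := (fingraph.order f x - k)%N.
have q0 : (0 < q)%N by rewrite subn_gt0.
have qy : iter q f y = y by rewrite /y -iterD subnK // ltnW.
pose Z := [set i in fingraph.orbit f y].
have ZP i : reflect (exists a, i = iter a f y) (i \in Z).
  rewrite inE -fconnect_orbit; apply: (iffP idP) => [/iter_findex <-|[a ->]].
    by eexists.
  exact: fconnect_iter.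
have per i : i \in Z -> iter q f i = i.
  by case/ZP => a ->; rewrite -iterD addnC iterD qy.
have fZ i : i \in Z -> f i \in Z by case/ZP => a ->; apply/ZP; exists a.+1.
pose g i := if i \in Z then f i else i.
have ginj : injective g.
  move=> i j; rewrite /g; case: ifP => iZ; case: ifP => jZ //.
  - by move=> e; rewrite -(per i iZ) -(per j jZ) -(prednK q0) !iterSr e.
  - by move=> e; rewrite -e fZ in jZ.
  - by move=> e; rewrite e fZ in iZ.
exists (perm ginj), Z; split.
- by apply/set0Pn; exists y; apply/ZP; exists 0%N.
- by move=> i iZ; rewrite permE /g iZ.
- by move=> i /negPf iZ; rewrite permE /g iZ.
- by move=> i /ZP [a ->]; exists (a + k)%N; rewrite iterD.
Qed.

Section Circulation.
Variables (R : realFieldType) (n m : nat).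
Implicit Types (t w : 'I_n -> 'I_n -> 'I_m -> R).

(** [t i i' j] is an amount handed from source [i] to source [i'] at sink [j]: a flow on a
    multigraph of sources whose parallel arcs are labelled by sinks. *)
Definition weight t w : R := \sum_i \sum_i' \sum_j t i i' j * w i i' j.

Definition circulation t : Prop :=
  [/\ forall i i' j, 0 <= t i i' j, forall i j, t i i j = 0
    & forall i, \sum_i' \sum_j t i i' j = \sum_i' \sum_j t i' i j].

Definition carrier t := [set a : 'I_n * 'I_n * 'I_m | t a.1.1 a.1.2 a.2 != 0].

(* By induction on the carrier: a cycle that carries too little weight is peeled
   off, and the rest of the circulation still has positive weight. *)
Lemma circulation_cycle N t w : circulation t -> (#|carrier t| <= N)%N -> 0 < weight t w ->
  exists (s : {perm 'I_n}) (jj : 'I_n -> 'I_m) (th : R),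
    [/\ 0 < th, forall i, s i != i -> th <= t i (s i) (jj i)
      & weight t w <= N%:R * (th * \sum_(i | s i != i) w i (s i) (jj i))].
Proof.
elim: N t => [|N IH] t [t0 tii tc] cN W0.
  have z i i' j : t i i' j = 0.
    move: cN; rewrite leqn0 cards_eq0 => /eqP/setP/(_ (i, i', j)).
    by rewrite !inE /= => /negbFE/eqP.
  move: W0; rewrite /weight big1 ?ltxx // => i _; rewrite big1 // => i' _.
  by rewrite big1 // => j _; rewrite z mul0r.
have /existsP [i0 /existsP [i1 /existsP [j0 t1]]] :
    [exists i, [exists i', [exists j, 0 < t i i' j]]].
  apply: contraTT W0; rewrite negb_exists => /forallP H; rewrite -leNgt.
  rewrite /weight big1 // => i _; rewrite big1 // => i' _; rewrite big1 // => j _.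
  move: (H i); rewrite negb_exists => /forallP/(_ i'); rewrite negb_exists => /forallP/(_ j).
  by rewrite -leNgt => h; rewrite (le_anti (introT andP (conj h (t0 i i' j)))) mul0r.
(* By conservation a source entered by a positive arc also has a positive arc leaving it, so the
   walk from [i1] never stops and runs into a cycle. *)
pose out i := [pick a : 'I_n * 'I_m | 0 < t i a.1 a.2].
have outP i i' j : 0 < t i' i j -> exists a, out i = Some a.
  move=> h; rewrite /out; case: pickP => [a _|/= H]; first by exists a.
  have : \sum_i' \sum_j t i i' j = 0.
    rewrite big1 // => k _; rewrite big1 // => l _; apply: le_anti.
    by rewrite t0 andbT leNgt (H (k, l)).
  rewrite tc => /eqP; rewrite psumr_eq0; last by move=> *; apply: sumr_ge0.
  move=> /allP/(_ i'); rewrite mem_index_enum => /(_ isT) /=.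
  rewrite psumr_eq0; last by move=> *.
  move=> /allP/(_ j); rewrite mem_index_enum => /(_ isT) /= /eqP e.
  by rewrite e ltxx in h.
pose f i := if out i is Some a then a.1 else i.
pose jj i := if out i is Some a then a.2 else j0.
have outt i a : out i = Some a -> 0 < t i a.1 a.2.
  by rewrite /out; case: pickP => // b h [<-].
have [s [Z [Zn sZ snZ Zx]]] := exists_cycle f i1.
have outZ k : exists a, out (iter k f i1) = Some a.
  elim: k => [|k [a e]]; first exact: outP t1.
  apply: (outP _ (iter k f i1) a.2); rewrite /= {2}/f e; exact: outt.
have tZ i : i \in Z -> 0 < t i (s i) (jj i).
  move=> iZ; rewrite sZ //; have [k ->] := Zx _ iZ; have [a e] := outZ k.
  by rewrite /f /jj e; apply: outt.
have movZ i : (s i != i) = (i \in Z).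
  case: (boolP (i \in Z)) => iZ; last by rewrite snZ // eqxx.
  apply/eqP => e; move: (tZ _ iZ); rewrite e tii ltxx //.
have [z zZ] := set0Pn _ Zn.
pose y := [arg min_(i < z in Z) t i (s i) (jj i)]%O.
have [yZ ymin] : y \in Z /\ forall i, i \in Z -> t y (s y) (jj y) <= t i (s i) (jj i).
  by rewrite /y; case: arg_minP => // i iZ H; split.
pose th := t y (s y) (jj y).
have th0 : 0 < th by apply: tZ.
pose c i i' j : R := ((i \in Z) && (i' == s i) && (j == jj i))%:R.
pose t' i i' j := t i i' j - th * c i i' j.
have cE i i' j : c i i' j = 0 \/ [/\ c i i' j = 1, i \in Z, i' = s i & j = jj i].
  rewrite /c; case: (boolP (i \in Z)) => iZ /=; last by left.
  case: eqP => [->|_] /=; last by left.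
  by case: eqP => [->|_] /=; [right|left].
have sumc (F : 'I_n -> 'I_n -> 'I_m -> R) i :
    \sum_i' \sum_j c i i' j * F i i' j = (i \in Z)%:R * F i (s i) (jj i).
  rewrite (bigD1 (s i)) //= [X in _ + X]big1 ?addr0; last first.
    by move=> k /negPf ks; rewrite big1 // => j _; rewrite /c ks andbF mul0r.
  rewrite (bigD1 (jj i)) //= [X in _ + X]big1 ?addr0; last first.
    by move=> k /negPf ks; rewrite /c ks andbF mul0r.
  by rewrite /c !eqxx !andbT.
have Wc : weight t' w = weight t w - th * \sum_(i | s i != i) w i (s i) (jj i).
  rewrite /weight /t' mulr_sumr [X in _ - X]big_mkcond /= -sumrB.
  apply: eq_bigr => i _; rewrite movZ.
  have -> : (if i \in Z then th * w i (s i) (jj i) else 0) =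
     \sum_i' \sum_j c i i' j * (th * w i i' j).
    by rewrite (sumc (fun i i' j => th * w i i' j)); case: ifP; rewrite ?mul1r ?mul0r.
  rewrite -sumrB; apply: eq_bigr => i' _; rewrite -sumrB; apply: eq_bigr => j _.
  by rewrite mulrBl mulrA [c _ _ _ * th]mulrC.
(* If the cycle has less than a share [1 / N.+1] of the weight, the rest has more than [N / N.+1] of
   it. A cycle with a share [1 / N] of the rest then has a share [1 / N.+1] of the whole. *)
have [big|small] := leP (weight t w) (N.+1%:R * (th * \sum_(i | s i != i) w i (s i) (jj i))).
  by exists s, jj, th; split=> // i; rewrite movZ => /ymin.
set S := th * _ in Wc small.
have W' : N.+1%:R * weight t' w > N%:R * weight t w.
  by rewrite Wc -natr1; move: small; rewrite -natr1; lra.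
have W'0 : 0 < weight t' w.
  have : 0 < N.+1%:R * weight t' w.
    by apply: le_lt_trans W'; apply: mulr_ge0 => //; apply: ltW.
  by rewrite pmulr_rgt0 ?ltr0n.
have t'0 i i' j : 0 <= t' i i' j.
  rewrite /t'; case: (cE i i' j) => [->|[-> iZ -> ->]]; rewrite ?mulr0 ?subr0 //.
  by rewrite mulr1 subr_ge0 ymin.
have cin i : \sum_i' \sum_j c i' i j = \sum_i' \sum_j c i i' j.
  transitivity ((i \in Z)%:R : R); last first.
    by have := sumc (fun _ _ _ => 1) i; under eq_bigr do under eq_bigr do rewrite mulr1;
       rewrite mulr1.
  transitivity (\sum_i' ((i' \in Z) && (i == s i'))%:R : R).
    apply: eq_bigr => i' _; rewrite (bigD1 (jj i')) //= [X in _ + X]big1 ?addr0.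
      by rewrite /c eqxx andbT.
    by move=> k /negPf ks; rewrite /c ks andbF.
  have iZs : (i \in Z) = ((s^-1)%g i \in Z).
    by rewrite -!movZ permKV -(inj_eq (@perm_inj _ s) i) permKV.
  rewrite (bigD1 ((s^-1)%g i)) //= permKV eqxx andbT -iZs big1 ?addr0 // => k kn.
  case: eqP => [e|_]; last by rewrite andbF.
  by rewrite e permK eqxx in kn.
have circ' : circulation t'.
  split=> [i i' j|i j|i]; first exact: t'0.
    rewrite /t' tii; case: (cE i i j) => [->|[_ iZ e _]]; first by rewrite mulr0 subr0.
    by move: iZ; rewrite -movZ -e eqxx.
  rewrite /t'; under eq_bigr do rewrite sumrB -mulr_sumr.
  under [RHS]eq_bigr do rewrite sumrB -mulr_sumr.
  by rewrite !sumrB -!mulr_sumr tc cin.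
(* The bottleneck arc of the cycle, at [y], leaves the carrier. *)
have sub : carrier t' \proper carrier t.
  apply/properP; split.
    apply/subsetP => -[[i i'] j]; rewrite !inE /= /t'.
    case: (cE i i' j) => [->|[-> iZ -> ->]]; first by rewrite mulr0 subr0.
    by move=> _; apply/eqP => e; move: (tZ _ iZ); rewrite e ltxx.
  exists (y, s y, jj y); rewrite !inE /=; first by rewrite gt_eqF.
  by rewrite /t' /c yZ !eqxx mulr1 subrr eqxx.
have cN' : (#|carrier t'| <= N)%N by rewrite -ltnS (leq_trans (proper_card sub)).
have [s' [jj' [th' [p1 p2 p3]]]] := IH _ circ' cN' W'0.
exists s', jj', th'; split=> //.
  by move=> i /p2 h; apply: le_trans h _; rewrite /t' gerBl mulr_ge0 // ?ltW.
set S' := th' * _ in p3 *.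
have NS : N.+1%:R * weight t' w <= N.+1%:R * (N%:R * S') by rewrite ler_pM2l ?ltr0n.
have := lt_le_trans W' NS; rewrite mulrCA.
case: (posnP N) => [N0|N0]; first by move: p3; rewrite N0 mul0r; move: W'0; lra.
by rewrite ltr_pM2l ?ltr0n // => /ltW.
Qed.

End Circulation.

(** * The gain of one round of cycle moves *)

Section Flows.
Variables (R : realFieldType) (n m : nat).
Variables (A : 'I_n -> R) (B : 'I_m -> R) (al : 'I_n -> 'I_m -> bool).
Implicit Types (x y c : 'I_n -> 'I_m -> R) (Z : 'I_n -> 'I_n -> bool).

Definition flow x : Prop :=
  [/\ forall i j, 0 <= x i j, forall i, \sum_j x i j = A i & forall j, \sum_i x i j = B j].

Definition supported x : Prop := forall i j, 0 < x i j -> al i j.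

Definition lin c x : R := \sum_i \sum_j c i j * x i j.

Definition usable x th i i' j := (th <= x i j) && al i' j.

(** Ties are broken by the index: with two best sinks for one arc, [move] would reroute the amount
    twice. *)
Definition beats c (i i' : 'I_n) (j' j : 'I_m) :=
  (c i' j' - c i j' < c i' j - c i j)
  || (c i' j' - c i j' <= c i' j - c i j) && (j' < j)%N.

Definition best c x th i i' j :=
  usable x th i i' j && [forall j' : 'I_m, ~~ (usable x th i i' j' && beats c i i' j' j)].

(* For every arc [(i, i')] of [Z], reroute [th] units from source [i] to source
   [i'] at the sink where this is cheapest. *)
Definition move c Z th x : 'I_n -> 'I_m -> R := fun r k =>
  x r k + th * \sum_i \sum_i' (if Z i i' && best c x th i i' k
                               then (i' == r :> nat)%:R - (i == r :> nat)%:R else 0).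

Lemma best_uniq c x th i i' j k : best c x th i i' j -> best c x th i i' k -> j = k.
Proof.
move=> /andP[uj /forallP bj] /andP[uk /forallP bk].
move: (bj k) (bk j); rewrite uj uk /= /beats !negb_or !negb_and -!leNgt -!ltNge -!leqNgt.
move=> /andP[h1 /orP[h2|h2]] /andP[h3 /orP[h4|h4]].
- by move: h1; rewrite leNgt h4.
- by move: h3; rewrite leNgt h2.
- by move: h1; rewrite leNgt h4.
- by apply/val_inj/eqP; rewrite eqn_leq h2 h4.
Qed.

Lemma best_exists c x th i i' j : usable x th i i' j ->
  exists k, best c x th i i' k /\ c i' k - c i k <= c i' j - c i j.
Proof.
move=> uj.
pose k0 := [arg min_(k < j | usable x th i i' k) (c i' k - c i k)]%O.
have [uk0 mink0] : usable x th i i' k0 /\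
    forall k, usable x th i i' k -> c i' k0 - c i k0 <= c i' k - c i k.
  by rewrite /k0; case: arg_minP => // k uk H; split.
pose P k := usable x th i i' k && (c i' k - c i k <= c i' k0 - c i k0).
have Pk0 : P k0 by rewrite /P uk0 lexx.
pose k1 := [arg min_(k < k0 | P k) (k : nat)].
have [/andP[uk1 lk1] mink1] : P k1 /\ forall k, P k -> (k1 <= k)%N.
  by rewrite /k1; case: arg_minnP => // k uk H; split.
exists k1; split; last by apply: le_trans lk1 (mink0 _ uj).
rewrite /best uk1; apply/forallP => k; apply/negP => /andP[uk] /orP[h|/andP[h1 h2]].
  by move: (lt_le_trans h lk1); rewrite ltNge mink0.
by move: h2; rewrite ltnNge mink1 // /P uk (le_trans h1 lk1).
Qed.

(** The difference of the two flows is a circulation between sources whose weight is the gap, so one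
    of its cycles accounts for a share [1 / (n * n * m)]. This cycle is replaced by a move with a
    short description: the amount becomes the least flow [x p q] among its edges, at least what the
    circulation carries, and every arc switches to its best sink. Both changes can only increase the
    gain. Since at most one arc of the cycle leaves each source, no edge is reduced twice. *)
Lemma round_gain c x y : flow x -> supported x -> flow y -> supported y -> lin c y < lin c x ->
  exists p q Z, [/\ flow (move c Z (x p q) x), supported (move c Z (x p q) x)
    & lin c x - lin c y <= (n * n * m)%:R * (lin c x - lin c (move c Z (x p q) x))].
Proof.
move=> [x0 xA xB] sx [y0 yA yB] sy gap.
pose P i j := Num.max (x i j - y i j) 0.
pose Q i j := Num.max (y i j - x i j) 0.
pose S j := \sum_i P i j.
have P0 i j : 0 <= P i j by rewrite /P le_max lexx orbT.
have Q0 i j : 0 <= Q i j by rewrite /Q le_max lexx orbT.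
have PQ i j : P i j - Q i j = x i j - y i j.
  by rewrite /P /Q; case: (lerP (x i j - y i j) 0); case: (lerP (y i j - x i j) 0); lra.
have PQ0 i j : P i j * Q i j = 0.
  rewrite /P /Q; case: (lerP (x i j - y i j) 0); case: (lerP (y i j - x i j) 0);
    rewrite ?mul0r ?mulr0 //; lra.
have S0 j : 0 <= S j by apply: sumr_ge0.
have SQ j : \sum_i Q i j = S j.
  apply/eqP; rewrite eq_sym -subr_eq0 -sumrB.
  by under eq_bigr do rewrite PQ; rewrite sumrB xB yB subrr.
(* At each sink the surplus of a source is spread over the deficits in proportion. When [S j] is
   zero all terms vanish, and division by zero returns the right value. *)
pose t i i' j := P i j * Q i' j / S j.
have tP i j : \sum_i' t i i' j = P i j.
  rewrite /t -mulr_suml -mulr_sumr SQ.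
  have [S0'|SN] := eqVneq (S j) 0; last by rewrite mulfK.
  rewrite S0' !mulr0 mul0r; apply/esym/eqP; move/eqP: S0'.
  rewrite psumr_eq0 // => /allP/(_ i); rewrite mem_index_enum; exact.
have tQ i' j : \sum_i t i i' j = Q i' j.
  rewrite /t -mulr_suml -mulr_suml -/(S j).
  have [S0'|SN] := eqVneq (S j) 0; last by rewrite mulrAC mulfV // mul1r.
  rewrite S0' !mul0r; apply/esym/eqP; move/eqP: S0'; rewrite -SQ.
  rewrite psumr_eq0 // => /allP/(_ i'); rewrite mem_index_enum; exact.
pose w i i' j := c i j - c i' j.
have circ : circulation t.
  split=> [i i' j|i j|i]; first by rewrite /t divr_ge0 ?mulr_ge0.
    by rewrite /t PQ0 mul0r.
  rewrite exchange_big [RHS]exchange_big /=.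
  under eq_bigr do rewrite tP; under [RHS]eq_bigr do rewrite tQ.
  apply/eqP; rewrite -subr_eq0 -sumrB; under eq_bigr do rewrite PQ.
  by rewrite sumrB xA yA subrr.
have W : weight t w = lin c x - lin c y.
  rewrite /weight /w.
  transitivity (\sum_j (\sum_i \sum_i' t i i' j * c i j - \sum_i' \sum_i t i i' j * c i' j)).
    under eq_bigr do rewrite exchange_big.
    rewrite exchange_big; apply: eq_bigr => j _ /=.
    rewrite [X in _ - X]exchange_big -sumrB; apply: eq_bigr => i _.
    by rewrite -sumrB; apply: eq_bigr => i' _; rewrite mulrBr.
  rewrite /lin exchange_big [X in _ - X]exchange_big -sumrB; apply: eq_bigr => j _ /=.
  under eq_bigr do rewrite -mulr_suml tP.
  under [X in _ - X]eq_bigr do rewrite -mulr_suml tQ.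
  rewrite -!sumrB; apply: eq_bigr => i _.
  by rewrite -mulrBl PQ mulrC mulrBr.
have cardN : (#|carrier t| <= n * n * m)%N.
  by apply: leq_trans (max_card _) _; rewrite !card_prod !card_ord.
have W0 : 0 < weight t w by rewrite W subr_gt0.
have [s [jj [th [th0 tth gain]]]] := circulation_cycle circ cardN W0.
have gp : 0 < \sum_(i | s i != i) w i (s i) (jj i).
  have : 0 < (n * n * m)%:R * (th * \sum_(i | s i != i) w i (s i) (jj i)).
    exact: lt_le_trans W0 gain.
  have n0 : (0 : R) <= (n * n * m)%:R by [].
  rewrite le_eqVlt in n0; case/orP: n0 => [/eqP <-|n0]; first by rewrite mul0r ltxx.
  by rewrite pmulr_rgt0 // pmulr_rgt0.
have [i0 mi0] : exists i, s i != i.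
  apply/existsP; apply: contraTT gp => /existsPn H; rewrite big_pred0 ?ltxx // => i.
  by apply/negbTE.
have tx i i' j : 0 < t i i' j -> t i i' j <= x i j /\ al i' j.
  move=> t0.
  have PQS : 0 < P i j * Q i' j / S j by [].
  have SN : 0 < S j.
    rewrite lt_neqAle S0 andbT eq_sym; apply/eqP => e.
    by move: PQS; rewrite e invr0 mulr0 ltxx.
  have Qp : 0 < Q i' j.
    rewrite lt_neqAle Q0 andbT eq_sym; apply/eqP => e.
    by move: PQS; rewrite e mulr0 mul0r ltxx.
  split.
    have tle : t i i' j <= P i j.
      rewrite /t ler_pdivrMr //; apply: ler_wpM2l => //.
      by rewrite -SQ (bigD1 i') //= lerDl sumr_ge0.
    apply: le_trans tle _; rewrite /P ge_max x0 andbT.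
    by rewrite gerBl y0.
  by apply: sy; move: Qp; rewrite /Q lt_max ltxx orbF; move: (x0 i' j); lra.
(* The amount must be named by an edge of the current flow, because the program enumerates edges and
   not real numbers. *)
pose p := [arg min_(i < i0 | s i != i) x i (jj i)]%O.
have [mp minp] : s p != p /\ forall i, s i != i -> x p (jj p) <= x i (jj i).
  by rewrite /p; case: arg_minP => // i mi H; split.
pose T := x p (jj p).
have thT : th <= T.
  have tp := tth _ mp; have [h _] := tx _ _ _ (lt_le_trans th0 tp).
  exact: le_trans tp h.
have T0 : 0 < T by apply: lt_le_trans thT.
have us i : s i != i -> usable x T i (s i) (jj i).
  move=> mi; rewrite /usable minp //=.
  by have [] := tx _ _ _ (lt_le_trans th0 (tth _ mi)).
have /fin_all_exists [jb jbP] i : exists k, s i != i ->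
    best c x T i (s i) k /\ c (s i) k - c i k <= c (s i) (jj i) - c i (jj i).
  case: (boolP (s i != i)) => mi; last by exists (jj i).
  by have [k h] := @best_exists c x _ _ _ _ (us _ mi); exists k.
pose Z i i' := (s i != i) && (i' == s i).
exists p, (jj p), Z; rewrite -/T.
have mE r k : move c Z T x r k = x r k +
    T * \sum_(i | s i != i) (jb i == k)%:R * ((s i == r)%:R - (i == r)%:R).
  rewrite /move [in RHS]big_mkcond; congr (_ + _ * _); apply: eq_bigr => i _ /=.
  rewrite (bigD1 (s i)) //= [X in _ + X]big1 ?addr0; last first.
    by move=> i' /negPf ne; rewrite /Z ne andbF.
  rewrite /Z eqxx andbT; case: (boolP (s i != i)) => mi //=.
  have [b _] := jbP _ mi.
  case: (jb i =P k) => [<-|ne]; first by rewrite b mul1r.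
  case: ifP => [b'|]; last by rewrite mul0r.
  by case: ne; apply: best_uniq b b'.
have col r : \sum_(i | s i != i) ((s i == r)%:R - (i == r)%:R : R) = 0.
  rewrite sumrB; apply/eqP; rewrite subr_eq0; apply/eqP.
  have e1 (F : pred 'I_n) a : \sum_(i | F i) ((i == a)%:R : R) = (F a)%:R.
    rewrite big_mkcond (bigD1 a) //= eqxx big1 ?addr0; first by case: (F a).
    by move=> i /negPf ->; case: ifP.
  rewrite e1 (reindex_inj (@perm_inj _ s^-1)%g) /=.
  under eq_bigr do rewrite permKV.
  rewrite e1 permKV -(inj_eq (@perm_inj _ s) r) permKV.
  by rewrite eq_sym.
have at1 (F : 'I_n -> R) r (G : pred 'I_n) : \sum_(i | G i) F i * (i == r)%:R =
   if G r then F r else 0.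
  rewrite big_mkcond (bigD1 r) //= eqxx mulr1 big1 ?addr0 // => i /negPf ->.
  by rewrite mulr0 if_same.
split.
- split=> [r k|r|k].
  + rewrite mE; under eq_bigr do rewrite mulrBr; rewrite sumrB.
    rewrite (at1 (fun i => (jb i == k)%:R)) mulrBr addrA addrAC.
    apply: addr_ge0; last first.
      by apply: mulr_ge0; [exact: ltW|apply: sumr_ge0 => i _; rewrite mulr_ge0].
    case: ifP => mr; last by rewrite mulr0 subr0.
    case: eqP => [<-|_]; last by rewrite mulr0 subr0.
    rewrite mulr1 subr_ge0.
    by have [/andP[/andP[h _] _] _] := jbP _ mr.
  + under eq_bigr do rewrite mE; rewrite big_split /= xA -mulr_sumr exchange_big /=.
    have one i : \sum_k ((jb i == k)%:R : R) = 1.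
      by rewrite (bigD1 (jb i)) //= eqxx big1 ?addr0 // => k; rewrite eq_sym => /negPf ->.
    by under eq_bigr do rewrite -mulr_suml one mul1r; rewrite col mulr0 addr0.
  + under eq_bigr do rewrite mE; rewrite big_split /= xB -mulr_sumr exchange_big /=.
    rewrite [X in _ * X]big1 ?mulr0 ?addr0 // => i _.
    have one a : \sum_r ((a == r :> 'I_n)%:R : R) = 1.
      by rewrite (bigD1 a) //= eqxx big1 ?addr0 // => r; rewrite eq_sym => /negPf ->.
    by rewrite -mulr_sumr sumrB !one subrr mulr0.
- move=> r k; rewrite mE => h.
  have [xp|xz] := ltP 0 (x r k); first exact: sx.
  have xz' : x r k = 0 by apply: le_anti; rewrite xz x0.
  move: h; rewrite xz' add0r pmulr_rgt0 // => h.
  have /existsP [i /and3P[mi /eqP jk /eqP sr]] : [exists i, [&& s i != i, jb i == k & s i == r]].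
    apply: contraTT h => /existsPn H; rewrite -leNgt; apply: sumr_le0 => i mi.
    case: (boolP (jb i == k)) => jk; last by rewrite mul0r.
    move: (H i); rewrite mi jk /= => /negPf ->; rewrite mul1r sub0r oppr_le0 //.
  have [/andP[/andP[_ h2] _] _] := jbP _ mi.
  by rewrite -jk -sr.
- have -> : lin c x - lin c (move c Z T x) = T * \sum_(i | s i != i) (c i (jb i) - c (s i) (jb i)).
    rewrite /lin -sumrB.
    transitivity (\sum_r \sum_k T * \sum_(i | s i != i) (jb i == k)%:R * ((i == r)%:R - (s i == r)%:R) * c r k).
      apply: eq_bigr => r _; rewrite -sumrB; apply: eq_bigr => k _; rewrite mE.
      rewrite -mulrBr opprD addNKr mulrN mulrC -mulNr -mulr_suml mulrA; congr (_ * _).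
      rewrite -mulrN; congr (_ * _); rewrite -sumrN; apply: eq_bigr => i _.
      by rewrite -mulrN opprB.
    under eq_bigr do rewrite -mulr_sumr; rewrite -mulr_sumr; congr (_ * _).
    under eq_bigr do rewrite exchange_big /=; rewrite exchange_big /=; apply: eq_bigr => i mi.
    have inner r : \sum_k (jb i == k)%:R * ((i == r)%:R - (s i == r)%:R) * c r k =
       ((i == r)%:R - (s i == r)%:R) * c r (jb i).
      rewrite (bigD1 (jb i)) //= eqxx mul1r big1 ?addr0 // => k.
      by rewrite eq_sym => /negPf ->; rewrite !mul0r.
    under eq_bigr do rewrite inner mulrBl; rewrite sumrB; congr (_ - _).
      rewrite (bigD1 i) //= eqxx mul1r big1 ?addr0 // => k.
      by rewrite eq_sym => /negPf ->; rewrite !mul0r.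
    rewrite (bigD1 (s i)) //= eqxx mul1r big1 ?addr0 // => k.
    by rewrite eq_sym => /negPf ->; rewrite !mul0r.
  rewrite -W; apply: le_trans gain _; apply: ler_wpM2l => //.
  apply: (@le_trans _ _ (T * \sum_(i | s i != i) w i (s i) (jj i))).
    by apply: ler_wpM2r => //; exact: ltW.
  apply: ler_wpM2l; first exact: ltW.
  by apply: ler_sum => i mi; have [_ h] := jbP _ mi; rewrite /w; lra.
Qed.

End Flows.

(** * Cuts and 4-cycles *)

Section Hall.
Variables (R : realFieldType) (n m : nat).
Implicit Types (E : 'I_n -> 'I_m -> bool) (ra : 'I_n -> R) (rb : 'I_m -> R) (S : {set 'I_n}).

Definition nbr E k : {set 'I_n} := [set i | E i k].

Definition hall E ra rb : Prop :=
  forall S, \sum_(k | nbr E k \subset S) rb k <= \sum_(i in S) ra i.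

(** What the sources of [S] can spare for sink [j] once they have served the other sinks that depend
    on [S] alone. *)
Definition slack E ra rb j S : R :=
  \sum_(i in S) ra i - \sum_(k | (k != j) && (nbr E k \subset S)) rb k.

Lemma hall_flow A B E x : flow A B x -> supported E x -> hall E A B.
Proof.
move=> [x0 xA xB] sx S.
apply: (@le_trans _ _ (\sum_k \sum_(i in S) x i k)); last first.
  by rewrite exchange_big /=; under eq_bigr do rewrite xA.
rewrite [leRHS](bigID (fun k => nbr E k \subset S)) /= -[leLHS]addr0.
apply: lerD; last by do 2![apply: sumr_ge0 => ? _].
apply: ler_sum => k kS; rewrite -xB (bigID (mem S)) /= [X in _ + X]big1 ?addr0 // => i iS.
apply: le_anti; rewrite x0 andbT leNgt; apply/negP => /sx Ei.
by move/negP: iS; apply; apply: (subsetP kS); rewrite inE.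
Qed.

Lemma hall_ge0 E ra rb i : (forall k, 0 <= rb k) -> hall E ra rb -> 0 <= ra i.
Proof.
move=> rb0 /(_ [set i]); rewrite big_set1; apply: le_trans.
by apply: sumr_ge0.
Qed.

(* By supermodularity of the demand enclosed in [S], no cut forces more flow on
   the edge [(i, j)] than another one allows. *)
Lemma hall_step E E' ra ra' rb rb' i j t :
  (forall k, 0 <= rb k) -> hall E ra rb -> E i j ->
  (forall r k, E' r k = E r k && ((r, k) != (i, j))) ->
  (forall r, ra' r = ra r - (if r == i then t else 0)) ->
  (forall k, rb' k = rb k - (if k == j then t else 0)) ->
  t <= rb j ->
  (forall S, i \in S -> ~~ (nbr E' j \subset S) -> t <= slack E ra rb j S) ->
  (t = rb j \/ exists S, [/\ i \in S, ~~ (nbr E' j \subset S) & t = slack E ra rb j S]) ->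
  0 <= t /\ hall E' ra' rb'.
Proof.
move=> rb0 H Eij E'E ra'E rb'E trb tS tE.
have nbr' k : k != j -> nbr E' k = nbr E k.
  by move=> kj; apply/setP => r; rewrite !inE E'E xpair_eqE (negPf kj) andbF andbT.
have nbrj S : (nbr E j \subset S) = (i \in S) && (nbr E' j \subset S).
  apply/idP/andP => [sS|[iS sS]].
    split; first by apply: (subsetP sS); rewrite inE.
    apply/subsetP => r; rewrite inE E'E => /andP[Er _]; apply: (subsetP sS).
    by rewrite inE.
  apply/subsetP => r; rewrite inE => Er; have [->//|ri] := eqVneq r i.
  by apply: (subsetP sS); rewrite inE E'E Er xpair_eqE (negPf ri).
have dem (F : 'I_m -> R) S : \sum_(k | nbr E k \subset S) F k =
    (if nbr E j \subset S then F j else 0) +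
    \sum_(k | (k != j) && (nbr E k \subset S)) F k.
  rewrite big_mkcond (bigD1 j) //=; congr (_ + _).
  by rewrite -big_mkcondr; apply: eq_bigl => k.
have dem' S : \sum_(k | nbr E' k \subset S) rb' k =
    (if nbr E' j \subset S then rb j - t else 0) +
    \sum_(k | (k != j) && (nbr E k \subset S)) rb k.
  rewrite big_mkcond (bigD1 j) //= rb'E eqxx; congr (_ + _).
  rewrite [RHS]big_mkcondr /=; apply: eq_bigr => k kj.
  by rewrite nbr' // rb'E (negPf kj) subr0.
have sup S : \sum_(r in S) ra' r = \sum_(r in S) ra r - (if i \in S then t else 0).
  under eq_bigr do rewrite ra'E; rewrite sumrB; congr (_ - _).
  rewrite big_mkcond (bigD1 i) //= eqxx big1 ?addr0 // => k /negPf ->.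
  by rewrite if_same.
set D := fun S => \sum_(k | (k != j) && (nbr E k \subset S)) rb k in dem dem' *.
have slE S : slack E ra rb j S = \sum_(r in S) ra r - D S by [].
have demE S : \sum_(k | nbr E k \subset S) rb k =
   (if nbr E j \subset S then rb j else 0) + D S by rewrite dem.
have DH S : D S <= \sum_(r in S) ra r.
  by apply: le_trans (H S); rewrite demE lerDr; case: ifP.
split.
  by case: tE => [->//|[S [_ _ ->]]]; rewrite slE subr_ge0.
(* The delicate cuts are those without [i]: their supply is unchanged, but after the deletion of
   [(i, j)] they may enclose sink [j], with demand [rb j - t]. There [t] must be large, which is
   where its being extremal is used: the tight cut [S2] is uncrossed with [S]. *)
move=> S; rewrite dem' sup; case: (boolP (i \in S)) => iS; last first.
  rewrite subr0; case: ifP => nS; last by rewrite add0r; exact: DH.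
  case: tE => [->|[S2 [iS2 nS2 ->]]]; first by rewrite subrr add0r; exact: DH.
  have HU := H (S :|: S2); have HI := DH (S :&: S2).
  have sU : nbr E j \subset S :|: S2.
    by rewrite nbrj inE iS2 orbT (subset_trans nS (subsetUl _ _)).
  rewrite demE sU in HU.
  have mod (F : 'I_n -> R) : \sum_(r in S :|: S2) F r + \sum_(r in S :&: S2) F r =
      \sum_(r in S) F r + \sum_(r in S2) F r.
    rewrite ![\sum_(_ in _) _]big_mkcond -!big_split /=; apply: eq_bigr => r _.
    by rewrite !inE; case: (r \in S); case: (r \in S2); rewrite ?addr0 ?add0r.
  have sm : D S + D S2 <= D (S :|: S2) + D (S :&: S2).
    rewrite /D ![\sum_(_ | (_ != j) && _) _]big_mkcondr -!big_split /=.
    apply: ler_sum => k _; have := rb0 k.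
    rewrite subsetI; case: (boolP (nbr E k \subset S)) => h1;
      case: (boolP (nbr E k \subset S2)) => h2 /=;
      rewrite ?(subset_trans h1 (subsetUl _ _)) ?(subset_trans h2 (subsetUr _ _)) //;
      do ?[case: ifP => _]; lra.
  rewrite slE; have := mod ra; move: HU HI sm; rewrite -/(D S); lra.
case: ifP => nS; last first.
  by have := tS _ iS (negbT nS); rewrite slE add0r -/(D S); lra.
have := H S; rewrite demE nbrj iS nS /= -/(D S); lra.
Qed.

End Hall.

Section Cancel.
Variables (R : realFieldType) (n m : nat).
Variables (A : 'I_n -> R) (B : 'I_m -> R) (al : 'I_n -> 'I_m -> bool).
Implicit Types (x y c f : 'I_n -> 'I_m -> R).

Definition full x i i' j j' := [&& 0 < x i j, 0 < x i' j', 0 < x i' j & 0 < x i j'].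

Definition turn x i i' j j' t : 'I_n -> 'I_m -> R := fun r k =>
  x r k + t * (((i' == r) && (j == k))%:R + ((i == r) && (j' == k))%:R
               - ((i == r) && (j == k))%:R - ((i' == r) && (j' == k))%:R).

Definition turncost c (i i' : 'I_n) (j j' : 'I_m) : R := c i j + c i' j' - c i' j - c i j'.

Lemma sum_pair x i j : \sum_r \sum_k x r k * ((i == r) && (j == k))%:R = x i j.
Proof.
rewrite (bigD1 i) //= [X in _ + X]big1 ?addr0; last first.
  by move=> r; rewrite eq_sym => /negPf ->; rewrite big1 // => k _; rewrite mulr0.
rewrite (bigD1 j) //= !eqxx mulr1 big1 ?addr0 // => k.
by rewrite eq_sym => /negPf ->; rewrite mulr0.
Qed.

(** The two entries that grow are already positive, so the support does not grow; the smaller of the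
    two others becomes zero, which breaks a nondegenerate rectangle for good. *)
Lemma turn_ok c x i i' j j' t : flow A B x -> full x i i' j j' -> 0 <= turncost c i i' j j' ->
  t = Num.min (x i j) (x i' j') ->
  [/\ flow A B (turn x i i' j j' t), forall r k, 0 < turn x i i' j j' t r k -> 0 < x r k,
      lin c (turn x i i' j j' t) <= lin c x
    & i != i' -> j != j' -> ~~ full (turn x i i' j j' t) i i' j j'].
Proof.
move=> [x0 xA xB] /and4P[p1 p2 p3 p4] tc tE.
have t0 : 0 < t by rewrite tE lt_min p1.
have t1 : t <= x i j by rewrite tE ge_min lexx.
have t2 : t <= x i' j' by rewrite tE ge_min lexx orbT.
have t3 : (x i j <= t) || (x i' j' <= t).
  by rewrite tE !le_min !lexx /=; case: (lerP (x i j) (x i' j')) => // /ltW ->.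
move: t tE t0 t1 t2 t3 => t _ t0 t1 t2 t3.
have one (T : finType) (a : T) (b : bool) : \sum_k (b && (a == k))%:R = b%:R :> R.
  rewrite (bigD1 a) //= eqxx andbT big1 ?addr0 // => k.
  by rewrite eq_sym => /negPf ->; rewrite andbF.
have one' (T : finType) (a : T) (b : bool) : \sum_k ((a == k) && b)%:R = b%:R :> R.
  by under eq_bigr do rewrite andbC; rewrite one.
split.
- split=> [r k|r|k]; rewrite /turn.
  + have := x0 r k.
    have [er|nr] := eqVneq i r; have [er'|nr'] := eqVneq i' r;
    have [ek|nk] := eqVneq j k; have [ek'|nk'] := eqVneq j' k; subst => //=; rewrite ?eqxx /=;
    rewrite ?addr0 ?add0r ?subr0; move: t1 t2 t0 p1 p2; try lra.
  + by rewrite big_split /= xA -mulr_sumr !sumrB big_split /= !one; ring.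
  + by rewrite big_split /= xB -mulr_sumr !sumrB big_split /= !one'; ring.
- move=> r k; rewrite /turn => h; rewrite lt_neqAle x0 andbT eq_sym; apply/eqP => e.
  move: h; rewrite e; 
  have [er|nr] := eqVneq i r; have [er'|nr'] := eqVneq i' r;
  have [ek|nk] := eqVneq j k; have [ek'|nk'] := eqVneq j' k; subst => //=; rewrite ?eqxx /=;
  move: t1 t2 t0 p1 p2 p3 p4 e; try lra.
- have -> : lin c (turn x i i' j j' t) = lin c x - t * turncost c i i' j j'.
    rewrite /lin /turn.
    transitivity (\sum_r \sum_k (c r k * x r k + t * (c r k * ((i' == r) && (j == k))%:R +
      c r k * ((i == r) && (j' == k))%:R - c r k * ((i == r) && (j == k))%:R
      - c r k * ((i' == r) && (j' == k))%:R))).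
      by apply: eq_bigr => r _; apply: eq_bigr => k _; ring.
    under eq_bigr do rewrite big_split /= -mulr_sumr !sumrB big_split /=.
    rewrite big_split /= -mulr_sumr !sumrB big_split /= !sum_pair /turncost; ring.
  by rewrite gerBl mulr_ge0 // ltW.
- move=> /negPf ni /negPf nj.
  have e1 : turn x i i' j j' t i j = x i j - t.
    by rewrite /turn !eqxx [i' == i]eq_sym [j' == j]eq_sym ni nj /=; ring.
  have e2 : turn x i i' j j' t i' j' = x i' j' - t.
    by rewrite /turn !eqxx ni nj /=; ring.
  by rewrite /full e1 e2 !subr_gt0; case/orP: t3 => h; rewrite ![t < _]ltNge h ?andbF.
Qed.

Definition fcost f x : R := \sum_i \sum_j (if 0 < x i j then f i j else 0).

(** A cheap edge that serves its sink alone carries [B j], so its linear cost is exactly its fixed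
    cost. The other cheap edges are at most [n * n] in number and are charged [d] each. *)
Lemma fcost_forest f (ch : 'I_n -> 'I_m -> bool) c x d : flow A B x -> supported al x ->
  (forall i j, 0 <= f i j) -> (forall j, 0 < B j) -> 0 <= d ->
  (forall i j, ch i j -> f i j <= d) ->
  (forall i j, c i j = if ch i j then f i j / B j else 0) ->
  (forall i i' j j', i != i' -> j != j' -> ~~ full x i i' j j') ->
  fcost f x <= \sum_i \sum_j (if al i j && ~~ ch i j then f i j else 0) + lin c x
               + (n * n)%:R * d.
Proof.
move=> [x0 xA xB] sx f0 B0 d0 fd cE nf.
pose sp i j := (0 < x i j) && [exists i', (i' != i) && (0 < x i' j)].
have c0 i j : 0 <= c i j by rewrite cE; case: ifP => // _; rewrite divr_ge0 // ltW.
have pt i j : (if 0 < x i j then f i j else 0) <=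
   (if al i j && ~~ ch i j then f i j else 0) + c i j * x i j + (sp i j)%:R * d.
  have spd : 0 <= (sp i j)%:R * d by rewrite mulr_ge0.
  have cx : 0 <= c i j * x i j by rewrite mulr_ge0.
  case: ifP => [xp|_]; last by rewrite !addr_ge0 //; case: ifP.
  rewrite (sx _ _ xp) /=; case: (boolP (ch i j)) => chij /=; last by rewrite -addrA lerDl addr_ge0.
  rewrite add0r; case: (boolP (sp i j)) => [_|nsp].
    by rewrite mul1r -[f i j]add0r; apply: lerD => //; apply: fd.
  rewrite mul0r addr0 cE chij.
  have -> : x i j = B j.
    rewrite -xB (bigD1 i) //= big1 ?addr0 // => i' ni.
    apply: le_anti; rewrite x0 andbT leNgt; apply/negP => xp'.
    by move/negP: nsp; apply; rewrite /sp xp; apply/existsP; exists i'; rewrite ni.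
  by rewrite divfK // gt_eqF.
apply: le_trans (ler_sum _ (fun i _ => ler_sum _ (fun j _ => pt i j))) _.
under eq_bigr do rewrite !big_split /=.
rewrite !big_split /= lerD2l.
under eq_bigr do rewrite -mulr_suml; rewrite -mulr_suml; apply: ler_wpM2r => //.
rewrite pair_big /= -natr_sum ler_nat.
pose D := [set a : 'I_n * 'I_m | sp a.1 a.2].
have -> : (\sum_(a : 'I_n * 'I_m) sp a.1 a.2 = #|D|)%N.
  by rewrite -sum1_card [RHS]big_mkcond /=; apply: eq_bigr => a _; rewrite inE; case: (sp _ _).
(* An edge that shares its sink is sent to the pair of its source and another source of that sink.
   Two sinks with the same pair would span a full rectangle, so this map is injective. *)
pose g (a : 'I_n * 'I_m) := (a.1, odflt a.1 [pick i' | (i' != a.1) && (0 < x i' a.2)]).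
have gP a : a \in D -> ((g a).2 != a.1) && (0 < x (g a).2 a.2).
  rewrite inE /g => /andP[_ /existsP [i' h]] /=; case: pickP => [//|/(_ i')].
  by rewrite h.
rewrite -(card_in_imset (f := g) (D := D)).
  by apply: leq_trans (max_card _) _; rewrite card_prod !card_ord.
move=> [i j] [i1 j1] aD bD gab; have /andP[a1 a2] := gP _ aD; have /andP[b1 b2] := gP _ bD.
have ii : i = i1 by case: gab.
move: gab aD bD a1 a2 b1 b2; rewrite -ii => {i1 ii} gab aD bD a1 a2 b1 b2; congr (_, _); apply/eqP; apply: contraT => nj.
have := nf i (g (i, j)).2 j j1; rewrite eq_sym a1 nj => /(_ isT isT)/negP; case.
move: aD bD; rewrite !inE /= => /andP[xa _] /andP[xb _].
by move: a2 b2; rewrite -gab /full xa xb /= => -> ->.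
Qed.

End Cancel.

(** * Exchanging sinks of the same cost type *)

Section Guess.
Variables (R : realFieldType) (n m : nat).
Variables (A : 'I_n -> R) (B : 'I_m -> R) (f : 'I_n -> 'I_m -> R) (V : R) (L M : nat).

Definition thr (l : nat) i j : bool := L%:R * f i j <= l%:R * V.

Definition same (j k : 'I_m) : bool :=
  [forall i : 'I_n, [forall l : 'I_L, thr l.+1 i j == thr l.+1 i k]].

Definition before (k j : 'I_m) : bool := (B j < B k) || (B j <= B k) && (k < j)%N.

(** As [before] breaks ties of demand by the index, distinct sinks of one type have distinct
    ranks. *)
Definition rank j : nat := #|[set k | same j k && before k j]|.

Definition cand j : bool := (rank j < M)%N.

Lemma same_refl j : same j j.
Proof. by apply/forallP => i; apply/forallP => l. Qed.

Lemma sameP j k : reflect (forall i (l : 'I_L), thr l.+1 i j = thr l.+1 i k) (same j k).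
Proof.
apply: (iffP forallP) => [H i l|H i]; first by have /forallP/(_ l)/eqP := H i.
by apply/forallP => l; rewrite H.
Qed.

Lemma same_sym j k : same j k = same k j.
Proof. by apply/sameP/sameP => H i l; rewrite H. Qed.

Lemma same_trans k j l : same j k -> same k l -> same j l.
Proof. by move=> /sameP H /sameP H'; apply/sameP => i t; rewrite H H'. Qed.

Lemma same_thr j k i l : same j k -> (0 < l <= L)%N -> thr l i j = thr l i k.
Proof. by move=> /sameP H; case: l => // l lL; apply: (H i (Ordinal lL)). Qed.

(** The least threshold [l] met by [f i j] is also met by [f i k], while [f i j] exceeds threshold
    [l - 1]. For [l = 1] the nonnegativity of [f i j] takes the place of the latter. *)
Lemma same_close j k i : 0 <= V -> (forall i j, 0 <= f i j) -> (0 < L)%N ->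
  same j k -> thr L i j -> f i k <= f i j + V / L%:R.
Proof.
move=> V0 f0 L0 s tL.
have L0' : 0 < L%:R :> R by rewrite ltr0n.
have ex : exists l, (0 < l)%N && thr l i j by exists L; rewrite L0.
have [l /andP[l0 tl] lmin] := ex_minnP ex.
have lL : (l <= L)%N by apply: lmin; rewrite L0.
have tk : thr l i k by rewrite -(same_thr i s) // l0.
suff H : L%:R * f i k <= L%:R * f i j + V.
  by rewrite -(ler_pM2l L0') mulrDr mulrCA mulfV ?mulr1 // gt_eqF.
case: l l0 tl lmin lL tk => // -[|l] _ tl lmin lL.
  by rewrite /thr mul1r => h; apply: le_trans h _; rewrite lerDr mulr_ge0.
move=> h; have : ~~ thr l.+1 i j by apply/negP => h'; have := lmin l.+1 h'; rewrite ltnn.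
by rewrite /thr -ltNge => h'; move: h; rewrite /thr -[l.+2]addn1 natrD; lra.
Qed.

Lemma before_irr j : before j j = false.
Proof. by rewrite /before ltxx ltnn andbF. Qed.

Lemma before_trans k j l : before j k -> before k l -> before j l.
Proof.
rewrite /before => /orP[h1|/andP[h1 h2]] /orP[h3|/andP[h3 h4]].
- by rewrite (lt_trans h3 h1).
- by rewrite (le_lt_trans h3 h1).
- by rewrite (lt_le_trans h3 h1).
- by rewrite (le_trans h3 h1) (ltn_trans h2 h4) orbT.
Qed.

Lemma before_total j k : j != k -> before j k || before k j.
Proof.
move=> ne; rewrite /before; case: (ltgtP (B j) (B k)) => _ //=.
by case: (ltngtP j k) => // e; move: ne; rewrite (val_inj e) eqxx.
Qed.

Lemma rank_lt j k : same j k -> before j k -> (rank j < rank k)%N.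
Proof.
move=> s b; have sk : same k j by rewrite same_sym.
apply: proper_card; apply/properP; split.
  apply/subsetP => l; rewrite !inE => /andP[sl bl].
  by rewrite (same_trans sk sl) (before_trans bl b).
by exists j; rewrite !inE ?before_irr ?andbF // sk.
Qed.

(** A candidate is determined by its pattern of thresholds and its rank. *)
Lemma card_cand : (#|[set j | cand j]| <= 2 ^ (n * L) * M)%N.
Proof.
case: (posnP M) => [M0|M0].
  by rewrite (_ : [set j | cand j] = set0) ?cards0 //; apply/setP => j; rewrite !inE /cand M0.
pose g j : {ffun 'I_n * 'I_L -> bool} * 'I_M.-1.+1 :=
  ([ffun a : 'I_n * 'I_L => thr a.2.+1 a.1 j], inord (rank j)).
rewrite -(card_in_imset (f := g)).
  apply: leq_trans (max_card _) _.
  by rewrite card_prod card_ffun card_prod !card_ord card_bool prednK.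
move=> j k; rewrite !inE => cj ck [/ffunP e1 /(congr1 val)]; rewrite /= !inordK ?prednK // => e2.
have s : same j k by apply/sameP => i l; have := e1 (i, l); rewrite !ffunE.
apply/eqP; apply: contraT => /before_total /orP[/(rank_lt s)|/rank_lt].
  by rewrite e2 ltnn.
by rewrite same_sym => /(_ s); rewrite e2 ltnn.
Qed.

Section Swap.
Variables (o : 'I_n -> 'I_m -> R) (kap Kx K : nat).
Hypothesis oflow : flow A B o.
Hypothesis B0 : forall j, 0 < B j.
Hypothesis f0 : forall i j, 0 <= f i j.
Hypothesis costV : fcost f o <= V.
Hypothesis kap0 : (0 < kap)%N.
Hypothesis Kx0 : (0 < Kx)%N.
Hypothesis K0 : (0 < K)%N.
Hypothesis LE : L = (kap * Kx)%N.
Hypothesis ME : (K.+1 * Kx <= M)%N.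

Let o0 : forall i j, 0 <= o i j. Proof. by case: oflow. Qed.
Let L0 : (0 < L)%N. Proof. by rewrite LE muln_gt0 kap0. Qed.

Let LR0 : 0 < L%:R :> R. Proof. by rewrite ltr0n. Qed.
Let c1 j := \sum_i (if 0 < o i j then f i j else 0).
Let c10 j : 0 <= c1 j. Proof. by apply: sumr_ge0 => i _; case: ifP. Qed.
Let costE : fcost f o = \sum_j c1 j. Proof. by rewrite /fcost exchange_big. Qed.
Let V0 : 0 <= V. Proof. by apply: le_trans costV; rewrite costE sumr_ge0. Qed.
Let c1_le j : c1 j <= V.
Proof. by apply: le_trans costV; rewrite costE (bigD1 j) //= lerDl sumr_ge0. Qed.

Let used i j : 0 < o i j -> f i j <= c1 j.
Proof. by move=> h; rewrite /c1 (bigD1 i) //= h lerDl sumr_ge0 // => k _; case: ifP. Qed.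

Let used_thr i j : 0 < o i j -> thr L i j.
Proof. by move=> h; rewrite /thr ler_pM2l // (le_trans (used h)). Qed.

Let J := [set j | [exists i, (0 < o i j) && ~~ thr kap i j]].

(** Each sink of [J] pays at least [kap * V / L] in [o], and the total is at most [V]. When [V = 0]
    this says nothing, but then every used edge is free and [J] is empty. *)
Let cardJ : (#|J| <= Kx)%N.
Proof.
have h1 : \sum_(j in J) (kap%:R * V) <= \sum_(j in J) (L%:R * c1 j).
  apply: ler_sum => j; rewrite inE => /existsP [i /andP[oij]].
  rewrite /thr -ltNge => /ltW h; apply: le_trans h _.
  by rewrite ler_pM2l // used.
have h2 : \sum_(j in J) (L%:R * c1 j) <= L%:R * V.
  rewrite -mulr_sumr ler_pM2l //; apply: le_trans costV; rewrite costE.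
  by rewrite [leRHS](bigID (mem J)) /= lerDl sumr_ge0.
have := le_trans h1 h2; rewrite sumr_const -[_ *+ #|_|]mulr_natl.
have [Vz _|Vn h] := eqVneq V 0.
  suff -> : J = set0 by rewrite cards0.
  apply/setP => j; rewrite !inE; apply/negbTE/existsPn => i; rewrite negb_and negbK.
  case: ltP => //= oij; rewrite /thr Vz mulr0 pmulr_rle0 //.
  by rewrite -Vz (le_trans (used oij)).
have Vp : 0 < V by rewrite lt_neqAle eq_sym Vn.
move: h; rewrite mulrA ler_pM2r // -natrM ler_nat LE [(kap * _)%N]mulnC.
by rewrite leq_pmul2r.
Qed.

Let Bad := [set j in J | ~~ cand j].

Let C j := [set k | [&& same j k, cand k, k \notin J
   & [forall l, same j l ==> ~~ cand l ==> before k l]]].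

(** At least [M] sinks precede the first non-candidate [u] of the type. All of them are candidates,
    and at most [Kx] lie in [J]; hence the factor [K.+1] in [ME]. *)
Let cardC j : j \in Bad -> (K * Kx <= #|C j|)%N.
Proof.
rewrite inE => /andP[_ nc].
pose P k := same j k && ~~ cand k.
have Pj : P j by rewrite /P same_refl.
pose u := [arg min_(k < j | P k) rank k].
have [/andP[su nu] minu] : P u /\ forall k, P k -> (rank u <= rank k)%N.
  by rewrite /u; case: arg_minnP => // k Pk H; split.
pose Bf := [set k | same u k && before k u].
have cBf : (M <= #|Bf|)%N by rewrite leqNgt.
have sub : Bf :\: J \subset C j.
  apply/subsetP => k; rewrite !inE => /andP[kJ /andP[suk bk]].
  have sk := same_trans su suk; rewrite sk kJ /=; apply/andP; split.
    apply: contraT => nk; have := minu k; rewrite /P sk nk => /(_ isT).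
    by rewrite leqNgt rank_lt // same_sym.
  apply/forallP => l; apply/implyP => sl; apply/implyP => nl.
  have [->//|ne] := eqVneq l u.
  have /orP[b|b] := before_total ne; last exact: before_trans bk b.
  have := minu l; rewrite /P sl nl => /(_ isT); rewrite leqNgt rank_lt //.
  by rewrite same_sym; apply: same_trans sl; rewrite same_sym.
apply: leq_trans (subset_leq_card sub).
have := cardsID J Bf; have : (#|Bf :&: J| <= Kx)%N.
  by apply: leq_trans cardJ; apply: subset_leq_card; apply: subsetIr.
move: cBf ME; rewrite mulSn; lia.
Qed.

(** The replacements of a type are cut into [K] blocks of length [Kx]. Family [s] uses block [s], at
    the position of [j] in [J], so that all families are disjoint and each is injective. *)
Let psi (s : 'I_K) j := nth j (enum (C j)) (s * Kx + index j (enum J)).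

Let psi_idx (s : 'I_K) j : j \in Bad -> (s * Kx + index j (enum J) < size (enum (C j)))%N.
Proof.
move=> jB; rewrite -cardE; apply: leq_trans (cardC jB).
have jJ : j \in J by move: jB; rewrite inE => /andP[].
have : (index j (enum J) < Kx)%N.
  by apply: leq_trans cardJ; rewrite cardE index_mem mem_enum.
have := ltn_ord s; nia.
Qed.

Let psiC s j : j \in Bad -> psi s j \in C j.
Proof. by move=> jB; rewrite -mem_enum mem_nth // psi_idx. Qed.

Let C_same j k : same j k -> C j = C k.
Proof.
move=> s; have e l : same j l = same k l.
  by apply/idP/idP => h; [apply: same_trans h; rewrite same_sym|apply: same_trans h].
apply/setP => l; rewrite !inE e; do 3!congr (_ && _).
by apply: eq_forallb => t; rewrite e.
Qed.

Let psi_inj s t j k : j \in Bad -> k \in Bad -> psi s j = psi t k -> s = t /\ j = k.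
Proof.
move=> jB kB e.
have jk : same j k.
  have := psiC s jB; have := psiC t kB; rewrite -e !inE => /andP[h1 _] /andP[h2 _].
  by apply: same_trans h2 _; rewrite same_sym.
have jJ : j \in J by move: jB; rewrite inE => /andP[].
have kJ : k \in J by move: kB; rewrite inE => /andP[].
move: e; rewrite /psi (set_nth_default k) ?psi_idx // (C_same jk) => /eqP.
have lj := psi_idx s jB; rewrite (C_same jk) in lj.
rewrite nth_uniq ?psi_idx ?enum_uniq // => /eqP e.
have ij : (index j (enum J) < Kx)%N.
  by apply: leq_trans cardJ; rewrite cardE index_mem mem_enum.
have ik : (index k (enum J) < Kx)%N.
  by apply: leq_trans cardJ; rewrite cardE index_mem mem_enum.
have st : s = t.
  apply: val_inj => /=; have := congr1 (divn^~ Kx) e.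
  by rewrite /= !divnMDl // !divn_small // !addn0.
split=> //; move: e; rewrite st => /addnI e.
by rewrite -(nth_index j (_ : j \in enum J)) ?mem_enum // e nth_index ?mem_enum.
Qed.

(** Averaging: the [K] families are disjoint, so their costs in [o] add up to at most the cost of
    [o]. *)
Let cheap_psi : exists s, K%:R * \sum_(j in Bad) c1 (psi s j) <= fcost f o.
Proof.
pose D := [set a : 'I_K * 'I_m | a.2 \in Bad].
have DE a : (a \in D) = (a.2 \in Bad) by rewrite inE.
have inj : {in D &, injective (fun a => psi a.1 a.2)}.
  move=> [s j] [t k]; rewrite !DE /= => jB kB e.
  by have [-> ->] := psi_inj jB kB e.
have tot : \sum_s \sum_(j in Bad) c1 (psi s j) <= fcost f o.
  rewrite pair_big_dep /= (eq_bigl (mem D)); last by move=> a; rewrite [RHS]DE.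
  rewrite -(big_imset (fun j => c1 j) inj) /= costE.
  by rewrite [leRHS](bigID (mem [set psi a.1 a.2 | a in D])) /= lerDl sumr_ge0.
pose S s := \sum_(j in Bad) c1 (psi s j).
pose s0 := [arg min_(s < Ordinal K0) S s]%O.
have s0min s : S s0 <= S s by rewrite /s0; case: arg_minP => // u _ H; apply: H.
exists s0; apply: le_trans tot; rewrite mulr_natl -[X in _ *+ X]card_ord -sumr_const.
by apply: ler_sum => s _; apply: s0min.
Qed.

(** A bad sink [k] takes the pattern of the larger sink [p k], scaled down by [rho k], and hands
    over its own pattern in return, so all row and column sums are kept. As [p k] is not in [J] and
    has the same type, [k] then uses cheap edges only, while the expensive ones have moved to the
    candidate [p k]. The pattern of [p k] is paid once more, which costs OPT / K in all, and each of
    the at most [Kx] exchanges moves two patterns of at most [n] edges, with an error [V / L] per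
    edge. *)
Lemma swap_exists : exists y, [/\ flow A B y,
   forall i j, 0 < y i j -> ~~ thr kap i j -> cand j && thr L i j
   & fcost f y <= fcost f o + fcost f o / K%:R + (2 * n * Kx)%:R * (V / L%:R)].
Proof.
have [s hs] := cheap_psi; pose p := psi s.
have pC k : k \in Bad -> p k \in C k by apply: psiC.
have pinj k l : k \in Bad -> l \in Bad -> p k = p l -> k = l.
  by move=> kB lB e; have [] := psi_inj kB lB e.
have pJ k : k \in Bad -> p k \notin J by move/pC; rewrite inE => /and4P[].
have pBad k l : k \in Bad -> l \in Bad -> p k == l = false.
  move=> kB lB; apply/negP => /eqP e; move: (pJ k kB); rewrite e.
  by move: lB; rewrite inE => /andP[-> _].
have pB k : k \in Bad -> B k <= B (p k).
  move=> kB; move: (pC k kB); rewrite inE => /and4P[_ _ _ /forallP/(_ k)].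
  rewrite same_refl; move: kB; rewrite inE => /andP[_ ->] /=.
  by rewrite /before => /orP[/ltW|/andP[]].
have ps k : k \in Bad -> same k (p k) by move/pC; rewrite inE => /and4P[].
pose rho k := B k / B (p k).
have rho0 k : 0 <= rho k by rewrite /rho divr_ge0 // ltW.
have rho1 k : k \in Bad -> rho k <= 1 by move=> kB; rewrite /rho ler_pdivrMr // mul1r pB.
pose y i j := o i j + \sum_(k in Bad) ((j == k)%:R - (j == p k)%:R) * (rho k * o i (p k) - o i k).
have [_ oA oB] := oflow.
have one (k : 'I_m) : \sum_j ((j == k)%:R : R) = 1.
  by rewrite (bigD1 k) //= eqxx big1 ?addr0 // => j /negPf ->.
have yBad i j : j \in Bad -> y i j = rho j * o i (p j).
  move=> jB; rewrite /y (bigD1 j) //= eqxx eq_sym pBad // subr0 mul1r big1 ?addr0; first by ring.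
  by move=> k /andP[kB kj]; rewrite [j == p k]eq_sym pBad // eq_sym (negPf kj) subr0 mul0r.
have yp i k : k \in Bad -> y i (p k) = o i k + (1 - rho k) * o i (p k).
  move=> kB; rewrite /y (bigD1 k) //= eqxx pBad // sub0r /= big1 ?addr0; first by ring.
  move=> l /andP[lB lk]; rewrite pBad // sub0r.
  case: eqP => [/(pinj _ _ kB lB) e|_]; first by rewrite e eqxx in lk.
  by rewrite oppr0 mul0r.
have yo i j : j \notin Bad -> (forall k, k \in Bad -> j != p k) -> y i j = o i j.
  move=> jB jp; rewrite /y big1 ?addr0 // => k kB; rewrite (negPf (jp k kB)) subr0.
  by case: eqP jB => [->|_ _]; rewrite ?kB // mul0r.
have tri j : [\/ j \in Bad, exists2 k, k \in Bad & j = p k |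
     j \notin Bad /\ forall k, k \in Bad -> j != p k].
  case: (boolP (j \in Bad)) => jB; first by apply: Or31.
  case: (boolP [exists k in Bad, j == p k]) => [/existsP [k /andP[kB /eqP e]]|h].
    by apply: Or32; exists k.
  apply: Or33; split=> // k kB; apply: contra h => e; apply/existsP; exists k.
  by rewrite kB.
have used_psi i k : k \in Bad -> 0 < o i (p k) -> thr kap i (p k).
  move=> kB h; apply: contraT => nt; move: (pJ k kB); rewrite inE => /existsPn/(_ i).
  by rewrite h nt.
have kapL : (0 < kap <= L)%N by rewrite kap0 LE leq_pmulr.
have LL : (0 < L <= L)%N by rewrite L0 leqnn.
exists y; split.
- split=> [i j|i|j].
  + case: (tri j) => [jB|[k kB ->]|[jB jp]].
    * by rewrite yBad // mulr_ge0.
    * by rewrite yp // addr_ge0 // mulr_ge0 // subr_ge0 rho1.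
    * by rewrite yo.
  + rewrite /y big_split /= oA exchange_big /= [X in _ + X]big1 ?addr0 // => k _.
    by rewrite -mulr_suml sumrB !one subrr mul0r.
  + rewrite /y big_split /= oB exchange_big /= [X in _ + X]big1 ?addr0 // => k kB.
    by rewrite -mulr_sumr sumrB -mulr_sumr !oB /rho divfK ?subrr ?mulr0 // gt_eqF.
- move=> i j; case: (tri j) => [jB|[k kB ->]|[jB jp]].
  + rewrite yBad // => h; have op : 0 < o i (p j).
      by rewrite lt_neqAle o0 andbT eq_sym; apply: contraTneq h => ->; rewrite mulr0 ltxx.
    by rewrite (same_thr i (ps j jB) kapL) used_psi.
  + rewrite yp // => h nt.
    have z : o i (p k) = 0.
      apply: le_anti; rewrite o0 andbT leNgt; apply: contra nt; exact: used_psi.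
    move: h; rewrite z mulr0 addr0 => /used_thr h.
    rewrite -(same_thr i (ps k kB) LL) h andbT.
    by move: (pC k kB); rewrite inE => /and4P[].
  + rewrite yo // => h nt; rewrite used_thr // andbT; apply: contraT => nc.
    by move: jB; rewrite inE nc andbT inE => /existsPn/(_ i); rewrite h nt.
- set eta := V / L%:R.
  have eta0 : 0 <= eta by rewrite divr_ge0.
  pose cy j := \sum_i (if 0 < y i j then f i j else 0).
  have cyE : fcost f y = \sum_j cy j by rewrite /fcost exchange_big.
  have trans j k : same k j -> \sum_i (if 0 < o i k then f i j else 0) <= c1 k + n%:R * eta.
    move=> sjk; rewrite /c1 mulr_natl -[X in _ *+ X]card_ord -sumr_const -big_split /=.
    apply: ler_sum => i _; case: ifP => [/used_thr h|_]; last by rewrite add0r.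
    exact: same_close.
  have cyle j : cy j <= c1 j + \sum_(k in Bad) ((j == k)%:R * (c1 (p k) + n%:R * eta - c1 k)
       + (j == p k)%:R * (c1 k + n%:R * eta)).
    have ne0 : 0 <= n%:R * eta by rewrite mulr_ge0.
    case: (tri j) => [jB|[k kB ->]|[jB jp]].
    + rewrite (bigD1 j) //= eqxx [j == p j]eq_sym pBad // big1 ?addr0; last first.
        by move=> k /andP[kB kj]; rewrite [j == p k]eq_sym pBad // eq_sym (negPf kj) !mul0r addr0.
      rewrite mul1r mul0r addr0 addrC subrK.
      have sj : same (p j) j by rewrite same_sym ps.
      apply: le_trans (trans _ _ sj); apply: ler_sum => i _; rewrite yBad //.
      case: (ltP 0 (o i (p j))) => h; first by case: ifP.
      by rewrite (le_anti (introT andP (conj h (o0 _ _)))) mulr0 ltxx.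
    + rewrite (bigD1 k) //= eqxx pBad // big1 ?addr0; last first.
        move=> l /andP[lB lk]; rewrite pBad // mul0r add0r.
        case: eqP => [/(pinj _ _ kB lB) e|_]; first by rewrite e eqxx in lk.
        by rewrite mul0r.
      rewrite mul0r add0r mul1r; have := trans _ _ (ps k kB).
      move=> h; apply: le_trans (lerD (lexx _) h); rewrite /c1 -big_split /=.
      apply: ler_sum => i _; rewrite yp //.
      case: (ltP 0 (o i (p k))) => h1.
        apply: (@le_trans _ _ (f i (p k))); first by case: ifP.
        by rewrite lerDl; case: ifP.
      by rewrite (le_anti (introT andP (conj h1 (o0 _ _)))) mulr0 addr0 add0r.
    + rewrite big1 ?addr0; last first.
        move=> k kB; rewrite (negPf (jp k kB)) mul0r addr0.
        by case: eqP jB => [->|_ _]; rewrite ?kB // mul0r.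
      by apply: ler_sum => i _; rewrite yo.
  rewrite cyE; apply: le_trans (ler_sum _ (fun j _ => cyle j)) _.
  rewrite big_split /= -costE exchange_big /= -addrA lerD2l.
  under eq_bigr do rewrite big_split /= -!mulr_suml !one !mul1r.
  have -> : \sum_(k in Bad) (c1 (p k) + n%:R * eta - c1 k + (c1 k + n%:R * eta)) =
     \sum_(k in Bad) c1 (p k) + #|Bad|%:R * (2 * n%:R * eta).
    by rewrite [#|_|%:R * _]mulr_natl -sumr_const -big_split /=; apply: eq_bigr => k _; ring.
  apply: lerD.
    by rewrite ler_pdivlMr ?ltr0n // mulrC.
  rewrite !natrM -!mulrA [2 * _]mulrCA [leRHS]mulrCA.
  have : (#|Bad|%:R : R) <= Kx%:R.
    rewrite ler_nat; apply: leq_trans cardJ; apply: subset_leq_card.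
    by apply/subsetP => k; rewrite inE => /andP[].
  have : 0 <= n%:R * eta by rewrite mulr_ge0.
  nra.
Qed.

End Swap.
End Guess.

(** * Existence of an optimal solution *)

Section Optimum.
Variables (R : realType) (n m : nat) (I : pfct R n m).

Lemma feasible_exists : exists x, feasible I x.
Proof.
pose S : R := (\sum_i supply I i)%:R.
exists (\matrix_(i, j) ((supply I i)%:R * (demand I j)%:R / S)); split.
- by move=> i j; rewrite mxE divr_ge0 ?mulr_ge0.
- move=> i; under eq_bigr do rewrite mxE; rewrite -mulr_suml -mulr_sumr -natr_sum.
  rewrite -supply_demand mulfK // pnatr_eq0 -lt0n (bigD1 i) //=.
  by rewrite addn_gt0 supply_gt0.
- move=> j; under eq_bigr do rewrite mxE -mulrA; rewrite -mulr_suml -natr_sum mulrCA.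
  rewrite mulfV ?mulr1 // pnatr_eq0 -lt0n supply_demand (bigD1 j) //=.
  by rewrite addn_gt0 demand_gt0.
Qed.

(** The cost depends on the support alone, and there are finitely many supports. *)
Lemma optimal_exists : exists x, optimal I x.
Proof.
pose supp (x : 'M[R]_(n, m)) := [set a : 'I_n * 'I_m | 0 < x a.1 a.2].
pose P E := `[< exists x, feasible I x /\ supp x = E >].
pose c (E : {set 'I_n * 'I_m}) := \sum_(a in E) fixed_cost I a.1 a.2.
have costE x : cost I x = c (supp x).
  by rewrite /cost /c pair_big [RHS]big_mkcond /=; apply: eq_bigr => a _; rewrite inE.
have [x0 fx0] := feasible_exists.
have P0 : P (supp x0) by apply/asboolP; exists x0.
case: (arg_minP c P0) => E /asboolP [x [fx sx]] minE.
exists x; split=> // y fy; rewrite !costE sx; apply: minE.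
by apply/asboolP; exists y.
Qed.

End Optimum.

(** * The greedy flow *)

Section Greedy.
Variables (R : realFieldType) (n m : nat).
Variables (A : 'I_n -> R) (B : 'I_m -> R) (al : 'I_n -> 'I_m -> bool).
Implicit Types (x : 'I_n -> 'I_m -> R) (ra : 'I_n -> R) (S : {set 'I_n}).

(** Edges are treated sink by sink, and [(i, j)] is the next one. The indices are natural numbers so
    that they may reach [n] and [m] at the end of a loop. *)
Definition done (j i : nat) (r : 'I_n) (k : 'I_m) : bool :=
  (k < j)%N || (k == j :> nat) && (r < i)%N.

Definition rest j i r k : bool := al r k && ~~ done j i r k.

Definition left_over x j i k : R := B k - \sum_(r | done j i r k) x r k.

(** This is [slack] for the remaining edges: earlier sinks are exhausted and later ones still have
    their full demand, so the program stores the residual demand of the current sink only. *)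
Definition cut ra (j : 'I_m) S : R :=
  \sum_(r in S) ra r - \sum_(k : 'I_m | (j < k)%N && (nbr al k \subset S)) B k.

Record greedy (j i : nat) x ra : Prop := Greedy {
  greedy_x : forall r k, done j i r k -> 0 <= x r k /\ (0 < x r k -> al r k);
  greedy_A : forall r, ra r = A r - \sum_(k | done j i r k) x r k;
  greedy_B : forall k, 0 <= left_over x j i k;
  greedy_B0 : forall k : 'I_m, (k < j)%N -> left_over x j i k = 0;
  greedy_hall : hall (rest j i) ra (left_over x j i)
}.

Lemma hall_eq (E E' : 'I_n -> 'I_m -> bool) ra ra' (rb rb' : 'I_m -> R) :
  (forall r k, E' r k = E r k) -> (forall r, ra' r = ra r) -> (forall k, rb' k = rb k) ->
  hall E ra rb -> hall E' ra' rb'.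
Proof.
move=> eE eA eB H S; rewrite (eq_bigr _ (fun r _ => eA r)) (eq_bigr _ (fun k _ => eB k)).
rewrite (eq_bigl (fun k => nbr E k \subset S)) // => k.
by rewrite (_ : nbr E' k = nbr E k) //; apply/setP => r; rewrite !inE eE.
Qed.

Lemma greedy_start y x : (forall j, 0 <= B j) -> flow A B y -> supported al y -> greedy 0 0 x A.
Proof.
move=> B0 fy sy.
have d0 r k : done 0 0 r k = false by rewrite /done !ltn0 andbF.
have lB k : left_over x 0 0 k = B k by rewrite /left_over big_pred0 ?subr0 // => r; apply: d0.
split=> [r k|r|k|k|] //.
- by rewrite d0.
- by rewrite big_pred0 ?subr0 // => k; apply: d0.
- by rewrite lB.
- apply: hall_eq (hall_flow fy sy) => // r k.
  by rewrite /rest d0 andbT.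
Qed.

Lemma greedy_send (i : 'I_n) (j : 'I_m) x x' ra ra' t u :
  greedy j i x ra ->
  u <= left_over x j i j ->
  (forall S, i \in S -> ~~ ([set r : 'I_n | (i < r)%N && al r j] \subset S) -> u <= cut ra j S) ->
  (u = left_over x j i j \/ exists S, [/\ i \in S,
     ~~ ([set r : 'I_n | (i < r)%N && al r j] \subset S) & u = cut ra j S]) ->
  t = (if al i j then u else 0) ->
  (forall r k, x' r k = if (r == i) && (k == j) then t else x r k) ->
  (forall r, ra' r = ra r - (if r == i then t else 0)) ->
  greedy j i.+1 x' ra' /\ left_over x' j i.+1 j = left_over x j i j - t.
Proof.
move=> [gx gA gB gB0 gH] u1 u2 u3 tE x'E ra'E.
have doneS r k : done j i.+1 r k = done j i r k || (r == i) && (k == j).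
  rewrite /done ltnS [(r <= i)%N]leq_eqVlt -[r == i]val_eqE -[k == j]val_eqE /=.
  by case: (k < j)%N; case: (nat_of_ord k == j); case: (nat_of_ord r == i); case: (r < i)%N.
have doneN r k : done j i r k -> (r == i) && (k == j) = false.
  apply: contraTF => /andP[/eqP -> /eqP ->].
  by rewrite /done !ltnn andbF.
have sumk r : \sum_(k | done j i.+1 r k) x' r k =
    \sum_(k | done j i r k) x r k + (if r == i then t else 0).
  rewrite (bigID (fun k => done j i r k)) /=; congr (_ + _).
    apply: eq_big => [k|k /andP[_ d]]; last by rewrite x'E (doneN _ _ d).
    by rewrite doneS; case: (done j i r k); rewrite ?andbF.
  rewrite (eq_bigl (fun k => (r == i) && (k == j))); last first.
    move=> k; rewrite doneS; case: (boolP (done j i r k)) => [/doneN ->|_] //=.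
    by rewrite andbT.
  case: eqP => [e|_] /=; last by rewrite big_pred0.
  by rewrite big_pred1_eq x'E e !eqxx.
have sumr k : \sum_(r | done j i.+1 r k) x' r k =
    \sum_(r | done j i r k) x r k + (if k == j then t else 0).
  rewrite (bigID (fun r => done j i r k)) /=; congr (_ + _).
    apply: eq_big => [r|r /andP[_ d]]; last by rewrite x'E (doneN _ _ d).
    by rewrite doneS; case: (done j i r k); rewrite ?andbF.
  rewrite (eq_bigl (fun r => (r == i) && (k == j))); last first.
    move=> r; rewrite doneS; case: (boolP (done j i r k)) => [/doneN ->|_] //=.
    by rewrite andbT.
  case: (k =P j) => [e|_] /=; last by rewrite big_pred0 // => r; rewrite andbF.
  by rewrite (eq_bigl (pred1 i)) ?big_pred1_eq ?x'E ?e ?eqxx // => r; rewrite andbT.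
have lE k : left_over x' j i.+1 k = left_over x j i k - (if k == j then t else 0).
  by rewrite /left_over sumr opprD addrA.
have cutE S : cut ra j S = slack (rest j i) ra (left_over x j i) j S.
  rewrite /cut /slack; congr (_ - _).
  rewrite [RHS](bigID (fun k : 'I_m => (j < k)%N)) /= [X in _ + X]big1 ?addr0; last first.
    move=> k /andP[/andP[kj _] jk]; apply: gB0.
    by rewrite ltn_neqAle leqNgt jk andbT val_eqE kj.
  have dk r (k : 'I_m) : (j < k)%N -> done j i r k = false.
    by move=> jk; rewrite /done ltnNge (ltnW jk) (gtn_eqF jk).
  apply: eq_big => [k|k /andP[jk _]]; last first.
    by rewrite /left_over big_pred0 ?subr0 // => r; apply: dk.
  case: (ltnP j k) => jk; rewrite ?andbF ?andbT //=.
  have -> : k != j by rewrite -val_eqE /= gtn_eqF.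
  rewrite (_ : nbr (rest j i) k = nbr al k) //; apply/setP => r.
  by rewrite !inE /rest dk // andbT.
have nbrE : nbr (rest j i.+1) j = [set r : 'I_n | (i < r)%N && al r j].
  by apply/setP => r; rewrite !inE /rest /done ltnn eqxx /= ltnS -ltnNge andbC.
have [t0 H'] : 0 <= t /\ hall (rest j i.+1) ra' (left_over x' j i.+1).
  (* On a forbidden edge nothing is sent, and neither the remaining edges nor the residual amounts
     change. *)
  case: (boolP (al i j)) tE => alij tE; last first.
    rewrite tE; split=> //; apply: hall_eq gH => [r k|r|k].
    - rewrite /rest doneS; case: (boolP (al r k)) => //= alrk.
      case: (boolP ((r == i) && (k == j))); last by rewrite orbF.
      by case/andP => /eqP e1 /eqP e2; rewrite -e1 -e2 alrk in alij.
    - by rewrite ra'E tE if_same subr0.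
    - by rewrite lE tE if_same subr0.
  apply: (@hall_step _ _ _ (rest j i) (rest j i.+1) ra ra' (left_over x j i) (left_over x' j i.+1) i j t) => //.
  - by rewrite /rest alij /done !ltnn andbF.
  - by move=> r k; rewrite /rest doneS negb_or andbA xpair_eqE.
  - by rewrite tE.
  - by move=> S iS; rewrite nbrE -cutE tE; apply: u2.
  - case: u3 => [eu|[S [iS nS uS]]]; [by left; rewrite tE|right; exists S].
    by rewrite nbrE -cutE tE.
have tl : t <= left_over x j i j by rewrite tE; case: ifP.
split; last by rewrite lE eqxx.
split=> //.
- move=> r k; rewrite doneS x'E => /orP[d|d]; first by rewrite (doneN _ _ d); apply: gx.
  by rewrite d; split=> //; case/andP: d => /eqP -> /eqP ->; rewrite tE; case: ifP => //; rewrite ltxx.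
- by move=> r; rewrite ra'E gA sumk opprD addrA.
- move=> k; rewrite lE; case: eqP => [->|_]; last by rewrite subr0.
  by rewrite subr_ge0.
- move=> k kj; rewrite lE gB0 //; case: eqP kj => [->|_ _]; first by rewrite ltnn.
  by rewrite subr0.
Qed.

Lemma greedy_next (j : 'I_m) x ra : greedy j n x ra -> greedy j.+1 0 x ra.
Proof.
move=> [gx gA gB gB0 gH].
have dE r k : done j.+1 0 r k = done j n r k.
  by rewrite /done ltn_ord andbT ltn0 andbF orbF ltnS leq_eqVlt orbC.
have lE k : left_over x j.+1 0 k = left_over x j n k.
  by rewrite /left_over; congr (_ - _); apply: eq_bigl => r; apply: dE.
(* No remaining edge enters sink [j], so the cut condition of the empty set leaves it no demand. *)
have lj : left_over x j n j = 0.
  apply: le_anti; rewrite gB andbT; have := gH set0; rewrite big_set0; apply: le_trans.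
  rewrite (bigD1 j) /=; first by rewrite lerDl sumr_ge0.
  apply/subsetP => r; rewrite inE /rest /done ltnn eqxx ltn_ord /=.
  by rewrite andbF.
split=> [r k|r|k|k|].
- by rewrite dE; apply: gx.
- by rewrite gA; congr (_ - _); apply: eq_bigl => k; rewrite dE.
- by rewrite lE.
- rewrite ltnS leq_eqVlt lE => /orP[/eqP e|]; last exact: gB0.
  by rewrite (_ : k = j) //; apply: val_inj.
- by apply: hall_eq gH => // r k; rewrite /rest dE.
Qed.

(** All demands are met. The residual supplies are nonnegative by the cut condition and add up to
    zero, so they vanish. *)
Lemma greedy_end x ra : greedy m 0 x ra -> \sum_i A i = \sum_j B j ->
  flow A B x /\ supported al x.
Proof.
move=> [gx gA gB gB0 gH] AB.
have dE r k : done m 0 r k by rewrite /done ltn_ord.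
have cB k : \sum_r x r k = B k.
  apply/esym/eqP; rewrite -subr_eq0; apply/eqP.
  have := gB0 k (ltn_ord k); rewrite /left_over.
  by rewrite (eq_bigl xpredT) // => r; apply: dE.
have raE r : ra r = A r - \sum_k x r k.
  by rewrite gA (eq_bigl xpredT) // => k; apply: dE.
have ra0 r : 0 <= ra r by apply: hall_ge0 gH.
have : \sum_r ra r = 0.
  under eq_bigr do rewrite raE; rewrite sumrB exchange_big /= (eq_bigr _ (fun k _ => cB k)).
  by rewrite AB subrr.
move/eqP; rewrite psumr_eq0 // => /allP raz.
split; last by move=> r k; case: (gx r k (dE r k)).
split=> // [r k|r]; first by case: (gx r k (dE r k)).
have := raz r; rewrite mem_index_enum => /(_ isT)/eqP; rewrite raE => /eqP.
by rewrite subr_eq0 => /eqP.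
Qed.

End Greedy.

(** * The program *)

(* Arrays of naturals, with scalars at index 0: the dimensions, the parameter
   [u = n + K + 2] and its powers, [E = 2 ^ (u ^ 7)], [G = 2 ^ E], the powers of 2
   below [G], a scratch cell, the table of the [E] bits of each code [c < G], and
   a flag telling whether [rBest] holds a solution. *)
Notation an := 0%N (only parsing).
Notation am := 1%N (only parsing).
Notation aU := 2%N (only parsing).
Notation aKap := 3%N (only parsing).
Notation aKx := 4%N (only parsing).
Notation aM := 5%N (only parsing).
Notation aL := 6%N (only parsing).
Notation aF := 7%N (only parsing).
Notation aE := 8%N (only parsing).
Notation aG := 9%N (only parsing).
Notation aPow := 10%N (only parsing).
Notation aRest := 11%N (only parsing).
Notation aBit := 12%N (only parsing).
Notation aFound := 14%N (only parsing).
(* Arrays of reals: the instance, the guess [V], the current flow with two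
   scratch copies, the best solution, the linear costs, the residual supplies,
   the residual demand, the amount to send, and the allowed edges. *)
Notation rIn := 0%N (only parsing).
Notation rV := 1%N (only parsing).
Notation rX := 2%N (only parsing).
Notation rY := 3%N (only parsing).
Notation rZ := 4%N (only parsing).
Notation rBest := 5%N (only parsing).
Notation rC := 6%N (only parsing).
Notation rA := 7%N (only parsing).
Notation rB := 8%N (only parsing).
Notation rT := 9%N (only parsing).
Notation rAl := 10%N (only parsing).

Notation N1 := (Cst 1) (only parsing).
Notation N0 := (Cst 0) (only parsing).
Notation R0 := (OfN (Cst 0)) (only parsing).

Definition Ns a := NArr a (Cst 0).
Definition Rs a := RArr a (Cst 0).
Definition Or a b := Neg (Conj (Neg a) (Neg b)).
Definition LtN a b := LeN (AddN a N1) b.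
Definition LtR a b := Neg (LeR b a).
Definition Iff a b := Ite a b (Neg b).
(** The product with the number of sinks is a sum over a loop variable reserved for it; this is why
    the evaluation lemmas ask [x] to differ from 10. In [bitE] the same is done with 21. *)
Definition ix x y := AddN (SumN 10 am (Var x)) (Var y).
Definition entryE a x y := RArr a (ix x y).
Definition fE x y := RArr rIn (AddN (AddN (Ns an) (Ns am)) (ix x y)).
Definition supE x := RArr rIn (Var x).
Definition demE x := RArr rIn (AddN (Ns an) (Var x)).
Definition alE x y := LtR R0 (entryE rAl x y).
Definition bitE c k := LeN N1 (NArr aBit (AddN (SumN 21 aE (Var c)) k)).
Definition thrE l x y := LeR (MulR (OfN (Ns aL)) (fE x y)) (MulR (OfN l) (Rs rV)).
Definition sameE x y :=
  All 22 an (All 9 aL (Iff (thrE (AddN (Var 9) N1) 22 x) (thrE (AddN (Var 9) N1) 22 y))).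
Definition beforeE x y :=
  Or (LtR (demE y) (demE x)) (Conj (LeR (demE y) (demE x)) (LtN (Var x) (Var y))).
(* A sink is a candidate when fewer than [M] larger sinks have its cost type. *)
Definition candE x :=
  LtN (SumN 4 am (Ite (Conj (sameE x 4) (beforeE 4 x)) N1 N0)) (Ns aM).
(* Expensive edges are numbered by [(rank of the sink among candidates) * n + source];
   the guess, whose code is in loop variable 15, selects some of them. *)
Definition posE := AddN (SumN 20 an (SumN 5 am (Ite (Conj (candE 5) (LtN (Var 5) (Var 3))) N1 N0)))
  (Var 0).
Definition allowE := Or (thrE (Ns aKap) 0 3)
  (Conj (Conj (candE 3) (thrE (Ns aL) 0 3)) (bitE 15 posE)).

Definition pAllow := PFor 0 an (PFor 3 am (PR rAl (ix 0 3) (Ite allowE (OfN N1) R0))).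
Definition pPrice := PFor 0 an (PFor 3 am (PR rC (ix 0 3)
  (Ite (thrE (Ns aKap) 0 3) (DivR (fE 0 3) (demE 3)) R0))).

(* Among the codes 8 of sets of sources that contain source 0 and miss a later
   neighbour of sink 3, the cut with the least slack bounds the amount sent. *)
Definition guardE := Conj (bitE 8 (Var 0))
  (Neg (All 1 an (Or (Neg (Conj (LtN (Var 0) (Var 1)) (alE 1 3))) (bitE 8 (Var 1))))).
Definition slackE := SubR (SumR 1 an (Ite (bitE 8 (Var 1)) (RArr rA (Var 1)) R0))
  (SumR 5 am (Ite (Conj (LtN (Var 3) (Var 5)) (All 1 an (Or (Neg (alE 1 5)) (bitE 8 (Var 1)))))
                  (demE 5) R0)).
Definition pCut := PSeq (PR rT N0 (Rs rB))
  (PFor 8 aG (PIf (Conj guardE (LtR slackE (Rs rT))) (PR rT N0 slackE) PNop)).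
Definition pSend := PSeq (PR rT N0 (Ite (alE 0 3) (Rs rT) R0))
  (PSeq (PR rX (ix 0 3) (Rs rT))
  (PSeq (PR rA (Var 0) (SubR (RArr rA (Var 0)) (Rs rT)))
        (PR rB N0 (SubR (Rs rB) (Rs rT))))).
Definition pGreedy := PSeq (PFor 0 an (PR rA (Var 0) (supE 0)))
  (PFor 3 am (PSeq (PR rB N0 (demE 3)) (PFor 0 an (PSeq pCut pSend)))).

(* A cycle move is given by an edge (6, 7), whose flow is the amount rerouted, and
   by the code 8 of a set of arcs (0, 1) between sources; each arc uses the sink
   5 where it is cheapest, the least one in case of a tie. *)
Definition usableE k := Conj (LeR (entryE rX 6 7) (entryE rX 0 k)) (alE 1 k).
Definition valE k := SubR (entryE rC 1 k) (entryE rC 0 k).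
Definition beatsE j k := Or (LtR (valE j) (valE k))
  (Conj (LeR (valE j) (valE k)) (LtN (Var j) (Var k))).
Definition bestE := Conj (usableE 5) (All 4 am (Neg (Conj (usableE 4) (beatsE 4 5)))).
Definition eqE x y := OfN (Ite (Conj (LeN (Var x) (Var y)) (LeN (Var y) (Var x))) N1 N0).
Definition moveE := AddR (entryE rX 2 5) (MulR (entryE rX 6 7) (SumR 0 an (SumR 1 an
  (Ite (Conj (bitE 8 (AddN (SumN 20 an (Var 0)) (Var 1))) bestE)
       (SubR (eqE 1 2) (eqE 0 2)) R0)))).
Definition EqR a b := Conj (LeR a b) (LeR b a).
(** A set of arcs given by an arbitrary code need not consist of cycles, and a wrong guess may admit
    no flow at all, so no flow is recorded without this test. *)
Definition validE a := Conj
  (All 2 an (All 5 am (Conj (LeR R0 (entryE a 2 5)) (Or (LeR (entryE a 2 5) R0) (alE 2 5)))))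
  (Conj (All 2 an (EqR (SumR 5 am (entryE a 2 5)) (supE 2)))
        (All 5 am (EqR (SumR 2 an (entryE a 2 5)) (demE 5)))).
Definition linE a := SumR 2 an (SumR 5 am (MulR (entryE rC 2 5) (entryE a 2 5))).
Definition costE a := SumR 2 an (SumR 5 am (Ite (LtR R0 (entryE a 2 5)) (fE 2 5) R0)).
Definition pFill a e := PFor 2 an (PFor 5 am (PR a (ix 2 5) e)).
Definition pCopy a b := pFill a (entryE b 2 5).
Definition pTry := PSeq (pFill rY moveE)
  (PIf (Conj (validE rY) (LtR (linE rY) (linE rZ))) (pCopy rZ rY) PNop).
Definition pRound := PSeq (pCopy rZ rX)
  (PSeq (PFor 6 an (PFor 7 am (PFor 8 aG pTry))) (pCopy rX rZ)).
(** With [N = n * n * m], the gap after [k] rounds is at most [N / (N + k)] times the initial one,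
    which is at most [m] times the price of a cheap edge. After [m * m] rounds at most [n * n] such
    prices are left. *)
Definition pSearch := PFor 18 am (PFor 19 am pRound).

Definition fullE := Conj (Conj (LtR R0 (entryE rX 0 3)) (LtR R0 (entryE rX 1 4)))
  (Conj (LtR R0 (entryE rX 1 3)) (LtR R0 (entryE rX 0 4))).
Definition turnE := SubR (SubR (AddR (entryE rC 0 3) (entryE rC 1 4)) (entryE rC 1 3)) (entryE rC 0 4).
Definition pShift := PSeq
  (PR rT N0 (Ite (LeR (entryE rX 0 3) (entryE rX 1 4)) (entryE rX 0 3) (entryE rX 1 4)))
  (PSeq (PR rX (ix 0 3) (SubR (entryE rX 0 3) (Rs rT)))
  (PSeq (PR rX (ix 1 4) (SubR (entryE rX 1 4) (Rs rT)))
  (PSeq (PR rX (ix 1 3) (AddR (entryE rX 1 3) (Rs rT)))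
        (PR rX (ix 0 4) (AddR (entryE rX 0 4) (Rs rT)))))).
Definition pTurn := PIf (Conj fullE (LeR R0 turnE)) pShift PNop.
(** The loops meet every rectangle in both orientations, one of which has nonnegative cost. *)
Definition pCancel := PFor 3 am (PFor 4 am (PFor 0 an (PFor 1 an pTurn))).

Definition pUpdate :=
  PIf (Conj (validE rX) (Or (LeN (Ns aFound) N0) (LtR (costE rX) (costE rBest))))
      (PSeq (pCopy rBest rX) (PN aFound N0 N1)) PNop.
Definition pGuess := PSeq pAllow (PSeq pPrice (PSeq pGreedy (PSeq pSearch (PSeq pCancel pUpdate)))).
Definition pScale := PSeq (PR rV N0 (MulR (OfN (AddN (ix 13 14) N1)) (fE 11 12))) (PFor 15 aG pGuess).
Definition pMain := PSeq (PN aFound N0 N0)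
  (PFor 11 an (PFor 12 am (PFor 13 an (PFor 14 am pScale)))).

(* Binary expansions by subtraction of the powers of 2, in decreasing order. *)
Definition pTable := PFor 8 aG (PSeq (PN aRest N0 (Var 8)) (PFor 9 aE
  (let k := SubN (SubN (Ns aE) N1) (Var 9) in
   let at_ := AddN (SumN 21 aE (Var 8)) k in
   PIf (LeN (NArr aPow k) (Ns aRest))
       (PSeq (PN aBit at_ N1) (PN aRest N0 (SubN (Ns aRest) (NArr aPow k))))
       (PN aBit at_ N0)))).

Definition pBody := PSeq pTable pMain.

Lemma wf_body : wfP [::] pBody. Proof. by vm_compute. Qed.

Lemma bnd_body : {subset bndP pBody <= [:: an; am; aL; aE; aG]}.
Proof. by apply/allP; vm_compute. Qed.

Lemma out_body : all (fun h => h \notin outn pBody) [:: an; am; aL; aE; aG].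
Proof. by vm_compute. Qed.

(** * Proof rules for programs *)

Section Rules.
Variable R : realType.
Implicit Types (st : store R) (ev : nat -> nat).

Lemma den_for v h p ev st (I : nat -> store R -> Prop) N : sn st h 0 = N -> I 0%N st ->
  (forall k st', (k < N)%N -> I k st' -> I k.+1 (den p (setv ev v k) st')) ->
  I N (den (PFor v h p) ev st).
Proof.
move=> hN I0 step; rewrite /= hN.
have H k : (k <= N)%N -> I k (foldl (fun st k => den p (setv ev v k) st) st (iota 0 k)).
  elim: k => // k IH kN; rewrite -addn1 iotaD foldl_cat /= addn1.
  by apply: step => //; apply: IH; apply: ltnW.
exact: H.
Qed.

(** The rule for exhaustive enumeration: round [k0], where the right object is tried, establishes
    [Q], and no round destroys it. *)
Lemma den_for_reach v h p ev st (P Q : store R -> Prop) N k0 : sn st h 0 = N -> P st ->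
  (forall k s, (k < N)%N -> P s -> P (den p (setv ev v k) s)) -> (k0 < N)%N ->
  (forall s, P s -> Q (den p (setv ev v k0) s)) ->
  (forall k s, (k < N)%N -> P s -> Q s -> Q (den p (setv ev v k) s)) ->
  P (den (PFor v h p) ev st) /\ Q (den (PFor v h p) ev st).
Proof.
move=> hN P0 Ps k0N Q0 Qs.
have [pf qf] : P (den (PFor v h p) ev st) /\ ((k0 < N)%N -> Q (den (PFor v h p) ev st)).
  apply: (den_for (I := fun k s => P s /\ ((k0 < k)%N -> Q s))) => // k s kN [ps qs].
  split; first exact: Ps.
  rewrite ltnS leq_eqVlt => /orP[/eqP <-|lt]; first exact: Q0.
  by apply: Qs => //; apply: qs.
by split=> //; apply: qf.
Qed.

Lemma den_for_inv v h p ev st (P : store R -> Prop) : P st ->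
  (forall k s, (k < sn st h 0)%N -> P s -> P (den p (setv ev v k) s)) ->
  P (den (PFor v h p) ev st).
Proof. by move=> P0 Ps; apply: (den_for (I := fun _ s => P s)). Qed.

Lemma den_seq p q ev st : den (PSeq p q) ev st = den q ev (den p ev st).
Proof. by []. Qed.

Lemma den_R a i e ev st : den (PR a i e) ev st = wrr st a (eval i ev st) (eval e ev st).
Proof. by []. Qed.

Lemma den_N a i e ev st : den (PN a i e) ev st = wrn st a (eval i ev st) (eval e ev st).
Proof. by []. Qed.

Lemma den_if e p q ev st :
  den (PIf e p q) ev st = if eval e ev st then den p ev st else den q ev st.
Proof. by []. Qed.

Lemma wrr_at st a k v l : sr (wrr st a k v) a l = if l == k then v else sr st a l.
Proof. by rewrite /wrr /= setv_same setvE. Qed.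

Lemma wrr_ne st a k v b : b != a -> sr (wrr st a k v) b = sr st b.
Proof. by move=> /negPf ne; rewrite /wrr /= setvE ne. Qed.

Lemma wrn_at st a k v l : sn (wrn st a k v) a l = if l == k then v else sn st a l.
Proof. by rewrite /wrn /= setv_same setvE. Qed.

Lemma wrn_ne st a k v b : b != a -> sn (wrn st a k v) b = sn st b.
Proof. by move=> /negPf ne; rewrite /wrn /= setvE ne. Qed.

Lemma wrn_sr st a k v : sr (wrn st a k v) = sr st.
Proof. by []. Qed.

End Rules.

(** * Correctness of the program *)

Section Spec.
Local Opaque wrn wrr.
Variables (R : realType) (n m : nat) (I : pfct R n m) (kap M L E G : nat).
Implicit Types (st : store R) (ev : nat -> nat).

Let a i : R := (supply I i)%:R.
Let b j : R := (demand I j)%:R.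
Let f := fixed_cost I.

Definition bit st c k := (0 < sn st aBit (c * E + k))%N.

(** The data that no phase changes. Of the table of bits only one property is kept, namely that
    every pattern of [E] bits has a code. *)
Record base st : Prop := Base {
  base_n : sn st an 0%N = n;
  base_m : sn st am 0%N = m;
  base_kap : sn st aKap 0%N = kap;
  base_M : sn st aM 0%N = M;
  base_L : sn st aL 0%N = L;
  base_E : sn st aE 0%N = E;
  base_G : sn st aG 0%N = G;
  base_bit : forall q : nat -> bool, exists2 c, (c < G)%N &
    forall k, (k < E)%N -> bit st c k = q k;
  base_sup : forall i : 'I_n, sr st rIn i = a i;
  base_dem : forall j : 'I_m, sr st rIn (n + j)%N = b j;
  base_f : forall (i : 'I_n) (j : 'I_m), sr st rIn (n + m + (i * m + j))%N = f i j
}.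

Lemma base_same st st' :
  (forall h, h \in [:: an; am; aKap; aM; aL; aE; aG; aBit] -> sn st' h = sn st h) ->
  sr st' rIn = sr st rIn -> base st -> base st'.
Proof.
move=> N Q [*]; split; rewrite ?Q ?N //; rewrite /bit ?N //.
Qed.

Lemma base_den p ev st :
  all (fun h => h \notin outn p) [:: an; am; aKap; aM; aL; aE; aG; aBit] ->
  rIn \notin outr p -> base st -> base (den p ev st).
Proof.
move=> /allP N Q; apply: base_same => [h /N hN|]; [exact: den_sn|exact: den_sr].
Qed.

Definition mx st r (i : 'I_n) (j : 'I_m) : R := sr st r (i * m + j)%N.
Definition al st (i : 'I_n) (j : 'I_m) : bool := (0 < mx st rAl i j).

Lemma ix_inj (i i' : nat) (j j' : 'I_m) :
  ((i * m + j)%N == (i' * m + j')%N) = (i == i') && (j == j').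
Proof.
have m0 : (0 < m)%N by apply: leq_ltn_trans (ltn_ord j).
apply/eqP/andP => [e|[/eqP -> /eqP ->]] //.
have ei : i = i'.
  have := congr1 (divn^~ m) e; rewrite /= !divnMDl // !divn_small // !addn0 //.
by split; apply/eqP => //; apply: val_inj; move: e; rewrite ei => /addnI.
Qed.

Lemma forallE h v (e : expr TB) ev st k (P : pred 'I_k) : sn st h 0%N = k ->
  (forall i : 'I_k, eval e (setv ev v i) st = P i) -> eval (All v h e) ev st = [forall i, P i].
Proof. by move=> hk; subst k => H /=; apply: eq_forallb. Qed.

Lemma sumRE h v (e : expr TR) ev st k (F : 'I_k -> R) : sn st h 0%N = k ->
  (forall i : 'I_k, eval e (setv ev v i) st = F i) -> eval (SumR v h e) ev st = \sum_i F i.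
Proof. by move=> hk; subst k => H /=; apply: eq_bigr. Qed.

Lemma sumNE h v (e : expr TN) ev st k (F : 'I_k -> nat) : sn st h 0%N = k ->
  (forall i : 'I_k, eval e (setv ev v i) st = F i) ->
  eval (SumN v h e) ev st = (\sum_i F i)%N.
Proof. by move=> hk; subst k => H /=; apply: eq_bigr. Qed.

Lemma setv_ne T (g : nat -> T) k v l : l != k -> setv g k v l = g l.
Proof. by move=> /negPf ne; rewrite setvE ne. Qed.

Lemma eval_AddN e1 e2 ev st : eval (AddN e1 e2) ev st = (eval e1 ev st + eval e2 ev st)%N.
Proof. by []. Qed.

Lemma eval_Conj e1 e2 ev st : eval (Conj e1 e2) ev st = eval e1 ev st && eval e2 ev st.
Proof. by []. Qed.

Lemma eval_Neg e ev st : eval (Neg e) ev st = ~~ eval e ev st.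
Proof. by []. Qed.

Lemma eval_AddR e1 e2 ev st : eval (AddR e1 e2) ev st = eval e1 ev st + eval e2 ev st.
Proof. by []. Qed.

Lemma eval_SubR e1 e2 ev st : eval (SubR e1 e2) ev st = eval e1 ev st - eval e2 ev st.
Proof. by []. Qed.

Lemma eval_MulR e1 e2 ev st : eval (MulR e1 e2) ev st = eval e1 ev st * eval e2 ev st.
Proof. by []. Qed.

Lemma eval_LeR e1 e2 ev st : eval (LeR e1 e2) ev st = (eval e1 ev st <= eval e2 ev st).
Proof. by []. Qed.

Lemma eval_LeN e1 e2 ev st : eval (LeN e1 e2) ev st = (eval e1 ev st <= eval e2 ev st)%N.
Proof. by []. Qed.

Lemma eval_Cst k ev st : eval (Cst k) ev st = k.
Proof. by []. Qed.

Lemma eval_Ite t e (e1 e2 : expr t) ev st :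
  eval (Ite e e1 e2) ev st = if eval e ev st then eval e1 ev st else eval e2 ev st.
Proof. by []. Qed.

Section Eval.
Variables (ev : nat -> nat) (st : store R).
Hypothesis bs : base st.

Lemma eval_Ns h : eval (Ns h) ev st = sn st h 0%N. Proof. by []. Qed.
Lemma eval_Rs h : eval (Rs h) ev st = sr st h 0%N. Proof. by []. Qed.
Lemma eval_Or e e' : eval (Or e e') ev st = eval e ev st || eval e' ev st.
Proof. by rewrite /Or /= negb_and !negbK. Qed.
Lemma eval_LtN e e' : eval (LtN e e') ev st = (eval e ev st < eval e' ev st)%N.
Proof. by rewrite /LtN /= addn1. Qed.
Lemma eval_LtR e e' : eval (LtR e e') ev st = (eval e ev st < eval e' ev st).
Proof. by rewrite /LtR /= ltNge. Qed.
Lemma eval_EqR e e' : eval (EqR e e') ev st = (eval e ev st == eval e' ev st).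
Proof. by rewrite /EqR /= eq_le. Qed.
Lemma eval_Iff e e' : eval (Iff e e') ev st = (eval e ev st == eval e' ev st :> bool).
Proof. by rewrite /Iff /=; case: (eval e ev st : bool); case: (eval e' ev st : bool). Qed.

Local Opaque Ns Rs Or LtN LtR EqR Iff.

Lemma eval_ix x y : x != 10%N -> eval (ix x y) ev st = (ev x * m + ev y)%N.
Proof.
move=> x10; rewrite /ix -[LHS]/(eval (SumN 10 am (Var x)) ev st + ev y)%N.
rewrite (sumNE (F := fun=> ev x) (base_m bs)); last by move=> i; apply: setv_ne.
by rewrite sum_nat_const card_ord mulnC.
Qed.

Local Opaque ix.

Lemma eval_entryE r x y : x != 10%N -> eval (entryE r x y) ev st = sr st r (ev x * m + ev y)%N.
Proof. by move=> x10; rewrite /entryE /= eval_ix. Qed.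

Local Opaque entryE.

Lemma eval_alE x y : x != 10%N -> eval (alE x y) ev st = (0 < sr st rAl (ev x * m + ev y)%N).
Proof. by move=> x10; rewrite /alE eval_LtR eval_entryE. Qed.

Lemma eval_fE x y (i : 'I_n) (j : 'I_m) : x != 10%N -> ev x = i -> ev y = j ->
  eval (fE x y) ev st = f i j.
Proof.
by move=> x10 xi yj; rewrite /fE /= eval_ix // !eval_Ns (base_n bs) (base_m bs) xi yj (base_f bs).
Qed.

Lemma eval_supE x (i : 'I_n) : ev x = i -> eval (supE x) ev st = a i.
Proof. by move=> xi; rewrite /supE /= xi (base_sup bs). Qed.

Lemma eval_demE x (j : 'I_m) : ev x = j -> eval (demE x) ev st = b j.
Proof. by move=> xj; rewrite /demE /= eval_Ns (base_n bs) xj (base_dem bs). Qed.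

Lemma eval_bitE c k : c != 21%N -> eval (bitE c k) ev st = bit st (ev c) (eval k ev st).
Proof.
move=> c21; rewrite /bitE -[LHS]/(0 < sn st aBit (eval (SumN 21 aE (Var c)) ev st + eval k ev st))%N.
rewrite (sumNE (F := fun=> ev c) (base_E bs)); last by move=> i; apply: setv_ne.
by rewrite sum_nat_const card_ord mulnC.
Qed.

Local Opaque entryE alE fE supE demE bitE.

Lemma eval_thrE l x y (i : 'I_n) (j : 'I_m) : x != 10%N -> ev x = i -> ev y = j ->
  eval (thrE l x y) ev st = thr f (sr st rV 0%N) L (eval l ev st) i j.
Proof.
by move=> x10 xi yj; rewrite /thrE /= eval_Ns (base_L bs) eval_Rs (eval_fE x10 xi yj).
Qed.

Local Opaque thrE.

Lemma eval_beforeE x y (j k : 'I_m) : ev x = j -> ev y = k ->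
  eval (beforeE x y) ev st = before b j k.
Proof.
move=> xj yk; rewrite /beforeE eval_Or eval_LtR /= eval_LtN /=.
by rewrite (eval_demE xj) (eval_demE yk) xj yk.
Qed.

End Eval.

Local Opaque Ns Rs Or LtN LtR EqR Iff ix entryE alE fE supE demE bitE thrE beforeE.

Lemma eval_sameE ev st x y (j k : 'I_m) : base st -> (x != 22%N) -> (x != 9%N) ->
  (y != 22%N) -> (y != 9%N) -> ev x = j -> ev y = k ->
  eval (sameE x y) ev st = same f (sr st rV 0%N) L j k.
Proof.
move=> bs x22 x9 y22 y9 xj yk; rewrite /sameE.
apply: (forallE (base_n bs)) => i; apply: (forallE (base_L bs)) => l.
have e w : w != 22%N -> w != 9%N -> setv (setv ev 22 i) 9 l w = ev w.
  by move=> w22 w9; rewrite !setvE (negPf w22) (negPf w9).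
rewrite eval_Iff (@eval_thrE _ _ bs _ _ _ i j) //; last by rewrite e.
rewrite (@eval_thrE _ _ bs _ _ _ i k) //; last by rewrite e.
by rewrite /= addn1.
Qed.

Local Opaque sameE.

Lemma eval_candE ev st x (j : 'I_m) : base st -> (x != 22%N) -> (x != 9%N) -> (x != 4%N) ->
  ev x = j -> eval (candE x) ev st = cand b f (sr st rV 0%N) L M j.
Proof.
move=> bs x22 x9 x4 xj; rewrite /candE eval_LtN eval_Ns (base_M bs) /cand; congr (_ < _)%N.
rewrite (sumNE (F := fun k => (same f (sr st rV 0%N) L j k && before b k j) : nat) (base_m bs)).
  by rewrite /rank -sum1_card [RHS]big_mkcond; apply: eq_bigr => k _; rewrite inE; case: (_ && _).
move=> k; have e : setv ev 4 k x = j by rewrite setvE (negPf x4).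
by rewrite [eval _ _ _]/= (@eval_sameE _ _ x 4 j k bs) // (@eval_beforeE _ _ bs 4 x k j) //.
Qed.

Local Opaque candE.

Definition pos st (i : 'I_n) (j : 'I_m) : nat :=
  (n * (\sum_(k < m) (cand b f (sr st rV 0%N) L M k && (k < j)%N)) + i)%N.

Definition allowed st g (i : 'I_n) (j : 'I_m) : bool :=
  let V := sr st rV 0%N in
  thr f V L kap i j || (cand b f V L M j && thr f V L L i j) && bit st g (pos st i j).

Lemma eval_allowE ev st (i : 'I_n) (j : 'I_m) : base st -> ev 0%N = i -> ev 3%N = j ->
  eval allowE ev st = allowed st (ev 15%N) i j.
Proof.
move=> bs ei ej; rewrite /allowE eval_Or [eval (Conj _ _) _ _]/=.
rewrite !(@eval_thrE _ _ bs _ 0 3 i j) // (@eval_candE _ _ 3 j bs) // eval_bitE //.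
rewrite !eval_Ns (base_kap bs) (base_L bs) /allowed; congr (_ || _ && bit _ _ _).
rewrite /posE /pos eval_AddN [eval (Var 0) _ _]/= ei; congr (_ + _)%N.
rewrite (sumNE (F := fun=> \sum_(k < m) (cand b f (sr st rV 0%N) L M k && (k < j)) : nat)%N
  (base_n bs)); first by rewrite sum_nat_const card_ord.
move=> t; apply: (sumNE (base_m bs)) => k.
rewrite eval_Ite eval_Conj.
by rewrite (@eval_candE _ _ 5 k bs) // eval_LtN /= /setv /= ej; case: (_ && _).
Qed.

Local Opaque allowE.

Definition same_but r st st' := sn st' = sn st /\ forall r', r' != r -> sr st' r' = sr st r'.

Lemma base_but r st st' : r != rIn -> same_but r st st' -> base st -> base st'.
Proof. by move=> r0 [e1 e2]; apply: base_same => [h _|]; rewrite ?e1 // e2 // eq_sym. Qed.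

(** The array is overwritten while [e] is still being evaluated, so the value of [e] is required in
    every store that differs from the initial one in array [r] only. *)
Lemma fill_spec r v w (e : expr TR) ev st (F : 'I_n -> 'I_m -> R) : base st -> r != rIn ->
  v != w -> v != 10%N -> w != 10%N ->
  (forall (i : 'I_n) (j : 'I_m) st', same_but r st st' ->
     eval e (setv (setv ev v i) w j) st' = F i j) ->
  let st' := den (PFor v an (PFor w am (PR r (ix v w) e))) ev st in
  same_but r st st' /\ forall i j, mx st' r i j = F i j.
Proof.
move=> bs r0 vw v10 w10 H.
pose J k l (st' : store R) := same_but r st st' /\
  forall (i : 'I_n) (j : 'I_m), (i < k)%N || (i == k :> nat) && (j < l)%N -> mx st' r i j = F i j.
have : J n 0%N (den (PFor v an (PFor w am (PR r (ix v w) e))) ev st).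
  apply: (@den_for _ _ _ _ _ _ (fun k => J k 0%N)); first exact: base_n.
    by split=> // i j; rewrite ltn0 andbF orbF.
  move=> k st1 kn [s1 J1].
  have : J k m (den (PFor w am (PR r (ix v w) e)) (setv ev v k) st1).
    apply: (@den_for _ _ _ _ _ _ (fun l => J k l)); last 2 first.
    - by split.
    - move=> l st2 lm [s2 J2].
      have bs2 := base_but r0 s2 bs.
      pose ik := Ordinal kn; pose jl := Ordinal lm.
      rewrite -[den _ _ _]/(wrr st2 r (eval (ix v w) _ st2) (eval e _ st2)).
      rewrite (H ik jl _ s2) eval_ix // setv_same [setv (setv _ _ _) _ _ v]setv_ne // setv_same.
      split.
        by case: s2 => e1 e2; split=> // r' ne; rewrite wrr_ne // e2.
      move=> i j ij; rewrite /mx wrr_at (ix_inj i ik j jl).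
      case: eqP => [ei|ni] /=; last first.
        by apply: J2; case/orP: ij => [->//|/andP[/eqP ek _]]; case: ni.
      case: eqP => [ej|nj]; first by congr (F _ _); apply: val_inj; rewrite /= ?ei ?ej.
      apply: J2; rewrite ei ltnn eqxx /=; move: ij; rewrite ei ltnn eqxx /= ltnS leq_eqVlt.
      by case/orP => // /eqP el; case: nj; apply: val_inj.
    - by case: s1 => -> _; exact: base_m.
  move=> [s3 J3]; split=> // i j; rewrite ltn0 andbF orbF ltnS leq_eqVlt => /orP[/eqP ek|lt].
    by apply: J3; rewrite ek eqxx ltn_ord orbT.
  by apply: J3; rewrite lt.
by move=> [s J']; split=> // i j; apply: J'; rewrite ltn_ord.
Qed.

Lemma allow_spec ev st (st' := den (PSeq pAllow pPrice) ev st) : base st ->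
  [/\ base st', sr st' rV = sr st rV, forall i j, al st' i j = allowed st (ev 15%N) i j
    & forall i j, mx st' rC i j = if thr f (sr st rV 0%N) L kap i j then f i j / b j else 0].
Proof.
move=> bs.
have [] := @fill_spec rAl 0 3 (Ite allowE (OfN N1) R0) ev st
   (fun i j => if allowed st (ev 15%N) i j then 1 else 0) bs isT isT isT isT.
  move=> i j st1 s1; rewrite eval_Ite.
  have bs1 : base st1 by apply: base_but s1 bs.
  rewrite (@eval_allowE _ _ i j bs1) //.
  have -> : allowed st1 (setv (setv ev 0 i) 3 j 15) i j = allowed st (ev 15%N) i j.
    by case: s1 => e1 e2; rewrite /allowed /pos /bit e1 e2.
  by case: ifP.
set st1 := den _ _ _ => s1 H1; have bs1 : base st1 by apply: base_but s1 bs.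
have [] := @fill_spec rC 0 3 (Ite (thrE (Ns aKap) 0 3) (DivR (fE 0 3) (demE 3)) R0) ev st1
   (fun i j => if thr f (sr st rV 0%N) L kap i j then f i j / b j else 0) bs1 isT isT isT isT.
  move=> i j st2 s2; rewrite eval_Ite.
  have bs2 : base st2 by apply: base_but s2 bs1.
  have V2 : sr st2 rV = sr st rV by case: s2 => _ -> //; case: s1 => _ ->.
  rewrite (@eval_thrE _ _ bs2 _ 0 3 i j) // eval_Ns (base_kap bs2) V2.
  by case: ifP => // _; rewrite /= (@eval_fE _ _ bs2 0 3 i j) // (@eval_demE _ _ bs2 3 j).
rewrite -/(den pPrice ev st1) => s2 H2.
have -> : st' = den pPrice ev st1 by [].
split=> //.
- exact: base_but s2 bs1.
- by case: s2 => _ -> //; case: s1 => _ ->.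
- move=> i j; rewrite /al /mx; case: s2 => _ -> //; rewrite -/(mx _ _ _ _) H1.
  by case: ifP; rewrite ?ltr01 ?ltxx.
Qed.

Hypothesis nE : (n * n <= E)%N.

Definition codeS st c : {set 'I_n} := [set i : 'I_n | bit st c i].

Lemma codeS_ex st S : base st -> exists2 c, (c < G)%N & codeS st c = S.
Proof.
move=> bs; have [c cG H] := base_bit bs (fun k => [exists i : 'I_n, (i == k :> nat) && (i \in S)]).
exists c => //; apply/setP => i; rewrite inE H; last by have := ltn_ord i; nia.
apply/existsP/idP => [[i' /andP[/eqP /val_inj -> //]]|iS]; exists i.
by rewrite eqxx.
Qed.

Lemma eval_guardE ev st (i : 'I_n) (j : 'I_m) : base st -> ev 0%N = i -> ev 3%N = j ->
  eval guardE ev st = (i \in codeS st (ev 8%N)) &&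
    ~~ ([set r : 'I_n | (i < r)%N && al st r j] \subset codeS st (ev 8%N)).
Proof.
move=> bs ei ej; rewrite /guardE eval_Conj eval_Neg (eval_bitE _ bs) // [eval (Var 0) _ _]/= ei inE.
congr (_ && ~~ _).
rewrite (forallE (P := fun r : 'I_n => ~~ ((i < r)%N && al st r j) || bit st (ev 8%N) r) (base_n bs)).
  apply/forallP/subsetP => [H r|H r].
    by rewrite !inE => h; have := H r; rewrite h.
  by have := H r; rewrite !inE; case: (_ && _) => //= /(_ isT).
move=> r; rewrite eval_Or eval_Neg eval_Conj (eval_bitE _ bs) // eval_LtN (eval_alE _ bs) //.
by rewrite /al /mx /= /setv /= ei ej.
Qed.

Lemma eval_slackE ev st (j : 'I_m) : base st -> ev 3%N = j ->
  eval slackE ev st = cut b (al st) (fun i : 'I_n => sr st rA i) j (codeS st (ev 8%N)).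
Proof.
move=> bs ej; rewrite /slackE /cut eval_SubR; congr (_ - _).
  rewrite (sumRE (F := fun r : 'I_n => if r \in codeS st (ev 8%N) then sr st rA r else 0)
    (base_n bs)); first by rewrite -big_mkcond.
  by move=> r; rewrite eval_Ite (eval_bitE _ bs) // inE.
rewrite (sumRE (F := fun k : 'I_m => if (j < k)%N && (nbr (al st) k \subset codeS st (ev 8%N))
   then b k else 0) (base_m bs)); first by rewrite -big_mkcond.
move=> k; rewrite eval_Ite eval_Conj eval_LtN (@eval_demE _ _ bs 5 k) //.
rewrite (forallE (P := fun r : 'I_n => ~~ al st r k || bit st (ev 8%N) r) (base_n bs)); last first.
  by move=> r; rewrite eval_Or eval_Neg (eval_bitE _ bs) // (eval_alE _ bs).
rewrite [eval (Var 3) _ _]/= [eval (Var 5) _ _]/= /setv /= ej.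
congr (if _ && _ then _ else _).
apply/forallP/subsetP => [H r|H r].
  by rewrite !inE => h; have := H r; rewrite h.
by have := H r; rewrite !inE; case: (al _ _ _) => //= /(_ isT).
Qed.

Local Opaque guardE slackE.

(** A running minimum over the codes is a minimum over all sets of sources, since every such set has
    a code. *)
Lemma cut_spec ev st (i : 'I_n) (j : 'I_m) (st' := den pCut ev st) (u := sr st' rT 0%N)
    (B := sr st rB 0%N) (ct := cut b (al st) (fun i : 'I_n => sr st rA i) j)
    (Nx := [set r : 'I_n | (i < r)%N && al st r j]) :
  base st -> ev 0%N = i -> ev 3%N = j ->
  [/\ same_but rT st st', u <= B,
     forall S : {set 'I_n}, i \in S -> ~~ (Nx \subset S) -> u <= ct S
   & u = B \/ exists S : {set 'I_n}, [/\ i \in S, ~~ (Nx \subset S) & u = ct S]].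
Proof.
move=> bs ei ej.
pose gd c := (i \in codeS st c) && ~~ (Nx \subset codeS st c).
pose J (k : nat) (s : store R) := [/\ same_but rT st s, sr s rT 0%N <= B,
   forall c, (c < k)%N -> gd c -> sr s rT 0%N <= ct (codeS st c)
   & sr s rT 0%N = B \/ exists2 c, gd c & sr s rT 0%N = ct (codeS st c)].
have [] : J G st'.
  rewrite /st' /pCut den_seq den_R.
  set st0 := wrr _ _ _ _.
  have s0 : same_but rT st st0 by split=> // r ne; rewrite /st0 wrr_ne.
  have T0 : sr st0 rT 0%N = B by rewrite /st0 wrr_at.
  apply: (@den_for _ 8 aG _ _ _ J G).
  - by case: s0 => -> _; apply: base_G.
  - by split; rewrite ?T0 //; left.
  - move=> k s kG [s1 lB lc eqc].
    have bs1 : base s by apply: base_but s1 bs.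
    have alE' : al s = al st.
      by apply/funext => r; apply/funext => c; rewrite /al /mx; case: s1 => _ ->.
    have cE c : codeS s c = codeS st c.
      by apply/setP => r; rewrite !inE /bit; case: s1 => -> _.
    have gE : eval guardE (setv ev 8 k) s = gd k.
      by rewrite (@eval_guardE _ _ i j bs1) // /gd /Nx alE' cE.
    have sE : eval slackE (setv ev 8 k) s = ct (codeS st k).
      rewrite (@eval_slackE _ _ j bs1) // alE' cE /ct.
      by case: s1 => _ ->.
    rewrite den_if den_R eval_Conj gE eval_LtR sE eval_Rs [den PNop _ _]/=; case: (boolP (gd k)) => gk /=; last first.
      split=> // c; rewrite ltnS leq_eqVlt => /orP[/eqP -> g|]; last exact: lc.
      by rewrite g in gk.
    case: ltP => h; last first.
      split=> // c; rewrite ltnS leq_eqVlt => /orP[/eqP -> //|]; exact: lc.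
    split; rewrite ?wrr_at //=.
    - by case: s1 => e1 e2; split=> // r ne; rewrite wrr_ne // e2.
    - exact: le_trans (ltW h) lB.
    - move=> c; rewrite ltnS leq_eqVlt => /orP[/eqP -> //|ck gc].
      by apply: le_trans (ltW h) _; apply: lc.
    - by right; exists k.
move=> s1 h1 h2 h3; split=> //.
  by move=> S iS nS; have [c cG ec] := codeS_ex S bs; rewrite -ec; apply: h2; rewrite // /gd ec iS.
case: h3 => [e|[c /andP[g1 g2] e]]; [by left|right].
by exists (codeS st c).
Qed.

Definition keeps (rs : seq nat) st st' :=
  sn st' = sn st /\ forall r, r \notin rs -> sr st' r = sr st r.

Lemma keeps_trans rs st st1 st2 : keeps rs st st1 -> keeps rs st1 st2 -> keeps rs st st2.
Proof.
by move=> [e1 h1] [e2 h2]; split=> [|r nr]; [rewrite e2|rewrite h2 // h1].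
Qed.

Lemma keeps_base rs st st' : rIn \notin rs -> keeps rs st st' -> base st -> base st'.
Proof. by move=> r0 [e1 h1]; apply: base_same => [h _|]; rewrite ?e1 ?h1. Qed.

Lemma den_keeps p ev st : outn p = [::] -> keeps (outr p) st (den p ev st).
Proof.
move=> o; split; last by move=> r; apply: den_sr.
by apply/funext => h; rewrite den_sn // o.
Qed.

Lemma al_keeps rs st st' : rAl \notin rs -> keeps rs st st' -> al st' = al st.
Proof.
by move=> r0 [_ h]; apply/funext => i; apply/funext => j; rewrite /al /mx h.
Qed.

Lemma sum_sup_dem : \sum_i a i = \sum_j b j.
Proof. by rewrite /a /b -!natr_sum supply_demand. Qed.

Lemma greedy_spec ev st y (st' := den pGreedy ev st) : base st ->
  flow a b y -> supported (al st) y ->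
  flow a b (mx st' rX) /\ supported (al st) (mx st' rX).
Proof.
move=> bs fy sy.
have b0 j : 0 <= b j by rewrite /b.
pose ra (s : store R) (i : 'I_n) := sr s rA i.
pose rs := [:: rT; rX; rA; rB].
pose J j (s : store R) := keeps rs st s /\ greedy a b (al st) j 0 (mx s rX) (ra s).
suff [_ g] : J m st' by exact: greedy_end g sum_sup_dem.
rewrite /st' /pGreedy den_seq; set st1 := den _ _ st.
have k1 : keeps [:: rA] st st1 by apply: den_keeps.
have bs1 : base st1 by apply: keeps_base k1 bs.
have A1 (i : 'I_n) : sr st1 rA i = a i.
  pose Q k (s : store R) := keeps [:: rA] st s /\ forall i : 'I_n, (i < k)%N -> sr s rA i = a i.
  have [_] : Q n st1; last by apply.
  apply: (@den_for _ _ _ _ _ _ Q n); [exact: base_n|by split|].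
  move=> k s kn [ks Qs]; rewrite den_R.
  have bss : base s by apply: keeps_base ks bs.
  rewrite (@eval_supE _ _ bss 0 (Ordinal kn)) //; split.
    apply: keeps_trans ks _; split=> // r; rewrite inE => ne; exact: wrr_ne.
  move=> i'; rewrite ltnS wrr_at [eval _ _ _]/= leq_eqVlt /setv /= => /orP[/eqP e|lt].
    by rewrite e eqxx; congr a; apply: val_inj.
  by rewrite (ltn_eqF lt) Qs.
apply: (@den_for _ 3 am _ _ _ J m); first exact: base_m.
  split.
    case: k1 => e h; split=> // r nr; apply: h; apply: contra nr.
    by rewrite !inE => ->; rewrite !orbT.
  have -> : ra st1 = a by apply/funext => i; apply: A1.
  exact: greedy_start fy sy.
move=> k s km [ks gs]; pose j := Ordinal km.
rewrite den_seq den_R; set s1 := wrr _ _ _ _.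
have bss : base s by apply: keeps_base ks bs.
have B1 : sr s1 rB 0%N = b j by rewrite /s1 wrr_at (@eval_demE _ _ bss 3 j).
have ks1 : keeps rs s s1 by split=> // r nr; rewrite /s1 wrr_ne //; apply: contra nr => /eqP ->.
pose Q i (s : store R) := [/\ keeps rs st s, greedy a b (al st) j i (mx s rX) (ra s)
   & sr s rB 0%N = left_over b (mx s rX) j i j].
suff [k2 g2 _] : Q n (den (PFor 0 an (PSeq pCut pSend)) (setv ev 3 k) s1).
  by split=> //; apply: (greedy_next g2).
apply: (@den_for _ 0 an _ _ _ Q n); first by case: ks1 => -> _; apply: base_n.
  split; first exact: keeps_trans ks ks1.
    rewrite (_ : mx s1 rX = mx s rX); last by apply/funext => r; apply/funext => c; rewrite /mx /s1 wrr_ne.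
    by rewrite (_ : ra s1 = ra s) //; apply/funext => r; rewrite /ra /s1 wrr_ne.
  by rewrite B1 /left_over big_pred0 ?subr0 // => r; rewrite /done ltnn ltn0 andbF.
move=> t s2 tn [k2 g2 B2]; pose i := Ordinal tn.
have bs2 : base s2 by apply: keeps_base k2 bs.
have al2 : al s2 = al st by apply: al_keeps k2.
rewrite den_seq.
have := @cut_spec (setv (setv ev 3 k) 0 t) s2 i j bs2 (erefl _) (erefl _).
set s3 := den pCut _ s2; set u := sr s3 rT 0%N; rewrite al2 B2 => -[k3 u1 u2 u3].
have k3' : keeps rs s2 s3.
  by case: k3 => e h; split=> // r nr; apply: h; apply: contra nr => /eqP ->.
have bs3 : base s3 by apply: keeps_base k3' bs2.
have al3 : al s3 = al st by rewrite -al2; apply: al_keeps k3'.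
rewrite /pSend !den_seq !den_R.
set e0 := setv (setv ev 3 k) 0 t.
rewrite eval_Ite (eval_alE e0 bs3) // [eval (Rs rT) e0 s3]/=.
set s4 := wrr s3 _ _ _; set s5 := wrr s4 _ _ _; set s6 := wrr s5 _ _ _; set s7 := wrr s6 _ _ _.
pose T := if al st i j then u else 0.
have E3 r : r != rT -> sr s3 r = sr s2 r by case: k3 => _; apply.
have T4 : sr s4 rT 0%N = T by rewrite /s4 wrr_at /T -al3.
have bs4 : base s4.
  by apply: (@keeps_base rs s3) => //; split=> // r nr; rewrite /s4 wrr_ne //; apply: contra nr => /eqP ->.
have x5 r c : mx s5 rX r c = if (r == i) && (c == j) then T else mx s2 rX r c.
  rewrite /mx /s5 wrr_at eval_ix // eval_Rs T4 -[e0 0%N]/(i : nat) -[e0 3%N]/(j : nat) ix_inj val_eqE.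
  by rewrite /s4 wrr_ne // E3.
have T5 : sr s5 rT 0%N = T by rewrite /s5 wrr_ne.
have A6 (r : 'I_n) : sr s6 rA r = sr s2 rA r - (if r == i then T else 0).
  rewrite /s6 wrr_at eval_SubR [eval (Var 0) _ _]/= [eval (RArr _ _) _ _]/= eval_Rs T5.
  rewrite -[e0 0%N]/(i : nat) -(val_eqE r i) /=; case: eqP => [->|_]; last rewrite subr0.
    by rewrite /s5 wrr_ne // /s4 wrr_ne // E3.
  by rewrite /s5 wrr_ne // /s4 wrr_ne // E3.
have B7 : sr s7 rB 0%N = sr s2 rB 0%N - T.
  have T6 : sr s6 rT 0%N = T by rewrite /s6 wrr_ne.
  have B6 : sr s6 rB = sr s2 rB by rewrite /s6 wrr_ne // /s5 wrr_ne // /s4 wrr_ne // E3.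
  by rewrite /s7 wrr_at eval_SubR !eval_Rs B6 T6.
have k7 : keeps rs s3 s7.
  split=> // r; rewrite !inE !negb_or => /and4P[n1 n2 n3 n4].
  by rewrite /s7 wrr_ne // /s6 wrr_ne // /s5 wrr_ne // /s4 wrr_ne.
have [g7 l7] := @greedy_send _ n m a b (al st) i j (mx s2 rX) (mx s7 rX) (ra s2) (ra s7) T u g2
  u1 u2 u3 erefl (fun r c => x5 r c) (fun r => A6 r).
split=> //; first exact: keeps_trans k2 (keeps_trans k3' k7).
by rewrite B7 B2 l7.
Qed.

Lemma copy_spec r r' ev st (st' := den (pCopy r r') ev st) : base st -> r != rIn -> r' != r ->
  same_but r st st' /\ mx st' r = mx st r'.
Proof.
move=> bs r0 rr; have [] := @fill_spec r 2 5 (entryE r' 2 5) ev st (mx st r') bs r0 isT isT isT.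
  move=> i j st1 s1; rewrite eval_entryE //; last exact: base_but s1 bs.
  by rewrite /mx; case: s1 => _ ->.
by move=> s1 h; split=> //; apply/funext => i; apply/funext => j; apply: h.
Qed.

Definition valid st x : Prop := flow a b x /\ supported (al st) x.

Lemma eval_validE ev st r : base st -> reflect (valid st (mx st r)) (eval (validE r) ev st).
Proof.
move=> bs; rewrite /validE !eval_Conj.
rewrite (forallE (P := fun i : 'I_n => [forall j : 'I_m, (0 <= mx st r i j) &&
   ((mx st r i j <= 0) || al st i j)]) (base_n bs)); last first.
  move=> i; apply: (forallE (base_m bs)) => j.
  by rewrite eval_Conj eval_Or !eval_LeR eval_entryE // (eval_alE _ bs).
rewrite (forallE (P := fun i : 'I_n => \sum_j mx st r i j == a i) (base_n bs)); last first.
  move=> i; rewrite eval_EqR (@eval_supE _ _ bs 2 i) //; congr (_ == _).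
  by apply: (sumRE (base_m bs)) => j; rewrite eval_entryE.
rewrite (forallE (P := fun j : 'I_m => \sum_i mx st r i j == b j) (base_m bs)); last first.
  move=> j; rewrite eval_EqR (@eval_demE _ _ bs 5 j) //; congr (_ == _).
  by apply: (sumRE (base_n bs)) => i; rewrite eval_entryE.
apply: (iffP and3P) => [[/forallP h1 /forallP h2 /forallP h3]|[[x0 xA xB] sx]].
  split; last first.
    by move=> i j; have /forallP/(_ j)/andP[_] := h1 i; rewrite leNgt; case: ltP.
  split=> [i j|i|j]; [|exact/eqP/h2|exact/eqP/h3].
  by have /forallP/(_ j)/andP[] := h1 i.
split; apply/forallP => i; rewrite ?xA ?xB //.
apply/forallP => j; rewrite x0 /=; case: (ltP 0 (mx st r i j)) => //= h.
exact: sx.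
Qed.

Lemma eval_linE ev st r : base st -> eval (linE r) ev st = lin (mx st rC) (mx st r).
Proof.
move=> bs; apply: (sumRE (base_n bs)) => i; apply: (sumRE (base_m bs)) => j.
by rewrite eval_MulR !eval_entryE.
Qed.

Lemma eval_costE ev st r : base st -> eval (costE r) ev st = fcost f (mx st r).
Proof.
move=> bs; apply: (sumRE (base_n bs)) => i; apply: (sumRE (base_m bs)) => j.
by rewrite eval_Ite eval_LtR eval_entryE // (@eval_fE _ _ bs 2 5 i j).
Qed.

Definition arcs st c (i i' : 'I_n) : bool := bit st c (n * i + i').

Lemma eval_eqE ev st x y : eval (eqE x y) ev st = (ev x == ev y)%:R.
Proof. by rewrite /eqE /= eqn_leq; case: (_ && _). Qed.

Local Opaque eqE.

Lemma eval_usableE ev st k (p i i' : 'I_n) (q j : 'I_m) : base st ->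
  ev 0%N = i -> ev 1%N = i' -> ev 6%N = p -> ev 7%N = q -> ev k = j ->
  eval (usableE k) ev st = usable (al st) (mx st rX) (mx st rX p q) i i' j.
Proof.
move=> bs e0 e1 e6 e7 ek.
by rewrite /usableE eval_Conj eval_LeR !eval_entryE // (eval_alE _ bs) // e0 e1 e6 e7 ek.
Qed.

Lemma eval_beatsE ev st k l (i i' : 'I_n) (j' j : 'I_m) : base st ->
  ev 0%N = i -> ev 1%N = i' -> ev k = j' -> ev l = j ->
  eval (beatsE k l) ev st = beats (mx st rC) i i' j' j.
Proof.
move=> bs e0 e1 ek el; rewrite /beatsE eval_Or eval_Conj eval_LtR eval_LeR eval_LtN /valE.
by rewrite !eval_SubR !eval_entryE // !e0 !e1 /= ek el.
Qed.

Local Opaque usableE beatsE.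

Lemma eval_bestE ev st (p i i' : 'I_n) (q j : 'I_m) : base st ->
  ev 0%N = i -> ev 1%N = i' -> ev 6%N = p -> ev 7%N = q -> ev 5%N = j ->
  eval bestE ev st = best (al st) (mx st rC) (mx st rX) (mx st rX p q) i i' j.
Proof.
move=> bs e0 e1 e6 e7 e5; rewrite /bestE eval_Conj (@eval_usableE _ _ 5 p i i' q j) //.
congr (_ && _); apply: (forallE (base_m bs)) => j'.
by rewrite eval_Neg eval_Conj (@eval_usableE _ _ 4 p i i' q j') // (@eval_beatsE _ _ 4 5 i i' j' j).
Qed.

Local Opaque bestE.

Lemma eval_moveE ev st (p r : 'I_n) (q k : 'I_m) : base st ->
  ev 2%N = r -> ev 5%N = k -> ev 6%N = p -> ev 7%N = q ->
  eval moveE ev st =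
    move (al st) (mx st rC) (arcs st (ev 8%N)) (mx st rX p q) (mx st rX) r k.
Proof.
move=> bs e2 e5 e6 e7; rewrite /moveE eval_AddR eval_MulR !eval_entryE // e2 e5 e6 e7 /move.
congr (_ + _ * _); apply: (sumRE (base_n bs)) => i; apply: (sumRE (base_n bs)) => i'.
set ev' := setv _ _ _.
rewrite eval_Ite eval_Conj (eval_bitE _ bs) // (@eval_bestE _ _ p i i' q k) //.
rewrite eval_SubR !eval_eqE -[ev' 1%N]/(i' : nat) -[ev' 0%N]/(i : nat) -[ev' 2%N]/(ev 2%N) e2.
rewrite -[ev' 8%N]/(ev 8%N) /arcs eval_AddN [eval (Var 1) _ _]/=.
rewrite (sumNE (F := fun=> i : nat) (base_n bs)); last by move=> t.
by rewrite sum_nat_const card_ord.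
Qed.

Local Opaque moveE validE linE costE.

Lemma al_but r st st' : r != rAl -> same_but r st st' -> al st' = al st.
Proof.
move=> r0 [_ h]; apply/funext => i; apply/funext => j.
by rewrite /al /mx h // eq_sym.
Qed.

Lemma mx_but r r' st st' : r' != r -> same_but r st st' -> mx st' r' = mx st r'.
Proof. by move=> r0 [_ h]; apply/funext => i; apply/funext => j; rewrite /mx h. Qed.

Lemma try_spec ev st (p : 'I_n) (q : 'I_m) (st' := den pTry ev st)
    (y := move (al st) (mx st rC) (arcs st (ev 8%N)) (mx st rX p q) (mx st rX)) :
  base st -> ev 6%N = p -> ev 7%N = q ->
  keeps [:: rY; rZ] st st' /\
  ((valid st y /\ lin (mx st rC) y < lin (mx st rC) (mx st rZ) /\ mx st' rZ = y) \/
   ((valid st y -> lin (mx st rC) (mx st rZ) <= lin (mx st rC) y) /\ mx st' rZ = mx st rZ)).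
Proof.
move=> bs e6 e7.
split; first by apply: den_keeps.
rewrite /st' /pTry den_seq den_if.
have [] := @fill_spec rY 2 5 moveE ev st y bs isT isT isT isT.
  move=> i j st1 s1; have bs1 : base st1 by apply: base_but s1 bs.
  rewrite (@eval_moveE _ _ p i q j) //.
  by rewrite (al_but _ s1) // !(mx_but _ s1) // /arcs /bit; case: s1 => -> _.
rewrite -/(pFill rY moveE); set st1 := den _ _ _ => s1 h1.
have bs1 : base st1 by apply: base_but s1 bs.
have y1 : mx st1 rY = y by apply/funext => i; apply/funext => j; apply: h1.
have vE : valid st1 = valid st by rewrite /valid (al_but _ s1).
rewrite eval_Conj eval_LtR !eval_linE // y1 !(mx_but _ s1) //.
case: (eval_validE ev rY bs1) => v; rewrite y1 vE in v; last first.
  by rewrite /=; right; split=> //; rewrite (mx_but _ s1).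
case: ltP => h /=; last by right; split=> //; rewrite (mx_but _ s1).
left; split=> //; split=> //.
by have [_ ->] := @copy_spec rZ rY ev st1 bs1 isT isT.
Qed.

Lemma mx_keeps rs r st st' : r \notin rs -> keeps rs st st' -> mx st' r = mx st r.
Proof. by move=> r0 [_ h]; apply/funext => i; apply/funext => j; rewrite /mx h. Qed.

Lemma but_keeps r (rs : seq nat) st st' : r \in rs -> same_but r st st' -> keeps rs st st'.
Proof. by move=> rr [e h]; split=> // r' n'; apply: h; apply: contraNneq n' => ->. Qed.

Lemma valid_al st st' : al st' = al st -> valid st' = valid st.
Proof. by rewrite /valid => ->. Qed.

Lemma sub_keeps (rs rs' : seq nat) st st' : {subset rs <= rs'} -> keeps rs st st' ->
  keeps rs' st st'.
Proof. by move=> s [e h]; split=> // r nr; apply: h; apply: contra nr => /s. Qed.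

Local Opaque pTry pCopy.

Lemma round_spec ev st y (st' := den pRound ev st) (x := mx st rX) (x' := mx st' rX)
    (c := mx st rC) : base st -> valid st x -> valid st y ->
  [/\ keeps [:: rX; rY; rZ] st st', valid st x', lin c x' <= lin c x
    & lin c y < lin c x -> lin c x - lin c y <= (n * n * m)%:R * (lin c x - lin c x')].
Proof.
move=> bs vx vy.
have [s1 z1] := @copy_spec rZ rX ev st bs isT isT.
rewrite /x' /st' /pRound !den_seq.
set st1 := den (pCopy rZ rX) ev st in s1 z1 *.
set rs := [:: rX; rY; rZ].
have k1 : keeps rs st st1 by apply: but_keeps s1.
(* During a round the flow in [rX] stays fixed, so all moves are computed from the same [x]; only
   the best result, in [rZ], changes. *)
pose P s := [/\ keeps [:: rY; rZ] st1 s, valid st (mx s rZ) & lin c (mx s rZ) <= lin c x].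
have Pbase s : P s -> base s.
  by case=> k _ _; apply: keeps_base k _ => //; apply: keeps_base k1 bs.
have Pn s : P s -> sn s an 0%N = n by move/Pbase/base_n.
have PX s : P s -> mx s rX = x.
  by case=> k _ _; rewrite (mx_keeps _ k) // (mx_but _ s1).
have PC s : P s -> mx s rC = c.
  by case=> k _ _; rewrite (mx_keeps _ k) // (mx_but _ s1).
have Pal s : P s -> al s = al st.
  by case=> k _ _; rewrite (al_keeps _ k) // (al_but _ s1).
have Pbit s : P s -> arcs s = arcs st.
  case=> -[e _] _ _; apply/funext => cc; apply/funext => i; apply/funext => i'.
  by rewrite /arcs /bit e; case: s1 => -> _.
have P1 : P st1 by split=> //; rewrite z1.
have step (e : nat -> nat) s (p : 'I_n) (q : 'I_m) k : P s -> e 6%N = p -> e 7%N = q ->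
    P (den pTry (setv e 8 k) s) /\
    let z := move (al st) c (arcs st k) (x p q) x in
    lin c (mx (den pTry (setv e 8 k) s) rZ) <= lin c (mx s rZ) /\
    (valid st z -> lin c (mx (den pTry (setv e 8 k) s) rZ) <= lin c z).
  move=> Ps e6 e7; have bss := Pbase _ Ps.
  have [k2 H] := @try_spec (setv e 8 k) s p q bss e6 e7.
  rewrite (Pal _ Ps) (PC _ Ps) (Pbit _ Ps) (PX _ Ps) (valid_al (Pal _ Ps)) in H.
  case: Ps => ks vs ls; set z := move _ _ _ _ _ in H.
  have ks2 := keeps_trans ks k2.
  case: H => [[vz [lz ez]]|[h ez]]; rewrite /P ez; split=> //; split=> //.
  - exact: le_trans (ltW lz) ls.
  - exact: ltW.
have sG s : P s -> sn s aG 0%N = G by move/Pbase/base_G.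
have sM s : P s -> sn s am 0%N = m by move/Pbase/base_m.
pose W (w : R) s := lin c (mx s rZ) <= w.
have L8 (e : nat -> nat) s (p : 'I_n) (q : 'I_m) w : P s -> e 6%N = p -> e 7%N = q ->
    P (den (PFor 8 aG pTry) e s) /\ (W w s -> W w (den (PFor 8 aG pTry) e s)).
  move=> Ps e6 e7.
  have [] := @den_for_inv _ 8 aG pTry e s (fun s => P s /\ (W w s -> W w s)); first by split.
    by move=> k s' _ [Ps' _]; split=> //; have [] := step e s' p q k Ps' e6 e7.
  move=> Pd _; split=> // Ws.
  have [] // := @den_for_inv _ 8 aG pTry e s (fun s => P s /\ W w s).
  move=> k s' _ [Ps' Ws']; have [Pd' [le _]] := step e s' p q k Ps' e6 e7.
  by split=> //; apply: le_trans le Ws'.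
have L7 (e : nat -> nat) s (p : 'I_n) w : P s -> e 6%N = p ->
    P (den (PFor 7 am (PFor 8 aG pTry)) e s) /\
    (W w s -> W w (den (PFor 7 am (PFor 8 aG pTry)) e s)).
  move=> Ps e6.
  apply: (@den_for_inv _ 7 am _ e s (fun s' => P s' /\ (W w s -> W w s'))) => //.
  move=> k s' km [Ps' Ws']; rewrite (sM _ Ps) in km.
  have [Pd Wd] := L8 (setv e 7 k) s' p (Ordinal km) w Ps' e6 (erefl _).
  by split=> // /Ws'/Wd.
have L6 w : P (den (PFor 6 an (PFor 7 am (PFor 8 aG pTry))) ev st1) /\
    (W w st1 -> W w (den (PFor 6 an (PFor 7 am (PFor 8 aG pTry))) ev st1)).
  apply: (@den_for_inv _ 6 an _ ev st1 (fun s' => P s' /\ (W w st1 -> W w s'))) => //.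
  move=> k s' km [Ps' Ws']; rewrite (Pn _ P1) in km.
  have [Pd Wd] := L7 (setv ev 6 k) s' (Ordinal km) w Ps' (erefl _).
  by split=> // /Ws'/Wd.
(* Any set of arcs has a code because [n * n <= E]; hence the move promised by [round_gain] is among
   those that are tried. *)
have reach (p : 'I_n) (q : 'I_m) Zb : valid st (move (al st) c Zb (x p q) x) ->
    W (lin c (move (al st) c Zb (x p q) x)) (den (PFor 6 an (PFor 7 am (PFor 8 aG pTry))) ev st1).
  move=> vz; set w := lin _ _.
  have [k0 k0G k0E] := base_bit bs
    (fun t => [exists i : 'I_n, exists i' : 'I_n, ((n * i + i')%N == t) && Zb i i']).
  have arcsE : arcs st k0 = Zb.
    apply/funext => i; apply/funext => i'; rewrite /arcs k0E; last first.
      by have := ltn_ord i; have := ltn_ord i'; nia.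
    apply/existsP/idP => [[u /existsP [u' /andP[/eqP e z]]]|z]; last first.
      by exists i; apply/existsP; exists i'; rewrite eqxx.
    have n0 : (0 < n)%N by apply: leq_ltn_trans (ltn_ord i).
    have eu : u = i.
      apply: val_inj; have := congr1 (divn^~ n) e.
      by rewrite /= ![(n * _)%N]mulnC !divnMDl // !divn_small // !addn0.
    by move: z; rewrite eu; move: e; rewrite eu => /addnI/val_inj ->.
  apply: (proj2 (@den_for_reach _ 6 an (PFor 7 am (PFor 8 aG pTry)) ev st1 P (W w) n p (Pn _ P1) P1 _ _ _ _)) => //.
  - by move=> k s kn Ps; have [] := L7 (setv ev 6 k) s (Ordinal kn) w Ps (erefl _).
  - move=> s Ps; apply: (proj2 (@den_for_reach _ 7 am (PFor 8 aG pTry) (setv ev 6 p) s P (W w) m q (sM _ Ps) Ps _ _ _ _)) => //.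
    + by move=> k s' km Ps'; have [] := L8 (setv (setv ev 6 p) 7 k) s' p (Ordinal km) w Ps' (erefl _) (erefl _).
    + move=> s' Ps'.
      apply: (proj2 (@den_for_reach _ 8 aG pTry (setv (setv ev 6 p) 7 q) s' P (W w) G k0 (sG _ Ps') Ps' _ _ _ _)) => //.
      * by move=> k t _ Pt; have [] := step (setv (setv ev 6 p) 7 q) t p q k Pt (erefl _) (erefl _).
      * move=> t Pt; have [_ [_ h]] := step (setv (setv ev 6 p) 7 q) t p q k0 Pt (erefl _) (erefl _).
        by rewrite arcsE in h; apply: h.
      * move=> k t _ Pt Wt; have [_ [h _]] := step (setv (setv ev 6 p) 7 q) t p q k Pt (erefl _) (erefl _).
        exact: le_trans h Wt.
    + move=> k s' km Ps' Ws'.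
      by have [_] := L8 (setv (setv ev 6 p) 7 k) s' p (Ordinal km) w Ps' (erefl _) (erefl _); apply.
  - by move=> k s kn Ps Ws; have [_] := L7 (setv ev 6 k) s (Ordinal kn) w Ps (erefl _); apply.
have [P2 _] := L6 0.
set st2 := den (PFor 6 an _) ev st1 in P2 reach *.
have [s3 z3] := @copy_spec rX rZ ev st2 (Pbase _ P2) isT isT.
rewrite z3; case: (P2) => k2 v2 l2; split=> //.
- apply: keeps_trans (keeps_trans k1 (sub_keeps _ k2)) (but_keeps _ s3) => //.
  by move=> r; rewrite !inE => /orP[] ->; rewrite ?orbT.
- move=> gap; have [fx sx] := vx; have [fy sy] := vy.
  have [p [q [Zb [fz sz gz]]]] := round_gain fx sx fy sy gap.
  apply: le_trans gz _; apply: ler_wpM2l => //.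
  by rewrite lerD2l lerN2; apply: reach.
Qed.

Local Opaque pRound.

(** Each round multiplies the gap by at most [1 - 1 / N]. The induction keeps the weaker factor
    [N / (N + k)], which is rational in [k] and strong enough for the number of rounds made. *)
Lemma search_spec ev st y (st' := den pSearch ev st) (x := mx st rX) (x' := mx st' rX)
    (c := mx st rC) (N := (n * n * m)%N) : base st -> valid st x -> valid st y ->
  [/\ keeps [:: rX; rY; rZ] st st', valid st x'
    & lin c x' <= lin c y \/ (N + m * m)%:R * (lin c x' - lin c y) <= N%:R * (lin c x - lin c y)].
Proof.
move=> bs vx vy; set rs := [:: rX; rY; rZ].
pose J k s := [/\ keeps rs st s, valid st (mx s rX) & lin c (mx s rX) <= lin c y \/
  (N + k)%:R * (lin c (mx s rX) - lin c y) <= N%:R * (lin c x - lin c y)].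
suff [] : J (m * m)%N st' by [].
apply: (@den_for _ 18 am _ ev st (fun k => J (k * m)%N) m); first exact: base_m.
  by split=> //; right; rewrite mul0n addn0.
move=> k s km Jk.
have -> : (k.+1 * m = k * m + m)%N by rewrite mulSn addnC.
apply: (@den_for _ 19 am _ _ s (fun l => J (k * m + l)%N) m); last 2 first.
- by rewrite addn0.
- move=> l t lm [kt vt gt]; set u := (k * m + l)%N in gt *.
  have bt : base t by apply: keeps_base kt bs.
  have alt : al t = al st by apply: al_keeps kt.
  have := @round_spec (setv (setv ev 18 k) 19 l) t y bt.
  rewrite (valid_al alt) (@mx_keeps rs rC st t isT kt) -/c => /(_ vt vy) [k2 v2 l2 g2].
  split=> //; first exact: keeps_trans kt k2.
  set xt := mx t rX in vt gt l2 g2; set xn := mx _ rX in v2 l2 g2 *.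
  case: (leP (lin c xn) (lin c y)) => h; first by left.
  right; have hg : lin c y < lin c xt by apply: lt_le_trans h l2.
  case: gt => [|gt]; first by rewrite leNgt hg.
  move: (g2 hg); rewrite !addnS -/u -natr1 -/N; move: gt h hg l2.
  rewrite natrD; set gn := lin c xn; set gy := lin c y; set gg := lin c xt.
  set NN : R := N%:R; set uu : R := u%:R; set g0 := lin c x.
  have N0 : 0 <= NN by [].
  have u0 : 0 <= uu by [].
  move=> h1 h2 h3 h4 h5.
  have Np : 0 < NN by nra.
  (* The step rests on [(N + k + 1) * (N - 1) <= N * (N + k)], where the two sides differ by
     [k + 1]. *)
  apply: le_trans h1; rewrite -(ler_pM2l Np).
  have -> : NN * ((NN + uu + 1) * (gn - gy)) = (NN + uu + 1) * (NN * (gn - gy)) by ring.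
  apply: (@le_trans _ _ ((NN + uu + 1) * ((NN - 1) * (gg - gy)))).
    by apply: ler_wpM2l; [nra|lra].
  have -> : NN * ((NN + uu) * (gg - gy)) =
     (NN + uu + 1) * ((NN - 1) * (gg - gy)) + (uu + 1) * (gg - gy) by ring.
  by rewrite lerDl mulr_ge0 //; lra.
- by case: Jk => -[-> _] _ _; apply: base_m.
Qed.

(** The assignment is described as an increment, so that four of them compose to [turn] even when
    corners of the rectangle coincide. *)
Lemma bump_spec ev st v w (i : 'I_n) (j : 'I_m) (e : expr TR) (d : R)
    (st' := den (PR rX (ix v w) e) ev st) : base st -> v != 10%N -> ev v = i -> ev w = j ->
  eval e ev st = mx st rX i j + d ->
  same_but rX st st' /\
  forall r k, mx st' rX r k = mx st rX r k + d * ((i == r) && (j == k))%:R.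
Proof.
move=> bs v10 ei ej ee; rewrite /st' den_R ee eval_ix // ei ej; split.
  by split=> // r nr; rewrite wrr_ne.
move=> r k; rewrite /mx wrr_at ix_inj (_ : (nat_of_ord r == i) = (i == r)) 1?eq_sym //.
rewrite ?[j == k]eq_sym.
case: (r =P i) => [->|_]; last by rewrite /= ?mulr0n ?mulr0 addr0.
by case: (k =P j) => [->|_]; rewrite /= ?mulr1n ?mulr0n ?mulr1 ?mulr0 ?addr0.
Qed.

Lemma shift_spec ev st (i i' : 'I_n) (j j' : 'I_m) (st' := den pShift ev st) (x := mx st rX) :
  base st -> ev 0%N = i -> ev 1%N = i' -> ev 3%N = j -> ev 4%N = j' ->
  mx st' rX = turn x i i' j j' (Num.min (x i j) (x i' j')).
Proof.
move=> bs e0 e1 e3 e4; rewrite /st' /pShift !den_seq [den (PR rT _ _) _ _]den_R.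
set st0 := wrr _ _ _ _.
have s0 : same_but rT st st0 by split=> // r nr; rewrite /st0 wrr_ne.
have bs0 : base st0 by apply: base_but s0 bs.
set t := Num.min _ _.
have T0 : sr st0 rT 0%N = t.
  rewrite /st0 wrr_at eval_Ite eval_LeR !eval_entryE // e0 e1 e3 e4 /t /mx.
  by rewrite minEle.
have x0 : mx st0 rX = x by rewrite (mx_but _ s0).
have [] := @bump_spec ev st0 0 3 i j (SubR (entryE rX 0 3) (Rs rT)) (- t) bs0 isT e0 e3.
  by rewrite eval_SubR eval_entryE // e0 e3 eval_Rs T0.
set st1 := den _ ev st0 => s1 x1; have bs1 : base st1 by apply: base_but s1 bs0.
have T1 : sr st1 rT 0%N = t by case: s1 => _ ->.
have [] := @bump_spec ev st1 1 4 i' j' (SubR (entryE rX 1 4) (Rs rT)) (- t) bs1 isT e1 e4.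
  by rewrite eval_SubR eval_entryE // e1 e4 eval_Rs T1.
set st2 := den _ ev st1 => s2 x2; have bs2 : base st2 by apply: base_but s2 bs1.
have T2 : sr st2 rT 0%N = t by case: s2 => _ ->.
have [] := @bump_spec ev st2 1 3 i' j (AddR (entryE rX 1 3) (Rs rT)) t bs2 isT e1 e3.
  by rewrite eval_AddR eval_entryE // e1 e3 eval_Rs T2.
set st3 := den _ ev st2 => s3 x3; have bs3 : base st3 by apply: base_but s3 bs2.
have T3 : sr st3 rT 0%N = t by case: s3 => _ ->.
have [] := @bump_spec ev st3 0 4 i j' (AddR (entryE rX 0 4) (Rs rT)) t bs3 isT e0 e4.
  by rewrite eval_AddR eval_entryE // e0 e4 eval_Rs T3.
set st4 := den _ ev st3 => s4 x4.
apply/funext => r; apply/funext => k; rewrite x4 x3 x2 x1 x0 /turn; ring.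
Qed.

Lemma shift_keeps ev st : keeps [:: rT; rX] st (den pShift ev st).
Proof.
apply: (@sub_keeps (outr pShift)); last exact: den_keeps.
by apply/allP.
Qed.

Local Opaque pShift.

Lemma turn_spec ev st (i i' : 'I_n) (j j' : 'I_m) (st' := den pTurn ev st) (x := mx st rX)
    (x' := mx st' rX) (c := mx st rC) :
  base st -> ev 0%N = i -> ev 1%N = i' -> ev 3%N = j -> ev 4%N = j' -> valid st x ->
  [/\ keeps [:: rT; rX] st st', valid st x', lin c x' <= lin c x,
     forall r k, 0 < x' r k -> 0 < x r k
   & 0 <= turncost c i i' j j' -> i != i' -> j != j' -> ~~ full x' i i' j j'].
Proof.
move=> bs e0 e1 e3 e4 [fx sx].
rewrite /x' /st' /pTurn den_if eval_Conj eval_LeR.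
have -> : eval fullE ev st = full x i i' j j'.
  by rewrite /fullE !eval_Conj !eval_LtR !eval_entryE // e0 e1 e3 e4 /full !andbA.
have -> : eval turnE ev st = turncost c i i' j j'.
  by rewrite /turnE !eval_SubR eval_AddR !eval_entryE // e0 e1 e3 e4.
rewrite [eval R0 _ _]/=; case: (boolP (full x i i' j j')) => //= fl.
case: ifP => tc; last by split=> //; rewrite tc.
rewrite (@shift_spec _ _ i i' j j') //.
have [h1 h2 h3 h4] := turn_ok fx fl tc erefl.
split=> //; first exact: shift_keeps.
by split=> // r k /h2/sx.
Qed.

Local Opaque pTurn.

(** Turns only shrink the support, so a rectangle that has been broken once stays broken, and a
    single pass is enough. *)
Lemma cancel_spec ev st (st' := den pCancel ev st) (x := mx st rX) (x' := mx st' rX)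
    (c := mx st rC) : base st -> valid st x ->
  [/\ keeps [:: rT; rX] st st', valid st x', lin c x' <= lin c x
   & forall i i' j j', i != i' -> j != j' -> ~~ full x' i i' j j'].
Proof.
move=> bs vx; set rs := [:: rT; rX].
pose P s := [/\ keeps rs st s, valid st (mx s rX) & lin c (mx s rX) <= lin c x].
have P0 : P st by [].
have Pb s : P s -> base s by case=> k _ _; apply: keeps_base k bs.
have sN s : P s -> sn s an 0%N = n by move/Pb/base_n.
have sM s : P s -> sn s am 0%N = m by move/Pb/base_m.
pose Q i i' j j' s := ~~ full (mx s rX) i i' j j'.
have step (e : nat -> nat) s (i i' : 'I_n) (j j' : 'I_m) : P s ->
    e 0%N = i -> e 1%N = i' -> e 3%N = j -> e 4%N = j' ->
    P (den pTurn e s) /\ (forall a a' b b', Q a a' b b' s -> Q a a' b b' (den pTurn e s)) /\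
    (0 <= turncost c i i' j j' -> i != i' -> j != j' -> Q i i' j j' (den pTurn e s)).
  move=> Ps e0 e1 e3 e4; case: (Ps) => ks vs ls.
  have := @turn_spec e s i i' j j' (Pb _ Ps) e0 e1 e3 e4.
  rewrite (valid_al (al_keeps _ ks)) // (@mx_keeps rs rC _ _ isT ks) -/c.
  move=> /(_ vs) [k2 v2 l2 h2 q2]; split; last split=> //.
    by split=> //; [apply: keeps_trans ks k2|apply: le_trans l2 ls].
  move=> w w' z z'; rewrite /Q /full; apply: contra => /and4P[h3 h4 h5 h6].
  by rewrite !h2.
pose p1 := PFor 1 an pTurn; pose p0 := PFor 0 an p1; pose p4 := PFor 4 am p0.
have L1 (e : nat -> nat) s (i : 'I_n) (j j' : 'I_m) : P s ->
    e 0%N = i -> e 3%N = j -> e 4%N = j' ->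
    P (den p1 e s) /\ forall a a' b b', Q a a' b b' s -> Q a a' b b' (den p1 e s).
  move=> Ps e0 e3 e4; apply: (@den_for_inv _ 1 an pTurn e s
    (fun t => P t /\ forall a a' b b', Q a a' b b' s -> Q a a' b b' t)) => // k t kn [Pt Qt].
  rewrite (sN _ Ps) in kn.
  have [Pd [Qd _]] := step (setv e 1 k) t i (Ordinal kn) j j' Pt e0 erefl e3 e4.
  by split=> // ? ? ? ? /Qt/Qd.
have L0 (e : nat -> nat) s (j j' : 'I_m) : P s -> e 3%N = j -> e 4%N = j' ->
    P (den p0 e s) /\ forall a a' b b', Q a a' b b' s -> Q a a' b b' (den p0 e s).
  move=> Ps e3 e4; apply: (@den_for_inv _ 0 an p1 e s
    (fun t => P t /\ forall a a' b b', Q a a' b b' s -> Q a a' b b' t)) => // k t kn [Pt Qt].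
  rewrite (sN _ Ps) in kn.
  have [Pd Qd] := L1 (setv e 0 k) t (Ordinal kn) j j' Pt erefl e3 e4.
  by split=> // ? ? ? ? /Qt/Qd.
have L4 (e : nat -> nat) s (j : 'I_m) : P s -> e 3%N = j ->
    P (den p4 e s) /\ forall a a' b b', Q a a' b b' s -> Q a a' b b' (den p4 e s).
  move=> Ps e3; apply: (@den_for_inv _ 4 am p0 e s
    (fun t => P t /\ forall a a' b b', Q a a' b b' s -> Q a a' b b' t)) => // k t kn [Pt Qt].
  rewrite (sM _ Ps) in kn.
  have [Pd Qd] := L0 (setv e 4 k) t j (Ordinal kn) Pt e3 erefl.
  by split=> // ? ? ? ? /Qt/Qd.
have PF : P st'.
  apply: (@den_for_inv _ 3 am p4 ev st P) => // k t kn Pt; rewrite (sM _ P0) in kn.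
  by have [] := L4 (setv ev 3 k) t (Ordinal kn) Pt erefl.
have reach i i' j j' : 0 <= turncost c i i' j j' -> i != i' -> j != j' -> Q i i' j j' st'.
  move=> tc ni nj.
  apply: (proj2 (@den_for_reach _ 3 am p4 ev st P (Q i i' j j') m j (sM _ P0) P0 _ _ _ _)) => //.
  - by move=> k s km Ps; have [] := L4 (setv ev 3 k) s (Ordinal km) Ps erefl.
  - move=> s Ps; apply: (proj2 (@den_for_reach _ 4 am p0 (setv ev 3 j) s P (Q i i' j j') m j' (sM _ Ps) Ps _ _ _ _)) => //.
    + by move=> k t km Pt; have [] := L0 (setv (setv ev 3 j) 4 k) t j (Ordinal km) Pt erefl erefl.
    + move=> t Pt; apply: (proj2 (@den_for_reach _ 0 an p1 (setv (setv ev 3 j) 4 j') t P (Q i i' j j') n i (sN _ Pt) Pt _ _ _ _)) => //.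
      * by move=> k u km Pu; have [] := L1 (setv (setv (setv ev 3 j) 4 j') 0 k) u (Ordinal km) j j' Pu erefl erefl erefl.
      * move=> u Pu; apply: (proj2 (@den_for_reach _ 1 an pTurn (setv (setv (setv ev 3 j) 4 j') 0 i) u P (Q i i' j j') n i' (sN _ Pu) Pu _ _ _ _)) => //.
        -- by move=> k w km Pw; have [] := step (setv (setv (setv (setv ev 3 j) 4 j') 0 i) 1 k) w i (Ordinal km) j j' Pw erefl erefl erefl erefl.
        -- move=> w Pw; have [_ [_ h]] := step (setv (setv (setv (setv ev 3 j) 4 j') 0 i) 1 i') w i i' j j' Pw erefl erefl erefl erefl.
           exact: h.
        -- move=> k w km Pw; have [_ [h _]] := step (setv (setv (setv (setv ev 3 j) 4 j') 0 i) 1 k) w i (Ordinal km) j j' Pw erefl erefl erefl erefl.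
           exact: h.
      * by move=> k u km Pu; have [_ h] := L1 (setv (setv (setv ev 3 j) 4 j') 0 k) u (Ordinal km) j j' Pu erefl erefl erefl; apply: h.
    + by move=> k t km Pt; have [_ h] := L0 (setv (setv ev 3 j) 4 k) t j (Ordinal km) Pt erefl erefl; apply: h.
  - by move=> k s km Ps; have [_ h] := L4 (setv ev 3 k) s (Ordinal km) Ps erefl; apply: h.
case: (PF) => k1 v1 l1; split=> // i i' j j' ni nj.
(* Otherwise the rectangle with its sources interchanged has the opposite, hence positive, cost, and
   that orientation has been treated too. *)
case: (leP 0 (turncost c i i' j j')) => tc; first exact: reach.
have := @reach i' i j j'; rewrite eq_sym => /(_ _ ni nj) h.
apply: contra (h _); last by rewrite /turncost; move: tc; rewrite /turncost; lra.
by rewrite /full => /and4P[-> -> -> ->].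
Qed.

Definition sound st : Prop := (0 < sn st aFound 0)%N -> flow a b (mx st rBest).

Definition within (w : R) st : Prop :=
  (0 < sn st aFound 0)%N /\ fcost f (mx st rBest) <= w.

Lemma update_spec ev st (st' := den pUpdate ev st) : base st -> sound st ->
  [/\ base st', sound st', sr st' rV = sr st rV, forall w, within w st -> within w st'
    & forall w, valid st (mx st rX) -> fcost f (mx st rX) <= w -> within w st'].
Proof.
move=> bs ss.
have bs' : base st' by apply: base_den.
have vs' : sr st' rV = sr st rV by rewrite /st' den_sr.
rewrite /st' /pUpdate den_if eval_Conj eval_Or eval_LeN eval_Ns eval_Cst eval_LtR !eval_costE // in bs' vs' *.
have [s1 x1] := @copy_spec rBest rX ev st bs isT isT.
have upd1 : (0 < sn (den (PSeq (pCopy rBest rX) (PN aFound N0 N1)) ev st) aFound 0)%N /\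
    mx (den (PSeq (pCopy rBest rX) (PN aFound N0 N1)) ev st) rBest = mx st rX.
  split; first by rewrite den_seq den_N wrn_at.
  by rewrite -x1; apply/funext => i; apply/funext => j; rewrite /mx den_seq den_N wrn_sr.
case: (eval_validE ev rX bs) bs' vs' => [[fl sx]|nv] bs' vs'; last by split.
rewrite andTb in bs' vs' *; case: ifP bs' vs' => h bs' vs'.
  split=> //; rewrite /sound /within; first by case: upd1 => _ ->.
    move=> w [f0 lw]; case: upd1 => -> ->; split=> //.
    case/orP: h => [|/ltW h]; first by rewrite leqNgt f0.
    exact: le_trans h lw.
  by move=> w _ lw; case: upd1 => -> ->.
split=> // w _ lw; move/negbT: h; rewrite negb_or -leNgt -ltnNge => /andP[h1 h2].
by split=> //; apply: le_trans h2 lw.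
Qed.

Definition pTransport := PSeq (PSeq (PSeq (PSeq pAllow pPrice) pGreedy) pSearch) pCancel.

Lemma den_guess ev st : den pGuess ev st = den pUpdate ev (den pTransport ev st).
Proof. by []. Qed.

Lemma transport_keeps ev st :
  keeps [:: rX; rY; rZ; rC; rA; rB; rT; rAl] st (den pTransport ev st).
Proof.
apply: (@sub_keeps (outr pTransport)); last by apply: den_keeps; vm_compute.
by apply/allP; vm_compute.
Qed.

Local Opaque pUpdate pTransport.

Lemma guess_step ev st (st' := den pGuess ev st) : base st -> sound st ->
  [/\ base st', sound st', sr st' rV = sr st rV & forall w, within w st -> within w st'].
Proof.
move=> bs ss; have k1 := transport_keeps ev st.
rewrite /st' den_guess; set st1 := den pTransport ev st in k1 *.
have bs1 : base st1 by apply: keeps_base k1 bs.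
have b1 : mx st1 rBest = mx st rBest by apply: mx_keeps k1.
have f1 : sn st1 = sn st by case: k1.
have ss1 : sound st1 by rewrite /sound b1 f1.
have [h1 h2 h3 h4 _] := update_spec ev bs1 ss1; split=> //.
  by rewrite h3; case: k1 => _; apply.
by move=> w hw; apply: h4; rewrite /within b1 f1.
Qed.

Hypothesis L0 : (0 < L)%N.

(** Every allowed expensive edge is used by [y], so paying for all of them is no loss, and on cheap
    edges the linear cost of [y] is at most its fixed cost. Beyond the cost of [y], the linear
    problem is off by at most [n * n] times [d], and the cheap edges that share a sink cost at most
    as much again. *)
Lemma guess_good ev st y (V := sr st rV 0%N) (d := kap%:R * V / L%:R)
    (st' := den pGuess ev st) : base st -> sound st -> 0 <= V -> flow a b y ->
  supported (allowed st (ev 15%N)) y ->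
  (forall i j, allowed st (ev 15%N) i j -> thr f V L kap i j || (0 < y i j)) ->
  within (fcost f y + (2 * (n * n))%:R * d) st'.
Proof.
move=> bs ss V0 fy sy ay; have k1 := transport_keeps ev st.
rewrite /st' den_guess; set st1 := den pTransport ev st in k1 *.
have bs1 : base st1 by apply: keeps_base k1 bs.
have b1 : mx st1 rBest = mx st rBest by apply: mx_keeps k1.
have f1 : sn st1 = sn st by case: k1.
have ss1 : sound st1 by rewrite /sound b1 f1.
have f0 i j : 0 <= f i j by apply: fixed_cost_ge0.
have b0 j : 0 < b j by rewrite /b ltr0n demand_gt0.
have LR : 0 < L%:R :> R by rewrite ltr0n.
have d0 : 0 <= d by rewrite /d !mulr_ge0 // invr_ge0 ltW.
have cheap i j : thr f V L kap i j -> f i j <= d.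
  by rewrite /thr /d ler_pdivlMr // mulrC.
suff [vx lx] : valid st1 (mx st1 rX) /\
    fcost f (mx st1 rX) <= fcost f y + (2 * (n * n))%:R * d.
  by have [_ _ _ _ upd] := update_spec ev bs1 ss1; apply: upd.
have Est1 : st1 = den pCancel ev (den pSearch ev (den pGreedy ev (den (PSeq pAllow pPrice) ev st))).
  by [].
move: Est1; have := allow_spec ev bs; set s1 := den (PSeq _ _) _ _.
rewrite -/V => -[bs2 V1 al1 c1].
have alE : al s1 = allowed st (ev 15%N) by apply/funext => i; apply/funext => j.
have sy1 : supported (al s1) y by rewrite alE.
have [fx0 sx0] := greedy_spec ev bs2 fy sy1.
have k2 : keeps [:: rX; rA; rB; rT] s1 (den pGreedy ev s1).
  apply: (@sub_keeps (outr pGreedy)); last by apply: den_keeps; vm_compute.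
  by apply/allP; vm_compute.
set s2 := den pGreedy ev s1 in fx0 sx0 k2 *.
have bs3 : base s2 by apply: keeps_base k2 bs2.
have al2 : al s2 = al s1 by apply: al_keeps k2.
have vx0 : valid s2 (mx s2 rX) by split; rewrite ?al2.
have vy2 : valid s2 y by split; rewrite ?al2.
have [k3 vx1 lx1] := search_spec ev bs3 vx0 vy2.
set s3 := den pSearch ev s2 in k3 vx1 lx1 *.
have bs4 : base s3 by apply: keeps_base k3 bs3.
have al3 : al s3 = al s2 by apply: al_keeps k3.
rewrite -(valid_al al3) in vx1.
have [k4 vx2 lx2 nf] := cancel_spec ev bs4 vx1.
set s4 := den pCancel ev s3 in k4 vx2 lx2 nf *; move=> E1.
have al4 : al s4 = al s3 by apply: al_keeps k4.
rewrite -E1 in vx2 lx2 nf al4; rewrite -(valid_al al4) in vx2.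
split=> //.
have cE i j : mx s3 rC i j = if thr f V L kap i j then f i j / b j else 0.
  by rewrite (mx_keeps _ k3) // (mx_keeps _ k2) // c1.
have c2E : mx s2 rC = mx s3 rC by rewrite (mx_keeps _ k3).
rewrite c2E in lx1; set c := mx s3 rC in cE lx1 lx2.
have [fx2 sx2] := vx2.
have cost1 := fcost_forest fx2 sx2 f0 b0 d0 cheap cE nf.
have alf : al st1 = allowed st (ev 15%N) by rewrite al4 al3 al2.
rewrite alf in cost1.
have costy : \sum_i \sum_j (if allowed st (ev 15%N) i j && ~~ thr f V L kap i j then f i j else 0)
    + lin c y <= fcost f y.
  rewrite /lin /fcost -big_split /=; apply: ler_sum => i _.
  rewrite -big_split /=; apply: ler_sum => j _; rewrite cE.
  have := ay i j; have [y0 _ yB] := fy.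
  case: (boolP (thr f V L kap i j)) => tk; rewrite ?andbF ?andbT /= => ay'.
    rewrite add0r; case: ltP => yp; last first.
      by rewrite (le_anti (introT andP (conj yp (y0 i j)))) mulr0.
    rewrite mulrAC ler_pdivrMr //; apply: ler_wpM2l => //.
    by rewrite -yB (bigD1 i) //= lerDl sumr_ge0.
  rewrite mul0r addr0; case: ifP => [/ay' -> //|_]; by case: ifP.
(* A unit sent to sink [j] costs at most [d / b j], so any flow pays at most [d] per sink. *)
have lin0 : lin c (mx s2 rX) <= m%:R * d.
  rewrite /lin exchange_big /= mulr_natl -[X in _ *+ X]card_ord -sumr_const.
  apply: ler_sum => j _; have [x0 _ xB] := fx0.
  apply: (@le_trans _ _ (\sum_i d / b j * mx s2 rX i j)); last first.
    by rewrite -mulr_sumr xB divfK ?gt_eqF.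
  apply: ler_sum => i _; apply: ler_wpM2r => //; rewrite cE; case: ifP => [/cheap h|_].
    by rewrite ler_pM2r ?invr_gt0.
  by rewrite divr_ge0 // ltW.
have linpos x : (forall i j, 0 <= x i j) -> 0 <= lin c x.
  move=> x0; apply: sumr_ge0 => i _; apply: sumr_ge0 => j _; rewrite mulr_ge0 // cE.
  by case: ifP => // _; rewrite divr_ge0 // ltW.
have nn0 : 0 <= (n * n)%:R * d by rewrite mulr_ge0.
(* The bound of [search_spec] is divided by [m * m], which is why the case without sinks is split
   off. *)
have key : lin c (mx s3 rX) <= lin c y + (n * n)%:R * d.
  case: (posnP m) => [m0|m0].
    have z x : lin c x = 0.
      by rewrite /lin big1 // => i _; rewrite big1 // => j; have := ltn_ord j; rewrite {2}m0.
    by rewrite !z add0r.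
  case: lx1 => [h|h]; first by apply: le_trans h _; rewrite lerDl.
  rewrite -lerBlDl; case: (leP (lin c (mx s3 rX) - lin c y) 0) => g0.
    by apply: le_trans g0 _.
  have yl : 0 <= lin c y by apply: linpos; case: fy.
  have mm : 0 < (m * m)%:R :> R by rewrite ltr0n muln_gt0 m0.
  rewrite -(ler_pM2l mm).
  apply: (@le_trans _ _ ((n * n * m + m * m)%:R * (lin c (mx s3 rX) - lin c y))).
    by rewrite ler_pM2r // ler_nat leq_addl.
  apply: le_trans h _.
  apply: (@le_trans _ _ ((n * n * m)%:R * (m%:R * d))); last first.
    by rewrite !natrM; have -> : m%:R * m%:R * (n%:R * n%:R * d) = n%:R * n%:R * m%:R * (m%:R * d) by ring.
  by apply: ler_wpM2l => //; move: lin0 yl; lra.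
apply: le_trans cost1 _; rewrite natrM.
move: costy key lx2 nn0; set S1 := \sum_i _; lra.
Qed.

Hypothesis posE : (2 ^ (n * L) * M * n <= E)%N.

(** Edges are numbered by the rank of their sink among the candidates and not by the sink itself, so
    the positions stay below a number that does not depend on [m]. *)
Lemma guess_code st (y : 'I_n -> 'I_m -> R) (V := sr st rV 0%N) : base st ->
  (forall i j, 0 < y i j -> ~~ thr f V L kap i j -> cand b f V L M j && thr f V L L i j) ->
  exists g, [/\ (g < G)%N, supported (allowed st g) y
    & forall i j, allowed st g i j -> thr f V L kap i j || (0 < y i j)].
Proof.
move=> bs yc.
pose cd := cand b f V L M.
pose K := [set k : 'I_m | cd k].
pose cr (j : 'I_m) := #|[set k : 'I_m | cd k && (k < j)%N]|.
have crE i (j : 'I_m) : pos st i j = (n * cr j + i)%N.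
  rewrite /pos /cr -sum1_card; congr (_ * _ + _)%N.
  by rewrite [RHS]big_mkcond; apply: eq_bigr => k _; rewrite inE -/V -/cd; case: (_ && _).
have crlt (j k : 'I_m) : cd j -> (j < k)%N -> (cr j < cr k)%N.
  move=> cj jk; apply: proper_card; apply/properP; split.
    by apply/subsetP => l; rewrite !inE => /andP[-> lj]; apply: ltn_trans lj jk.
  by exists j; rewrite !inE ?cj ?jk // ltnn andbF.
have crK j : cd j -> (cr j < #|K|)%N.
  move=> cj; apply: proper_card; apply/properP; split.
    by apply/subsetP => l; rewrite !inE => /andP[].
  by exists j; rewrite !inE ?cj // ltnn andbF.
have cardK : (#|K| <= 2 ^ (n * L) * M)%N by apply: card_cand.
have [g gG gE] := base_bit bs (fun t => [exists i : 'I_n, exists j : 'I_m,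
   [&& (n * cr j + i)%N == t, cd j & 0 < y i j]]).
have posb i j : cd j -> bit st g (pos st i j) = (0 < y i j).
  move=> cj; rewrite crE gE; last first.
    apply: leq_trans posE; have := crK _ cj; have := ltn_ord i; nia.
  apply/existsP/idP => [[i' /existsP [j' /and3P[/eqP e cj' yp]]]|yp]; last first.
    by exists i; apply/existsP; exists j; rewrite eqxx cj.
  have n0 : (0 < n)%N by apply: leq_ltn_trans (ltn_ord i).
  have ec : cr j' = cr j.
    have := congr1 (divn^~ n) e.
    by rewrite /= ![(n * _)%N]mulnC !divnMDl // !divn_small // !addn0.
  have ej : j' = j.
    apply: val_inj; case: (ltngtP j' j) => // lt.
      by have := crlt _ _ cj' lt; rewrite ec ltnn.
    by have := crlt _ _ cj lt; rewrite ec ltnn.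
  by move: yp; rewrite ej; move: e; rewrite ec => /addnI/val_inj ->.
exists g; split=> //.
- move=> i j yp; rewrite /allowed -/V; case: (boolP (thr f V L kap i j)) => //= nt.
  by have /andP[c1 t1] := yc _ _ yp nt; rewrite c1 t1 posb.
- move=> i j; rewrite /allowed -/V; case: (thr f V L kap i j) => //= /andP[/andP[c1 _]].
  by rewrite posb.
Qed.

Lemma setV_spec ev st (i0 i1 : 'I_n) (j0 j1 : 'I_m)
    (st' := den (PR rV N0 (MulR (OfN (AddN (ix 13 14) N1)) (fE 11 12))) ev st) :
  base st -> ev 11%N = i0 -> ev 12%N = j0 -> ev 13%N = i1 -> ev 14%N = j1 ->
  sr st' rV 0%N = (i1 * m + j1).+1%:R * f i0 j0.
Proof.
move=> bs e1 e2 e3 e4; rewrite /st' den_R wrr_at eval_MulR (@eval_fE _ _ bs 11 12 i0 j0) //.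
rewrite -[eval (OfN _) _ _]/((eval (ix 13 14) ev st + 1)%:R) eval_ix // e3 e4 addn1.
by [].
Qed.

Lemma scale_step ev st (st' := den pScale ev st) : base st -> sound st ->
  [/\ base st', sound st' & forall w, within w st -> within w st'].
Proof.
move=> bs ss; rewrite /st' /pScale den_seq; set st1 := den _ ev st.
have k1 : keeps [:: rV] st st1 by apply: den_keeps.
have bs1 : base st1 by apply: keeps_base k1 bs.
have b1 : mx st1 rBest = mx st rBest by apply: mx_keeps k1.
have f1 : sn st1 = sn st by case: k1.
apply: (@den_for_inv _ 15 aG pGuess ev st1
  (fun s => [/\ base s, sound s & forall w, within w st -> within w s])).
  by split; [exact: bs1|rewrite /sound b1 f1|move=> w; rewrite /within b1 f1].
move=> k s _ [bs2 ss2 ws2]; have [h1 h2 _ h4] := guess_step (setv ev 15 k) bs2 ss2.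
by split=> // w /ws2/h4.
Qed.

Lemma scale_good ev st y (i0 i1 : 'I_n) (j0 j1 : 'I_m) (st' := den pScale ev st)
    (V := (i1 * m + j1).+1%:R * f i0 j0) (d := kap%:R * V / L%:R) :
  base st -> sound st -> ev 11%N = i0 -> ev 12%N = j0 -> ev 13%N = i1 -> ev 14%N = j1 ->
  flow a b y ->
  (forall i j, 0 < y i j -> ~~ thr f V L kap i j -> cand b f V L M j && thr f V L L i j) ->
  within (fcost f y + (2 * (n * n))%:R * d) st'.
Proof.
move=> bs ss e1 e2 e3 e4 fy yc; rewrite /st' /pScale den_seq.
have := setV_spec bs e1 e2 e3 e4; rewrite -/V; set st1 := den _ ev st => V1.
have k1 : keeps [:: rV] st st1 by apply: den_keeps.
have bs1 : base st1 by apply: keeps_base k1 bs.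
have b1 : mx st1 rBest = mx st rBest by apply: mx_keeps k1.
have f1 : sn st1 = sn st by case: k1.
have ss1 : sound st1 by rewrite /sound b1 f1.
have V0 : 0 <= V by rewrite /V mulr_ge0 //; apply: fixed_cost_ge0.
have yc1 : forall i j, 0 < y i j -> ~~ thr f (sr st1 rV 0%N) L kap i j ->
  cand b f (sr st1 rV 0%N) L M j && thr f (sr st1 rV 0%N) L L i j by rewrite V1.
have [g [gG sg ag]] := guess_code bs1 yc1.
(* The set of allowed edges of a code depends on the scale and the table of bits only, and neither
   is changed by the guesses tried before [g]. *)
pose P s := [/\ base s, sound s, sr s rV 0%N = V & forall c i j, allowed s c i j = allowed st1 c i j].
have Ps k s : P s -> P (den pGuess (setv ev 15 k) s).
  move=> [bs2 ss2 V2 al2]; have [h1 h2 h3 h4] := guess_step (setv ev 15 k) bs2 ss2.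
  split=> //; first by rewrite h3.
  move=> c i j; rewrite -al2 /allowed /pos h3.
  have e : sn (den pGuess (setv ev 15 k) s) aBit = sn s aBit by apply: den_sn; vm_compute.
  by rewrite /bit e.
have P1 : P st1 by [].
apply: (proj2 (@den_for_reach _ 15 aG pGuess ev st1 P
  (within (fcost f y + (2 * (n * n))%:R * d)) G g (base_G bs1) P1 _ _ _ _)) => //.
- by move=> k s _ Pk; apply: Ps.
- move=> s [bs2 ss2 V2 al2].
  have := @guess_good (setv ev 15 g) s y bs2 ss2; rewrite V2 -/d; apply=> //.
  + by move=> i j yp; rewrite al2; apply: sg.
  + by move=> i j; rewrite al2 -V1; apply: ag.
- by move=> k s _ [bs2 ss2 _ _]; have [_ _ _] := guess_step (setv ev 15 k) bs2 ss2; apply.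
Qed.

Local Opaque pScale.

Lemma main_spec ev st y (i0 i1 : 'I_n) (j0 j1 : 'I_m) (w : R) (st' := den pMain ev st)
    (V := (i1 * m + j1).+1%:R * f i0 j0) : base st -> flow a b y ->
  (forall i j, 0 < y i j -> ~~ thr f V L kap i j -> cand b f V L M j && thr f V L L i j) ->
  fcost f y + (2 * (n * n))%:R * (kap%:R * V / L%:R) <= w ->
  flow a b (mx st' rBest) /\ fcost f (mx st' rBest) <= w.
Proof.
move=> bs fy yc yw.
suff [ss [w1 w2]] : (base st' /\ sound st') /\ within w st' by split=> //; apply: ss.2.
pose P s := base s /\ sound s.
rewrite /st' /pMain den_seq; set st1 := den _ ev st.
have P1 : P st1.
  have f0 : sn st1 aFound 0%N = 0%N by rewrite /st1 den_N wrn_at.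
  split; last by rewrite /sound f0.
  by apply: base_den bs.
have sN s : P s -> sn s an 0%N = n by case=> h _; apply: base_n.
have sM s : P s -> sn s am 0%N = m by case=> h _; apply: base_m.
pose p14 := PFor 14 am pScale; pose p13 := PFor 13 an p14; pose p12 := PFor 12 am p13.
have step e s : P s -> P (den pScale e s) /\ (within w s -> within w (den pScale e s)).
  by move=> [b1 s1]; have [h1 h2 h3] := scale_step e b1 s1; split=> //; apply: h3.
have lift v h p : (forall e s, P s -> P (den p e s) /\ (within w s -> within w (den p e s))) ->
    forall e s, P s -> P (den (PFor v h p) e s) /\ (within w s -> within w (den (PFor v h p) e s)).
  move=> H e s Ps; apply: (@den_for_inv _ v h p e s
    (fun s' => P s' /\ (within w s -> within w s'))) => // k s' _ [Ps' ws'].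
  by have [h1 h2] := H (setv e v k) s' Ps'; split=> // /ws'/h2.
have l14 := lift 14 am _ step; have l13 := lift 13 an _ l14; have l12 := lift 12 am _ l13.
have reach v h p k0 N e s : (forall e s, P s -> P (den p e s) /\ (within w s -> within w (den p e s))) ->
    sn s h 0%N = N -> P s -> (k0 < N)%N ->
    (forall s', P s' -> within w (den p (setv e v k0) s')) ->
    within w (den (PFor v h p) e s).
  move=> H hN Ps kN Q; apply: (proj2 (@den_for_reach _ v h p e s P (within w) N k0 hN Ps _ _ _ _)) => //.
  - by move=> k s' _ /(H (setv e v k)) [].
  - by move=> k s' _ /(H (setv e v k)) [].
split.
  by have [] := lift 11 an _ l12 ev st1 P1.
apply: (reach 11 an p12 i0 n ev st1 l12 (sN _ P1) P1 (ltn_ord _)) => s2 P2.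
apply: (reach 12 am p13 j0 m _ s2 l13 (sM _ P2) P2 (ltn_ord _)) => s3 P3.
apply: (reach 13 an p14 i1 n _ s3 l14 (sN _ P3) P3 (ltn_ord _)) => s4 P4.
apply: (reach 14 am pScale j1 m _ s4 step (sM _ P4) P4 (ltn_ord _)) => s5 [b5 s5s].
have [h1 h2] := @scale_good (setv (setv (setv (setv ev 11 i0) 12 j0) 13 i1) 14 j1) s5 y i0 i1 j0 j1
  b5 s5s erefl erefl erefl erefl fy yc.
by split=> //; apply: le_trans h2 yw.
Qed.

End Spec.

(** * Tables of powers and of binary digits *)

(** Each power is obtained from the previous one by adding it [u] times. The sixth power is only a
    step towards the seventh: [pE] overwrites it in [aE]. *)
Definition pPowers := PSeq (PN aKap N0 (SumN 0 aU (Ns aU)))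
  (PSeq (PN aKx N0 (SumN 0 aU (Ns aKap)))
  (PSeq (PN aM N0 (SumN 0 aU (Ns aKx)))
  (PSeq (PN aL N0 (SumN 0 aU (Ns aM)))
  (PSeq (PN aE N0 (SumN 0 aU (Ns aL)))
        (PN aF N0 (SumN 0 aU (Ns aE))))))).
Definition pDouble := PFor 0 aF (PN aE N0 (AddN (Ns aE) (Ns aE))).
Definition pPow := PFor 0 aE (PSeq (PN aPow (Var 0) (Ns aG)) (PN aG N0 (AddN (Ns aG) (Ns aG)))).

Lemma binary_code (E : nat) (q : nat -> bool) :
  exists2 c, (c < 2 ^ E)%N & forall k, (k < E)%N -> odd (c %/ 2 ^ k) = q k.
Proof.
elim: E q => [|E IH] q; first by exists 0%N.
have [c cE cq] := IH (fun k => q k.+1); exists (q 0%N + c.*2)%N.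
  by rewrite expnS mul2n; case: (q 0%N); lia.
case=> [_|k kE]; first by rewrite divn1 oddD odd_double addbF oddb.
rewrite expnS divnMA -cq //; congr (odd (_ %/ _)).
by rewrite -muln2 addnC divnMDl // divn_small ?addn0 //; case: (q 0%N).
Qed.

(** Once the bits above [t] are removed, bit [t] of [c] is read by comparing the remainder with
    [2 ^ t]. *)
Lemma modn_pow2 c t : (c %% 2 ^ t.+1 = odd (c %/ 2 ^ t) * 2 ^ t + c %% 2 ^ t)%N.
Proof.
rewrite {1}(divn_eq c (2 ^ t)) {1}(divn_eq (c %/ 2 ^ t) 2) modn2 mulnDl -mulnA -expnS -addnA.
rewrite modnMDl modn_small // expnS mul2n -addnn.
have : (c %% 2 ^ t < 2 ^ t)%N by rewrite ltn_mod expn_gt0.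
by case: (odd _); rewrite ?mul1n ?mul0n; lia.
Qed.

Section Init.
Variable R : realType.
Implicit Types (st : store R) (ev : nat -> nat).

Lemma den_powers ev st (u := sn st aU 0%N) (st' := den pPowers ev st) :
  [/\ sn st' aKap 0%N = (u ^ 2)%N, sn st' aM 0%N = (u ^ 4)%N, sn st' aL 0%N = (u ^ 5)%N
    & sn st' aF 0%N = (u ^ 7)%N].
Proof.
have S x k (s : store R) h : sn s aU 0%N = u -> sn s h 0%N = (u ^ k)%N ->
    eval (SumN x aU (Ns h)) ev s = (u ^ k.+1)%N.
  by move=> hu hh; rewrite /= hu hh sum_nat_const card_ord expnS.
rewrite /st' /pPowers !den_seq !den_N.
set s1 := wrn st _ _ _; set s2 := wrn s1 _ _ _; set s3 := wrn s2 _ _ _.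
set s4 := wrn s3 _ _ _; set s5 := wrn s4 _ _ _; set s6 := wrn s5 _ _ _.
have u1 : sn s1 aU 0%N = u by [].
have k1 : sn s1 aKap 0%N = (u ^ 2)%N by rewrite wrn_at (S 0%N 1%N) ?expn1.
have k2 : sn s2 aKx 0%N = (u ^ 3)%N by rewrite wrn_at (S 0%N 2).
have k3 : sn s3 aM 0%N = (u ^ 4)%N by rewrite wrn_at (S 0%N 3).
have k4 : sn s4 aL 0%N = (u ^ 5)%N by rewrite wrn_at (S 0%N 4).
have k5 : sn s5 aE 0%N = (u ^ 6)%N by rewrite wrn_at (S 0%N 5).
have k6 : sn s6 aF 0%N = (u ^ 7)%N by rewrite wrn_at (S 0%N 6).
by split.
Qed.

Lemma den_double ev st (st' := den pDouble ev st) :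
  sn st' aE 0%N = (sn st aE 0 * 2 ^ sn st aF 0)%N.
Proof.
apply: (@den_for _ 0 aF _ ev st (fun k s => sn s aE 0%N = sn st aE 0%N * 2 ^ k)%N) => //.
  by rewrite muln1.
by move=> k s _ h; rewrite den_N wrn_at /= h expnS; lia.
Qed.

Lemma den_pow ev st (st' := den pPow ev st) : sn st aG 0%N = 1%N ->
  sn st' aG 0%N = (2 ^ sn st aE 0)%N /\
  forall k, (k < sn st aE 0)%N -> sn st' aPow k = (2 ^ k)%N.
Proof.
move=> g1; apply: (@den_for _ 0 aE _ ev st (fun k s => sn s aG 0%N = (2 ^ k)%N /\
  forall l, (l < k)%N -> sn s aPow l = (2 ^ l)%N)) => //.
move=> k s _ [hg hp]; rewrite den_seq !den_N; split.
  rewrite wrn_at -[eval (AddN _ _) _ _]/(sn s aG 0 + sn s aG 0)%N hg addnn -mul2n -expnS.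
  by [].
move=> l; rewrite wrn_ne // wrn_at /= setv_same ltnS leq_eqVlt hg.
by case: eqP => [->//|_] /=; apply: hp.
Qed.

Lemma table_bits ev st E (st' := den pTable ev st) :
  sn st aE 0%N = E -> sn st aG 0%N = (2 ^ E)%N ->
  (forall k, (k < E)%N -> sn st aPow k = (2 ^ k)%N) ->
  forall c k, (c < 2 ^ E)%N -> (k < E)%N ->
    (0 < sn st' aBit (c * E + k))%N = odd (c %/ 2 ^ k).
Proof.
move=> hE hG hP.
pose fr (s : store R) := sn s aE = sn st aE /\ sn s aPow = sn st aPow.
pose J (c0 : nat) s := fr s /\ forall c k, (c < c0)%N -> (k < E)%N ->
    (0 < sn s aBit (c * E + k))%N = odd (c %/ 2 ^ k).
suff [_] : J (2 ^ E)%N st' by [].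
apply: (@den_for _ 8 aG _ ev st J) => // c s cG [[sE sP] hs].
rewrite den_seq den_N; set s0 := wrn s _ _ _.
pose Q (t : nat) s' := [/\ fr s', sn s' aRest 0%N = (c %% 2 ^ (E - t))%N,
   forall c' k, (c' < c)%N -> (k < E)%N -> (0 < sn s' aBit (c' * E + k))%N = odd (c' %/ 2 ^ k)
   & forall k, (E - t <= k < E)%N -> (0 < sn s' aBit (c * E + k))%N = odd (c %/ 2 ^ k)].
have Qend : Q E (den (PFor 9 aE (let k := SubN (SubN (Ns aE) N1) (Var 9) in
   let at_ := AddN (SumN 21 aE (Var 8)) k in
   PIf (LeN (NArr aPow k) (Ns aRest))
       (PSeq (PN aBit at_ N1) (PN aRest N0 (SubN (Ns aRest) (NArr aPow k))))
       (PN aBit at_ N0))) (setv ev 8 c) s0).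
  apply: den_for; first by rewrite /s0 wrn_ne // sE.
    split.
    - by split; rewrite /s0 wrn_ne.
    - by rewrite /s0 wrn_at /= subn0 modn_small.
    - by move=> c' k lc lk; rewrite /s0 wrn_ne //; apply: hs.
    - by move=> k; rewrite subn0; lia.
  move=> t s1 tE [[fE fP] hr hb hc].
  have E1 : sn s1 aE 0%N = E by rewrite fE.
  set kk := (E - 1 - t)%N.
  have Et : (E - t = kk.+1)%N by rewrite /kk; lia.
  have Et1 : (E - t.+1 = kk)%N by rewrite /kk; lia.
  have kkE : (kk < E)%N by rewrite /kk; lia.
  have pk : sn s1 aPow kk = (2 ^ kk)%N by rewrite fP hP.
  set e := setv (setv ev 8 c) 9 t.
  have ek : eval (SubN (SubN (Ns aE) N1) (Var 9)) e s1 = kk by rewrite /= E1.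
  have ea : eval (AddN (SumN 21 aE (Var 8)) (SubN (SubN (Ns aE) N1) (Var 9))) e s1 = (c * E + kk)%N.
    by rewrite /= E1 sum_nat_const card_ord mulnC.
  have inj c' k : (k < E)%N -> ((c' * E + k == c * E + kk) = (c' == c) && (k == kk))%N.
    move=> kE; apply/eqP/andP => [h|[/eqP -> /eqP ->]] //.
    have E0 : (0 < E)%N by apply: leq_ltn_trans kE.
    have ec : c' = c.
      by have := congr1 (divn^~ E) h; rewrite /= !divnMDl // !divn_small // !addn0.
    by split; apply/eqP => //; move: h; rewrite ec => /addnI.
  have pos : (0 < 2 ^ kk)%N by rewrite expn_gt0.
  have md := modn_pow2 c kk.
  have lt : (c %% 2 ^ kk < 2 ^ kk)%N by rewrite ltn_mod.
  have gd : eval (LeN (NArr aPow (SubN (SubN (Ns aE) N1) (Var 9))) (Ns aRest)) e s1 = odd (c %/ 2 ^ kk).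
    rewrite -[LHS]/(sn s1 aPow (eval (SubN (SubN (Ns aE) N1) (Var 9)) e s1) <= sn s1 aRest 0)%N.
    by rewrite ek pk hr Et md; case: (odd _); rewrite ?mul1n ?mul0n; lia.
  rewrite den_if gd den_seq !den_N ea -[eval N1 e s1]/1%N -[eval N0 e s1]/0%N.
  case: ifP => od.
    set s2 := wrn s1 _ _ _; split.
    - by split; rewrite !wrn_ne.
    - have -> : eval (SubN (Ns aRest) (NArr aPow (SubN (SubN (Ns aE) N1) (Var 9)))) e s2 =
          (sn s2 aRest 0 - sn s2 aPow (eval (SubN (SubN (Ns aE) N1) (Var 9)) e s2))%N by [].
      have -> : eval (SubN (SubN (Ns aE) N1) (Var 9)) e s2 = kk.
        rewrite -[LHS]/(sn s2 aE 0%N - 1 - t)%N.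
        by rewrite (_ : sn s2 aE 0%N = E).
      have r2 : sn s2 aRest 0%N = (2 ^ kk + c %% 2 ^ kk)%N by rewrite /s2 wrn_ne // hr Et md od mul1n.
      have p2 : sn s2 aPow kk = (2 ^ kk)%N by rewrite /s2 wrn_ne.
      by rewrite wrn_at r2 p2 Et1 addKn.
    - move=> c' k lc lk; rewrite wrn_ne // wrn_at inj // (ltn_eqF lc); exact: hb.
    - move=> k; rewrite Et1 => /andP[k1 k2]; rewrite wrn_ne // wrn_at inj // eqxx /=.
      by case: eqP => [->|nk]; [rewrite od|apply: hc; rewrite Et k2 andbT ltn_neqAle k1 eq_sym andbT; apply/eqP].
  split.
  - by split; rewrite !wrn_ne.
  - by rewrite wrn_ne // hr Et Et1 md od mul0n.
  - move=> c' k lc lk; rewrite wrn_at inj // (ltn_eqF lc); exact: hb.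
  - move=> k; rewrite Et1 => /andP[k1 k2]; rewrite wrn_at inj // eqxx /=.
    by case: eqP => [->|nk]; [rewrite od|apply: hc; rewrite Et k2 andbT ltn_neqAle k1 eq_sym andbT; apply/eqP].
case: Qend => -[fE fP] _ hb hc; split; first by split.
move=> c' k; rewrite ltnS leq_eqVlt => /orP[/eqP ->|lc] kE; last exact: hb.
by apply: hc; rewrite subnn kE.
Qed.

End Init.

(** * The scale, and copying the input and the output *)

(** Let [h] be the price of the costliest used edge, and [k] least with [OPT <= k h]. Then
    [(k - 1) h < OPT] and [h <= OPT], so [k h] is at most 2 OPT. Since [k] is between 1 and [n * m],
    the number [k - 1] is written as [i1 * m + j1], which two loops enumerate. *)
Lemma scale_exists (R : archiFieldType) n m (A : 'I_n -> R) (B : 'I_m -> R) f o :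
  flow A B o -> (forall j, 0 < B j) -> (forall i j, 0 <= f i j) -> (0 < m)%N ->
  exists (i0 i1 : 'I_n) (j0 j1 : 'I_m),
    fcost f o <= (i1 * m + j1).+1%:R * f i0 j0 <= 2 * fcost f o.
Proof.
move=> [o0 oA oB] B0 f0 m0.
pose h i j : R := if 0 < o i j then f i j else 0.
have h0 i j : 0 <= h i j by rewrite /h; case: ifP.
pose j' := Ordinal m0.
have [i' oi'] : exists i, 0 < o i j'.
  apply/existsP; apply: contraTT (B0 j') => /existsPn H; rewrite -leNgt -oB.
  by apply: sumr_le0 => i _; rewrite leNgt.
pose a := [arg max_(a > (i', j')) h a.1 a.2]%O.
have amax i j : h i j <= h a.1 a.2 by rewrite /a; case: arg_maxP => // b _ /(_ (i, j) isT).
have cE : fcost f o = \sum_i \sum_j h i j by [].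
have cle : fcost f o <= (n * m)%:R * h a.1 a.2.
  have -> : (n * m = #|{: 'I_n * 'I_m}|)%N by rewrite card_prod !card_ord.
  rewrite cE mulr_natl -sumr_const pair_big.
  by apply: ler_sum => b _; apply: amax.
have c1 i j : h i j <= fcost f o.
  rewrite cE (bigD1 i) //= (bigD1 j) //= -addrA lerDl addr_ge0 ?sumr_ge0 // => k _.
  exact: sumr_ge0.
have n0 : (0 < n)%N by apply: leq_ltn_trans (ltn_ord i').
case: (ltP 0 (fcost f o)) => c0; last first.
  (* If the optimum is zero, any used edge is free and gives the scale 0. *)
  exists i', (Ordinal n0), j', j'.
  have ce : fcost f o = 0.
    by apply: le_anti; rewrite c0 (le_trans (h0 i' j')).
  have fe : f i' j' = 0.
    apply: le_anti; rewrite f0 andbT -ce; have := c1 i' j'.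
    by rewrite /h oi'.
  by rewrite fe ce !mulr0 lexx.
have ha : 0 < h a.1 a.2.
  rewrite lt_neqAle h0 andbT eq_sym; apply/eqP => e.
  by move: cle; rewrite e mulr0 leNgt c0.
have fa : f a.1 a.2 = h a.1 a.2.
  by move: ha; rewrite /h; case: ifP => //; rewrite ltxx.
have ex : exists k, fcost f o <= k%:R * h a.1 a.2 by exists (n * m)%N.
have [k kP kmin] := ex_minnP ex.
have k0 : (0 < k)%N.
  by case: k kP {kmin} => //; rewrite mul0r leNgt c0.
have knm : (k.-1 < n * m)%N.
  by rewrite prednK //; apply: kmin.
have k1 : (k.-1 %/ m < n)%N by rewrite ltn_divLR.
have k2 : (k.-1 %% m < m)%N by rewrite ltn_mod.
exists a.1, (Ordinal k1), a.2, (Ordinal k2).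
rewrite /= -divn_eq prednK // fa kP /=.
have : k.-1%:R * h a.1 a.2 < fcost f o.
  rewrite ltNge; apply/negP => /kmin; rewrite -ltnS prednK // ltnn //.
have kE : k%:R = k.-1%:R + 1 :> R by rewrite natr1 prednK.
by have := c1 a.1 a.2; rewrite kE mulrDl mul1r; lra.
Qed.

Section Concrete.
Variable R : realType.
Implicit Types (s : state R).

(* Copies the input, stored contiguously, to the addresses of array 0; going
   downwards, no cell is overwritten before it is read. *)
Definition cnt := NLoad (NConst 2).
Definition top := NLoad (NConst 3).
Definition cMul := Seq (NStore (NConst 2) (NConst 0))
  (While (BNot (BNLe (NLoad (NConst 0)) cnt))
     (Seq (NStore (NConst 3) (NAdd top (NLoad (NConst 1)))) (NStore (NConst 2) (NAdd cnt (NConst 1))))).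
Definition cSpread := While (BNLe (NConst 1) top)
  (Seq (NStore (NConst 3) (NSub top (NConst 1))) (RStore (at_ 0 top) (RLoad top))).
(** Only the reals are moved: as [addr a 0 = a], the dimensions at addresses 0 and 1 already are the
    scalars [an] and [am]. *)
Definition cPre := Seq (NStore (NConst 3) (NAdd (NLoad (NConst 0)) (NLoad (NConst 1)))) (Seq cMul cSpread).
(** The address [32 * e + 5] read lies above the address [e] written, so this copy goes upwards. *)
Definition cGather := Seq (NStore (NConst 2) (NConst 0)) (While (BNot (BNLe top cnt))
  (Seq (RStore cnt (RLoad (at_ 5 cnt))) (NStore (NConst 2) (NAdd cnt (NConst 1))))).
Definition cPost := Seq (NStore (NConst 3) (NConst 0)) (Seq cMul cGather).

Lemma runs_mul s n m t : nmem s 0 = n -> nmem s 1 = m -> nmem s 3 = t ->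
  runs cMul s (n * 100 + 100) (fun s' => [/\ nmem s' 0 = n, nmem s' 1 = m,
     nmem s' 3 = (t + n * m)%N & rmem s' = rmem s]).
Proof.
move=> e0 e1 e3.
pose J k s' := [/\ nmem s' 0 = n, nmem s' 1 = m, nmem s' 2 = k,
  nmem s' 3 = (t + k * m)%N & rmem s' = rmem s].
apply: (@runs_le _ _ _ (4 + (n * (6 + 16 + 1) + 6 + 1))); last by lia.
apply: (@runs_seq _ _ _ _ _ _ _ (J 0%N)).
  by apply: runs_nstore => //=; split=> //=; rewrite /upd /= ?addn0.
move=> s1 J1; apply: runs_imp (@runs_while _ _ _ _ n 16 J _ _ J1) _ => //.
- by move=> k s2 [h0 h1 h2 h3 hr] kn /=; rewrite h0 h2 -ltnNge.
- move=> k s2 kn [h0 h1 h2 h3 hr]; apply: (@runs_seq _ _ _ _ 8 8 _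
    (fun s3 => [/\ nmem s3 0 = n, nmem s3 1 = m, nmem s3 2 = k, nmem s3 3 = (t + k.+1 * m)%N & rmem s3 = rmem s])).
    apply: runs_nstore => //=; split=> //=; rewrite /upd /= h3 h1 mulSn; lia.
  move=> s3 [g0 g1 g2 g3 gr]; apply: runs_nstore => //=; split=> //=.
  by rewrite /upd /= g2 addn1.
- by move=> s2 [].
Qed.

Lemma runs_pre s n m (v : nat -> R) : nmem s 0 = n -> nmem s 1 = m ->
  (forall p, (p < n + m + n * m)%N -> rmem s p = v p) ->
  runs cPre s (1000 * (n + m + n * m + 1)) (fun s' => [/\ nmem s' 0 = n, nmem s' 1 = m
    & forall p, (p < n + m + n * m)%N -> rmem s' (addr 0 p) = v p]).
Proof.
move=> e0 e1 ev; set q := (n + m + n * m)%N.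
apply: (@runs_le _ _ _ (10 + ((n * 100 + 100) + (q * (4 + 300 + 1) + 4 + 1)))); last by rewrite /q; lia.
apply: (@runs_seq _ _ _ _ _ _ _ (fun s' => [/\ nmem s' 0 = n, nmem s' 1 = m,
   nmem s' 3 = (n + m)%N & rmem s' = rmem s])).
  by apply: runs_nstore => //=; split=> //=; rewrite /upd /= e0 e1.
move=> s1 [f0 f1 f3 fr]; apply: runs_seq (runs_mul f0 f1 f3) _ => s2 [g0 g1 g3 gr].
pose J k s' := [/\ nmem s' 0 = n, nmem s' 1 = m, nmem s' 3 = (q - k)%N,
  forall p, (q - k <= p < q)%N -> rmem s' (addr 0 p) = v p
  & forall p, (p < q - k)%N -> rmem s' p = v p].
have J0 : J 0%N s2.
  split=> //; rewrite ?subn0 // => p; first by lia.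
  by move=> pq; rewrite gr fr ev.
apply: runs_imp (@runs_while _ _ _ _ q 300 J _ _ J0) _.
- by move=> k s3 [h0 h1 h3 _ _] kq /=; rewrite h3; lia.
- move=> k s3 kq [h0 h1 h3 hd hu].
  apply: (@runs_seq _ _ _ _ 100 200 _ (fun s4 => [/\ nmem s4 0 = n, nmem s4 1 = m,
    nmem s4 3 = (q - k.+1)%N & rmem s4 = rmem s3])).
    by apply: runs_nstore => //=; split=> //=; rewrite /upd /= h3; lia.
  move=> s4 [i0 i1 i3 ir]; apply: runs_rstore => //; rewrite at_E /= i3.
  have vq : rmem s4 (q - k.+1)%N = v (q - k.+1)%N by rewrite ir hu //; lia.
  split=> //= p pq; rewrite /upd.
    rewrite addr_eq // eqxx /=; case: eqP => [->//|ne].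
    by rewrite ir hd //; lia.
  have -> : (p == addr 0 (q - k.+1)) = false by apply/eqP; rewrite /addr; lia.
  by rewrite ir hu //; lia.
- move=> s3 [h0 h1 h3 hd _]; split=> // p pq; apply: hd; rewrite subnn; lia.
Qed.

Lemma runs_post s n m (v : nat -> R) : nmem s 0 = n -> nmem s 1 = m ->
  (forall e, (e < n * m)%N -> rmem s (addr 5 e) = v e) ->
  runs cPost s (1000 * (n + m + n * m + 1)) (fun s' =>
    forall e, (e < n * m)%N -> rmem s' e = v e).
Proof.
move=> e0 e1 ev; set q := (n * m)%N.
apply: (@runs_le _ _ _ (10 + ((n * 100 + 100) + (10 + (q * (6 + 300 + 1) + 6 + 1)))));
  last by rewrite /q; lia.
apply: (@runs_seq _ _ _ _ _ _ _ (fun s' => [/\ nmem s' 0 = n, nmem s' 1 = m,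
   nmem s' 3 = 0%N & rmem s' = rmem s])).
  by apply: runs_nstore => //=; split=> //=; rewrite /upd /= e0 e1.
move=> s1 [f0 f1 f3 fr]; apply: runs_seq (runs_mul f0 f1 f3) _ => s2 [g0 g1 g3 gr].
pose J k s' := [/\ nmem s' 2 = k, nmem s' 3 = q,
  forall e, (k <= e < q)%N -> rmem s' (addr 5 e) = v e
  & forall e, (e < k)%N -> rmem s' e = v e].
apply: (@runs_seq _ _ _ _ _ _ _ (J 0%N)).
  apply: runs_nstore => //=; split=> //= e eq.
  by rewrite gr fr ev.
move=> s3 J3; apply: runs_imp (@runs_while _ _ _ _ q 300 J _ _ J3) _.
- by move=> k s4 [h2 h3 _ _] kq /=; rewrite h2 h3 -ltnNge.
- move=> k s4 kq [h2 h3 hu hd].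
  apply: (@runs_seq _ _ _ _ 200 100 _ (fun s5 => [/\ nmem s5 2 = k, nmem s5 3 = q,
    forall e, (k.+1 <= e < q)%N -> rmem s5 (addr 5 e) = v e
    & forall e, (e < k.+1)%N -> rmem s5 e = v e])).
    apply: runs_rstore => //; rewrite rload_at /= h2; split=> //= e; rewrite /upd.
      move=> eq; have -> : (addr 5 e == k) = false by apply/eqP; rewrite /addr; lia.
      by apply: hu; lia.
    rewrite ltnS leq_eqVlt; case: eqP => [->|_] /= lt; [by rewrite hu // leqnn|exact: hd].
  move=> s5 [h5 h6 h7 h8]; apply: runs_nstore => //=; split=> //=.
  by rewrite /upd /= h5 addn1.
- by move=> s4 [_ _ _ hd] e eq; apply: hd.
Qed.

End Concrete.

(** * Choice of the parameters *)

Lemma nth_allpairs_mul (S T U : Type) (x0 : S) (y0 : T) (z0 : U) (h : S -> T -> U) s t i j :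
  (i < size s)%N -> (j < size t)%N ->
  nth z0 [seq h x y | x <- s, y <- t] (i * size t + j) = h (nth x0 s i) (nth y0 t j).
Proof.
elim: s i => // x s IH [|i] /= lt jt.
  by rewrite mul0n nth_cat size_map jt (nth_map y0).
rewrite nth_cat size_map mulSn -addnA ltnNge leq_addr /=.
by rewrite addKn IH.
Qed.

(** The algorithm takes [D = 1]. A larger factor raises [G] to the power [D], which lets [growth] be
    computed by the same code. *)
Definition pE D := PSeq (PN aE N0 (Cst D)) pDouble.
Definition pG := PSeq (PN aG N0 N1) pPow.
Definition pU c := PN aU N0 (AddN (Ns an) (Cst c)).
Definition pPrep c := PSeq (pU c) (PSeq pPowers (PSeq (pE 1) (PSeq pG pTable))).

Lemma den_pE (R : realType) ev (st : store R) D :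
  sn (den (pE D) ev st) aE 0%N = (D * 2 ^ sn st aF 0)%N.
Proof. by rewrite /pE den_seq den_double den_N wrn_at wrn_ne. Qed.

Lemma den_pG (R : realType) ev (st : store R) (st' := den pG ev st) :
  sn st' aG 0%N = (2 ^ sn st aE 0)%N /\ forall k, (k < sn st aE 0)%N -> sn st' aPow k = (2 ^ k)%N.
Proof.
have e1 : sn (den (PN aG N0 N1) ev st) aG 0%N = 1%N by rewrite den_N wrn_at.
have e2 : sn (den (PN aG N0 N1) ev st) aE = sn st aE by rewrite den_N wrn_ne.
by have [h1 h2] := den_pow ev e1; rewrite e2 in h1 h2; split; rewrite /st' /pG den_seq.
Qed.

Section Algorithm.
Variables (R : realType) (n m : nat) (I : pfct R n m).
Let a i : R := (supply I i)%:R.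
Let b j : R := (demand I j)%:R.
Let f := fixed_cost I.
Let q := (n + m + n * m)%N.

Definition input_store (st : store R) : Prop :=
  [/\ sn st an 0%N = n, sn st am 0%N = m
    & forall p, (p < q)%N -> sr st rIn p = rmem (pfct_input I) p].

Lemma input_supply (i : 'I_n) : rmem (pfct_input I) i = a i.
Proof.
rewrite /= nth_cat size_map size_enum_ord ltn_ord (nth_map i) ?size_enum_ord //.
by rewrite nth_ord_enum.
Qed.

Lemma input_demand (j : 'I_m) : rmem (pfct_input I) (n + j)%N = b j.
Proof.
rewrite /= nth_cat size_map size_enum_ord ltnNge leq_addr addKn /=.
rewrite nth_cat size_map size_enum_ord ltn_ord (nth_map j) ?size_enum_ord //.
by rewrite nth_ord_enum.
Qed.

Lemma input_cost (i : 'I_n) (j : 'I_m) : rmem (pfct_input I) (n + m + (i * m + j))%N = f i j.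
Proof.
rewrite /= nth_cat size_map size_enum_ord ltnNge -addnA leq_addr addKn /=.
rewrite nth_cat size_map size_enum_ord ltnNge leq_addr addKn /=.
have := @nth_allpairs_mul _ _ _ i j 0 (fixed_cost I) (enum 'I_n) (enum 'I_m) i j.
by rewrite !size_enum_ord => -> //; rewrite !nth_ord_enum.
Qed.

Lemma prep_base ev st c (u := (n + c)%N) (E := (2 ^ (u ^ 7))%N) : input_store st ->
  base I (u ^ 2) (u ^ 4) (u ^ 5) E (2 ^ E) (den (pPrep c) ev st).
Proof.
move=> [en em eI]; rewrite /pPrep !den_seq.
set st1 := den (pU c) ev st; set st2 := den pPowers ev st1.
set st3 := den (pE 1) ev st2; set st4 := den pG ev st3; set st5 := den pTable ev st4.
have u1 : sn st1 aU 0%N = u by rewrite /st1 den_N wrn_at /u -en.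
have [k2 M2 L2 F2] := den_powers ev st1; rewrite -/st2 u1 in k2 M2 L2 F2.
have E3 : sn st3 aE 0%N = E by rewrite /st3 den_pE F2 mul1n.
have [g4 p4] := den_pG ev st3; rewrite -/st4 E3 in g4 p4.
have E4 : sn st4 aE 0%N = E by rewrite -E3 /st4 den_sn.
have bits := @table_bits R ev st4 E E4 g4 p4.
have sr5 : sr st5 rIn = sr st rIn.
  by rewrite /st5 den_sr // /st4 den_sr // /st3 den_sr // /st2 den_sr // /st1 den_sr.
split.
- by rewrite /st5 den_sn // /st4 den_sn // /st3 den_sn // /st2 den_sn // /st1 den_sn.
- by rewrite /st5 den_sn // /st4 den_sn // /st3 den_sn // /st2 den_sn // /st1 den_sn.
- by rewrite /st5 den_sn // /st4 den_sn // /st3 den_sn.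
- by rewrite /st5 den_sn // /st4 den_sn // /st3 den_sn.
- by rewrite /st5 den_sn // /st4 den_sn // /st3 den_sn.
- by rewrite /st5 den_sn.
- by rewrite /st5 den_sn.
- move=> w; have [cc cE cw] := binary_code E w; exists cc => // k kE.
  by rewrite /bit bits // cw.
- by move=> i; rewrite sr5 eI ?input_supply //; have := ltn_ord i; rewrite /q; lia.
- by move=> j; rewrite sr5 eI ?input_demand //; have := ltn_ord j; rewrite /q; lia.
- move=> i j; rewrite sr5 eI ?input_cost //; have := ltn_ord j; have := ltn_ord i; rewrite /q; nia.
Qed.

(** The excess is OPT / K from the exchanged patterns, [V / K] from rounding and [2 V / K] from the
    cheap edges. With [V <= 2 OPT] this adds up to 7 OPT / K. *)
Lemma main_approx ev st K (eps : R) o : input_store st -> (0 < m)%N -> (0 < K)%N ->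
  7 <= K%:R * eps -> flow a b o ->
  let x : 'I_n -> 'I_m -> R := mx (den pMain ev (den (pPrep (K + 2)) ev st)) rBest in
  flow a b x /\ fcost f x <= (1 + eps) * fcost f o.
Proof.
move=> ist m0 K0 Keps fo x.
set u := (n + (K + 2))%N; have bs := prep_base ev (K + 2) ist; rewrite -/u in bs.
have b0 j : 0 < b j by rewrite /b ltr0n demand_gt0.
have f0 i j : 0 <= f i j by apply: fixed_cost_ge0.
have u2 : (2 <= u)%N by rewrite /u; lia.
have uK : (K.+1 <= u)%N by rewrite /u; lia.
have un : (n <= u)%N by rewrite /u; lia.
have u0 : (0 < u)%N by lia.
have pw i j : (i <= j)%N -> (u ^ i <= u ^ j)%N by move=> ij; rewrite leq_pexp2l.
have lt2 k : (k <= 2 ^ k)%N by apply: ltnW; apply: ltn_expl.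
have nE : (n * n <= 2 ^ (u ^ 7))%N.
  apply: leq_trans (lt2 _); apply: leq_trans (pw 2 7 isT).
  by rewrite expnS expn1 leq_mul.
have L0 : (0 < u ^ 5)%N by rewrite expn_gt0 u0.
(* This fixes the exponent 7: the bound needed is [u ^ 6 + u ^ 4 + u <= 2 * u ^ 6 <= u ^ 7]. *)
have posE : (2 ^ (n * u ^ 5) * u ^ 4 * n <= 2 ^ (u ^ 7))%N.
  apply: (@leq_trans (2 ^ (u ^ 6) * 2 ^ (u ^ 4) * 2 ^ u)).
    apply: leq_mul; first apply: leq_mul => //.
      by rewrite leq_exp2l // expnS leq_mul2r un orbT.
    exact: leq_trans un (lt2 _).
  rewrite -!expnD leq_exp2l //.
  have h4 : (u ^ 4 <= u ^ 5)%N by apply: pw.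
  have h1 : (u ^ 1 <= u ^ 5)%N by apply: pw.
  have h5 : (2 * u ^ 5 <= u ^ 6)%N by rewrite expnS leq_mul2r u2 orbT.
  have h6 : (2 * u ^ 6 <= u ^ 7)%N by rewrite [(u ^ 7)%N]expnS leq_mul2r u2 orbT.
  by rewrite expn1 in h1; lia.
have [i0 [i1 [j0 [j1 /andP[V1 V2]]]]] := scale_exists fo b0 f0 m0.
set V := _ * f i0 j0 in V1 V2.
have kap0 : (0 < u ^ 2)%N by rewrite expn_gt0 u0.
have Kx0 : (0 < u ^ 3)%N by rewrite expn_gt0 u0.
have LE : (u ^ 5 = u ^ 2 * u ^ 3)%N by rewrite -expnD.
have ME : (K.+1 * u ^ 3 <= u ^ 4)%N by rewrite [(u ^ 4)%N]expnS leq_mul2r uK orbT.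
have [y [fy yc yw]] := swap_exists fo b0 f0 V1 kap0 Kx0 K0 LE ME.
apply: (main_spec nE L0 posE ev bs fy yc); rewrite -/V.
apply: le_trans (lerD yw (lexx _)) _.
set OPT := fcost f o in V1 V2 *.
have KR : 0 < K%:R :> R by rewrite ltr0n.
have uR : 0 < u%:R :> R by rewrite ltr0n.
have V0 : 0 <= V by rewrite /V mulr_ge0 // f0.
have O0 : 0 <= OPT by rewrite /OPT /fcost; do 2![apply: sumr_ge0 => ? _]; case: ifP.
have n0 : 0 <= n%:R :> R by [].
have e1 : (2 * n * u ^ 3)%:R * (V / (u ^ 5)%:R) <= V / K%:R.
  rewrite mulrCA; apply: ler_wpM2l => //.
  rewrite ler_pdivrMr ?ltr0n // mulrC ler_pdivlMr // -natrM ler_nat.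
  have : (2 * n * K <= u ^ 2)%N by rewrite /u expnS expn1; nia.
  by rewrite [(u ^ 5)%N](expnD u 2 3) => h; have := leq_mul h (leqnn (u ^ 3)); lia.
have e2 : (2 * (n * n))%:R * ((u ^ 2)%:R * V / (u ^ 5)%:R) <= V * (2 / K%:R).
  have -> : (2 * (n * n))%:R * ((u ^ 2)%:R * V / (u ^ 5)%:R) =
      V * ((2 * (n * n) * u ^ 2)%:R / (u ^ 5)%:R) by rewrite !natrM; ring.
  apply: ler_wpM2l => //.
  rewrite ler_pdivrMr ?ltr0n // mulrAC ler_pdivlMr // -!natrM ler_nat.
  have h1 : (n * n * K <= u ^ 3)%N.
    by rewrite !expnS expn0 muln1 mulnA; apply: leq_mul; [exact: leq_mul|exact: ltnW].
  by rewrite [(u ^ 5)%N](expnD u 2 3); have := leq_mul h1 (leqnn (u ^ 2)); lia.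
have VK : V / K%:R <= 2 * OPT / K%:R by rewrite ler_pM2r // invr_gt0.
have OK : OPT / K%:R * 7 <= eps * OPT.
  have -> : OPT / K%:R * 7 = OPT * (7 / K%:R) by ring.
  rewrite mulrC [leRHS]mulrC [leLHS]mulrC; apply: ler_wpM2l => //.
  by rewrite ler_pdivrMr // mulrC.
have E2 : V * (2 / K%:R) = 2 * (V / K%:R) by ring.
have E3 : 2 * OPT / K%:R = 2 * (OPT / K%:R) by ring.
move: e1 e2 VK OK; rewrite E2 E3; set X1 := _ / K%:R; set X2 := V / K%:R; lra.
Qed.

End Algorithm.

(** * The algorithm *)

Section Stages.
Variable R : realType.
Implicit Types (s : state R) (st : store R).

Definition view s : store R := Store (fun a k => nmem s (addr a k)) (fun a k => rmem s (addr a k)).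

Lemma rel_view ev s : rel [::] ev (view s) s.
Proof. by split. Qed.

(** Every stage has its own list [H] of loop bounds, since it may loop up to a number that an
    earlier stage has computed. *)
Lemma runs_stage (H : seq nat) p c ev st s B T T' (Q : store R -> Prop) :
  wfP [::] p -> all (fun h => h \in H) (bndP p) -> all (fun h => h \notin outn p) H ->
  all (fun h => sn st h 0 <= B)%N H -> rel [::] ev st s ->
  (forall s', rel [::] ev (den p ev st) s' -> runs c s' T (fun s'' => exists st'', rel [::] ev st'' s'' /\ Q st'')) ->
  (tmP B p + T <= T')%N ->
  runs (Seq (compP p) c) s T' (fun s'' => exists st'', rel [::] ev st'' s'' /\ Q st'').
Proof.
move=> w /allP sub /allP out /allP hB r next lT.
apply: runs_le lT; apply: runs_seq next.
by apply: compP_ok r => //; [exact: sub|exact: out|exact: hB].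
Qed.

Lemma runs_last (H : seq nat) p ev st s B T' (Q : store R -> Prop) :
  wfP [::] p -> all (fun h => h \in H) (bndP p) -> all (fun h => h \notin outn p) H ->
  all (fun h => sn st h 0 <= B)%N H -> rel [::] ev st s -> Q (den p ev st) ->
  (tmP B p <= T')%N ->
  runs (compP p) s T' (fun s'' => exists st'', rel [::] ev st'' s'' /\ Q st'').
Proof.
move=> w /allP sub /allP out /allP hB r q lT.
apply: runs_le lT.
apply: runs_imp (compP_ok w sub out hB r) _ => s' r'.
by exists (den p ev st).
Qed.

End Stages.

Definition cAlg c := Seq cPre (Seq (Seq (compP (pU c)) (Seq (compP pPowers) (Seq (compP (pE 1))
  (Seq (compP pG) (compP pBody))))) cPost).

Definition tAlg B := (tmP B (pU 0) + (tmP B pPowers + (tmP B (pE 1) + (tmP B pG + tmP B pBody))))%N.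

Lemma runs_alg (R : realType) n m (I : pfct R n m) K (eps : R) o
    (u := (n + (K + 2))%N) (G := (2 ^ (2 ^ (u ^ 7)))%N) (B := (G * m.+1)%N) :
  (0 < K)%N -> 7 <= K%:R * eps -> optimal I o ->
  runs (cAlg (K + 2)) (pfct_input I) (8 * (1000 * B) + tAlg B) (fun s' =>
    approx_solution I eps (pfct_output n m s')).
Proof.
move=> K0 Keps [[o0 oA oB] omin].
have G0 : (0 < G)%N by rewrite expn_gt0.
have u0 : (0 < u)%N by rewrite /u; lia.
have lt2 k : (k <= 2 ^ k)%N by apply: ltnW; apply: ltn_expl.
have pw i j : (i <= j)%N -> (u ^ i <= u ^ j)%N by move=> ij; rewrite leq_pexp2l.
have EG : (2 ^ (u ^ 7) <= G)%N by apply: lt2.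
have u7G : (u ^ 7 <= G)%N by apply: leq_trans (lt2 _) EG.
have uG : (u <= G)%N by apply: leq_trans u7G; have := pw 1%N 7 isT; rewrite expn1.
have nG : (n <= G)%N by apply: leq_trans uG; rewrite /u; lia.
have GB : (G <= B)%N by rewrite /B leq_pmulr.
have mB : (m <= B)%N by rewrite /B; apply: leq_trans (leq_pmull _ G0).
have nmB : (n * m <= B)%N by rewrite /B leq_mul.
have le_B k : (k <= G)%N -> (k <= B)%N by move=> h; apply: leq_trans GB.
pose ev := fun _ : nat => 0%N.
apply: (@runs_le _ _ _ (1000 * (n + m + n * m + 1) + ((tAlg B) + 1000 * (n + m + n * m + 1)))); last first.
  have arith (x y z t w : nat) : (x <= w -> y <= w -> z <= w -> 0 < w ->
    1000 * (x + y + z + 1) + (t + 1000 * (x + y + z + 1)) <= 8 * (1000 * w) + t)%N by lia.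
  by apply: arith; [exact: le_B|exact: mB|exact: nmB|exact: leq_trans G0 GB].
have e0 : nmem (pfct_input I) 0 = n by [].
have e1 : nmem (pfct_input I) 1 = m by [].
apply: runs_seq (runs_pre e0 e1 (fun p _ => erefl)) _ => s1 [h0 h1 hp].
pose st := view s1.
have ist : input_store I st by split.
set st1 := den (pU (K + 2)) ev st; set st2 := den pPowers ev st1.
set st3 := den (pE 1) ev st2; set st4 := den pG ev st3.
have [en em _] := ist.
have U1 : sn st1 aU 0%N = u by rewrite /st1 den_N wrn_at; apply: (congr1 (addn^~ (K + 2)%N) en).
have [k2 M2 L2 F2] := den_powers ev st1; rewrite -/st2 U1 in k2 M2 L2 F2.
have E3 : sn st3 aE 0%N = (2 ^ (u ^ 7))%N by rewrite /st3 den_pE F2 mul1n.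
have [g4 p4] := den_pG ev st3; rewrite -/st4 E3 in g4 p4.
have E4 : sn st4 aE 0%N = (2 ^ (u ^ 7))%N by rewrite -E3 /st4 den_sn.
have n4 : sn st4 an 0%N = n.
  by rewrite /st4 den_sn // /st3 den_sn // /st2 den_sn // /st1 den_sn //; case: ist.
have m4 : sn st4 am 0%N = m.
  by rewrite /st4 den_sn // /st3 den_sn // /st2 den_sn // /st1 den_sn //; case: ist.
have L4 : sn st4 aL 0%N = (u ^ 5)%N.
  by rewrite /st4 den_sn // /st3 den_sn.
pose stF := den pBody ev st4.
apply: (@runs_seq _ _ _ _ _ _ _ (fun s => exists st'', rel [::] ev st'' s /\ st'' = stF)).
  apply: (@runs_stage _ [::] (pU (K + 2)) _ ev st s1 B); try exact: rel_view; try by [].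
    move=> s2 r2; apply: (@runs_stage _ [:: aU] pPowers _ ev _ s2 B) r2 _ (leqnn _) => //.
      by apply/andP; split=> //; rewrite U1 le_B.
    move=> s3 r3; apply: (@runs_stage _ [:: aF] (pE 1) _ ev _ s3 B) r3 _ (leqnn _) => //.
      by apply/andP; split=> //; rewrite F2 le_B.
    move=> s4 r4; apply: (@runs_stage _ [:: aE] pG _ ev _ s4 B) r4 _ (leqnn _) => //.
      by apply/andP; split=> //; rewrite E3 le_B.
    move=> s5 r5; apply: (@runs_last _ [:: an; am; aL; aE; aG] pBody ev _ s5 B) r5 _ (leqnn _).
    - exact: wf_body.
    - by apply/allP; exact: bnd_body.
    - exact: out_body.
    - apply/and5P; split; [by rewrite n4 le_B|by rewrite m4|rewrite L4 le_B //|by rewrite E4 le_B|by rewrite andbT g4 le_B].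
      exact: leq_trans (pw 5 7 isT) u7G.
    - by [].
  exact: leqnn.
move=> s6 [w [+ wE]]; rewrite {}wE => -[_ r2 r3].
have nF : nmem s6 0 = n by rewrite -[0%N]/(addr an 0) r2 // /stF den_sn //; vm_compute.
have mF : nmem s6 1 = m by rewrite -[1%N]/(addr am 0) r2 // /stF den_sn //; vm_compute.
have B6 e : (e < n * m)%N -> rmem s6 (addr 5 e) = sr stF rBest e by move=> _; apply: (r3 rBest e isT).
apply: runs_imp (runs_post nF mF B6) _.
move=> s7 h7.
have outE : forall i j, pfct_output n m s7 i j = @mx R n m stF rBest i j.
  move=> i j; rewrite mxE h7 //; have := ltn_ord i; have := ltn_ord j; nia.
suff [[x0 xA xB] xc] : flow (fun i => (supply I i)%:R) (fun j => (demand I j)%:R) (@mx R n m stF rBest) /\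
    fcost (fixed_cost I) (@mx R n m stF rBest) <= (1 + eps) * fcost (fixed_cost I) (fun i j => o i j).
  split.
    split=> [i j|i|j]; first by rewrite outE.
      by under eq_bigr do rewrite outE.
    by under eq_bigr do rewrite outE.
  exists o; first by split.
  rewrite /cost; under eq_bigr => i _ do under eq_bigr => j _ do rewrite outE.
  exact: xc.
(* Without sinks the total supply is zero; supplies being positive, there are no sources either, and
   the empty matrix is a solution. *)
case: (posnP m) => [m0|m0].
  have n0 : n = 0%N.
    have := supply_demand I; rewrite [in RHS]big1; last by move=> j; have := ltn_ord j; rewrite {2}m0.
    case: (posnP n) => // n0 /eqP; rewrite sum_nat_eq0 => /forallP/(_ (Ordinal n0)).
    by rewrite eqn0Ngt supply_gt0.
  split; first by split=> [i|i|j]; [have := ltn_ord i|have := ltn_ord i|have := ltn_ord j];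
    rewrite ?{2}n0 ?{2}m0.
  by rewrite /fcost !big1 ?mulr0 // => i; have := ltn_ord i; rewrite {2}n0.
apply: (@main_approx _ _ _ I ev st K eps (fun i j => o i j) ist m0 K0 Keps).
by split.
Qed.

(** * The function of the number of sources *)

(** The least [K] with [K * eps > 7]. The program finds it by counting upwards, as a real number
    cannot be converted to a natural one. *)
Definition precision (R : realType) (eps : R) : nat := (Num.truncn (7 / eps)).+1.

Lemma precisionP (R : realType) (eps : R) : 0 < eps ->
  (forall k, (k < precision eps)%N = (k%:R * eps <= 7)) /\ (precision eps)%:R <= 7 / eps + 1.
Proof.
move=> e0; have q0 : 0 <= 7 / eps by rewrite divr_ge0 // ltW.
split=> [k|]; first by rewrite ltnS truncn_ge_nat // ler_pdivlMr.
by rewrite -[leLHS]natr1 lerD2r; have /andP[] := truncn_itv q0.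
Qed.

(** This is [G ^ D], which dominates a polynomial of degree [D] in [G]; its binary logarithm bounds
    all loops that compute it. *)
Definition growth D (R : realType) n (eps : R) : nat :=
  (2 ^ (D * 2 ^ ((n + (precision eps + 2)) ^ 7)))%N.

Definition cPrecision := While (BRLe (RMul (RNat (NLoad (NConst 2))) (RLoad (NConst 0))) (RNat (NConst 7)))
  (NStore (NConst 2) (NAdd (NLoad (NConst 2)) (NConst 1))).
Definition pSum := PN aU N0 (AddN (AddN (Ns an) (Ns aU)) (Cst 2)).
Definition pOut := PN an N0 (Ns aG).
Definition cGrowth D := Seq cPrecision (Seq (compP pSum) (Seq (compP pPowers) (Seq (compP (pE D))
  (Seq (compP pG) (compP pOut))))).
Definition tGrowth D B :=
  (tmP B pSum + (tmP B pPowers + (tmP B (pE D) + (tmP B pG + tmP B pOut))))%N.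

Lemma runs_precision (R : realType) n (eps : R) (K := precision eps) : 0 < eps ->
  runs cPrecision (load [:: n] [:: eps]) (26 * K) (fun s => nmem s 0 = n /\ nmem s 2 = K).
Proof.
move=> e0; have [Kl _] := precisionP e0.
pose J k (s : state R) := [/\ nmem s 0 = n, nmem s 2 = k & rmem s 0%N = eps].
have J0 : J 0%N (load [:: n] [:: eps]) by [].
apply: (@runs_le _ _ _ (K * (9 + 6 + 1) + 9 + 1)); last by rewrite /K /precision; lia.
apply: runs_imp (@runs_while _ _ _ _ K 6 J _ _ J0) _.
- by move=> k s [h0 h2 hr] _ /=; rewrite h2 hr Kl.
- move=> k s _ [h0 h2 hr]; apply: runs_nstore => //=; split=> //=.
  by rewrite /upd /= h2 addn1.
- by move=> s [].
Qed.

Lemma runs_growth (R : realType) D n (eps : R) (K := precision eps)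
    (B := (D * 2 ^ ((n + (K + 2)) ^ 7))%N) : 0 < eps -> (0 < D)%N ->
  runs (cGrowth D) (load [:: n] [:: eps]) (26 * K + tGrowth D B)
    (fun s => nmem s 0 = growth D n eps).
Proof.
move=> e0 D0; set u := (n + (K + 2))%N in B *.
have lt2 k : (k <= 2 ^ k)%N by apply: ltnW; apply: ltn_expl.
have u0 : (0 < u)%N by rewrite /u; lia.
have EB : (2 ^ (u ^ 7) <= B)%N by rewrite /B leq_pmull.
have u7B : (u ^ 7 <= B)%N by apply: leq_trans (lt2 _) EB.
have uB : (u <= B)%N by apply: leq_trans u7B; rewrite -{1}(expn1 u) leq_pexp2l.
pose ev := fun _ : nat => 0%N.
apply: runs_seq (runs_precision n e0) _ => s1 [h0 h2].
pose st := view s1.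
set st1 := den pSum ev st; set st2 := den pPowers ev st1.
set st3 := den (pE D) ev st2; set st4 := den pG ev st3.
have U1 : sn st1 aU 0%N = u.
  rewrite /st1 den_N wrn_at; transitivity (nmem s1 0 + nmem s1 2 + 2)%N; first by [].
  by rewrite h0 h2 /u addnA.
have [_ _ _ F2] := den_powers ev st1; rewrite -/st2 U1 in F2.
have E3 : sn st3 aE 0%N = B by rewrite /st3 den_pE F2.
have [g4 _] := den_pG ev st3; rewrite -/st4 E3 in g4.
pose stF := den pOut ev st4.
have -> : growth D n eps = sn stF an 0%N by rewrite /stF den_N wrn_at; apply/esym.
apply: (@runs_imp _ _ _ _ (fun s => exists st'', rel [::] ev st'' s /\ st'' = stF)); last first.
  move=> s6 [w [+ wE]]; rewrite {}wE => -[_ r2 _].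
  by rewrite -[0%N]/(addr an 0) r2.
apply: (@runs_stage _ [::] pSum _ ev st s1 B); try exact: rel_view; try by [].
  move=> s2 r2; apply: (@runs_stage _ [:: aU] pPowers _ ev _ s2 B) r2 _ (leqnn _) => //.
    by apply/andP; split=> //; rewrite U1.
  move=> s3 r3; apply: (@runs_stage _ [:: aF] (pE D) _ ev _ s3 B) r3 _ (leqnn _) => //.
    by apply/andP; split=> //; rewrite F2.
  move=> s4 r4; apply: (@runs_stage _ [:: aE] pG _ ev _ s4 B) r4 _ (leqnn _) => //.
    by apply/andP; split=> //; rewrite E3.
  by move=> s5 r5; apply: (@runs_last _ [::] pOut ev _ s5 B) r5 _ (leqnn _).
exact: leqnn.
Qed.

Lemma growth_efficient (R : realType) D : (0 < D)%N -> efficiently_computable (@growth D R).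
Proof.
move=> D0.
have [C [d Cd]] : polyb (tGrowth D).
  by rewrite /tGrowth; do 4!apply: (polyb_add (tmP_polyb _)); exact: tmP_polyb.
exists (cGrowth D), (10 + C + d)%N => n eps e0.
have [t [s [ex lt sE]]] := runs_growth n e0 D0; exists t, s; split=> //.
have [_ Kle] := precisionP e0; set K := precision eps in Kle lt *.
set B := (D * _)%N in lt.
have -> : trunc_log 2 (growth D n eps) = B by rewrite trunc_expnK.
have B0 : (0 < B)%N by rewrite muln_gt0 D0 expn_gt0.
set X : R := _ + 2.
have i0 : 0 < eps^-1 by rewrite invr_gt0.
have n0 : 0 <= n%:R :> R by [].
have b0 : 0 <= B%:R :> R by [].
have X2 : 2 <= X by rewrite /X; lra.
have X1 : 1 <= X by lra.
have X0 : 0 <= X by lra.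
have BX : B%:R <= X by rewrite /X; lra.
have KX : K%:R <= 7 * X by apply: le_trans Kle _; rewrite /X; lra.
apply: (@le_trans _ _ (26 * K%:R + C%:R * B%:R ^+ d)).
  rewrite -natrX -!natrM -natrD ler_nat.
  by apply: leq_trans lt _; rewrite leq_add2l Cd.
(* As [X] is at least 2, the constant [C] is absorbed by [X ^+ C], the product [26 * K] by [X ^+ 9],
   and the sum of two terms by one more factor. *)
have C2 : C%:R <= X ^+ C.
  apply: (@le_trans _ _ (2 ^+ C)); last by rewrite lerXn2r // nnegrE.
  by rewrite -natrX ler_nat ltnW // ltn_expl.
have Y1 : 1 <= X ^+ (C + d) by rewrite exprn_ege1.
have Z1 : X * 2 ^+ 8 <= X ^+ 9 by rewrite [X ^+ 9]exprS ler_wpM2l // lerXn2r // nnegrE.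
have Z0 : 1 <= X ^+ 9 by rewrite exprn_ege1.
have h1 : 26 * K%:R <= X ^+ 9 * X ^+ (C + d).
  apply: le_trans (ler_peMr (le_trans ler01 Z0) Y1).
  by apply: le_trans Z1; lra.
have h2 : C%:R * B%:R ^+ d <= X ^+ 9 * X ^+ (C + d).
  apply: le_trans (ler_peMl (le_trans ler01 Y1) Z0).
  by rewrite exprD ler_pM // ?exprn_ge0 // lerXn2r.
apply: le_trans (lerD h1 h2) _.
have -> : X ^+ (10 + C + d) = X * (X ^+ 9 * X ^+ (C + d)) by rewrite mulrA -exprS -exprD addnA.
rewrite -mulr2n -mulr_natl ler_wpM2r //.
by rewrite mulr_ge0 // exprn_ge0.
Qed.

Theorem theorem1p8 (R : realType) :
  exists (g : nat -> R -> nat) (p : {poly nat}),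
    efficiently_computable g /\
    forall eps : R, 0 < eps ->
      exists A : cmd, forall (n m : nat) (I : pfct R n m),
        exists (t : nat) (s : state R),
          [/\ exec A (pfct_input I) t s,
              (t <= g n eps * p.[m])%N
            & approx_solution I eps (pfct_output n m s)].
Proof.
have [C [d Cd]] : polyb (fun B => 8 * (1000 * B) + tAlg B)%N.
  apply: polyb_add; last by rewrite /tAlg; do 4!apply: (polyb_add (tmP_polyb _)); exact: tmP_polyb.
  apply: polyb_mul; first exact: polyb_const.
  by apply: polyb_mul; [exact: polyb_const|exact: polyb_id].
(* Here [growth d.+1] is [G ^ d.+1]; the exponent [d.+1] instead of [d] keeps the factor [D]
   positive. The bound on the time is a constant times a power of [G * m.+1], which splits into this
   number and a polynomial in [m]. *)
exists (@growth d.+1 R), (C%:P * ('X + 1) ^+ d.+1); split; first exact: growth_efficient.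
move=> eps e0; set K := precision eps.
have [Kl _] := precisionP e0.
have Keps : 7 <= K%:R * eps by rewrite ltW // ltNge -Kl ltnn.
exists (cAlg (K + 2)) => n m I.
have [o oI] := optimal_exists I.
have [t [s [ex lt ok]]] := runs_alg (isT : (0 < K)%N) Keps oI.
exists t, s; split=> //; apply: leq_trans lt _.
apply: leq_trans (Cd _ _) _; first by rewrite muln_gt0 expn_gt0.
have -> : (C%:P * ('X + 1) ^+ d.+1).[m] = (C * m.+1 ^ d.+1)%N.
  by rewrite !hornerE; congr (_ * _ ^ _)%N; apply: addn1.
rewrite /growth mulnCA leq_mul2l; apply/orP; right.
rewrite [(d.+1 * _)%N]mulnC expnM -expnMn leq_pexp2l //.
by rewrite muln_gt0 expn_gt0.
Qed.
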